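(* Let $f:(\mathbb{C}^2,0)\to(\mathbb{C},0)$ be a holomorphic germ with no repeated irreducible factors, and suppose that $f$ has no smooth components. Then the set $\mathcal{I}(f)$ is finite, and consequently both $I_f$ and $V_f$ are finite.
   Context: $\mathcal{O}_2$ is the ring of germs at $0$ of holomorphic functions on $\mathbb{C}^2$; $m(f,g)=\dim_{\mathbb{C}}\mathcal{O}_2/\langle f,g\rangle$ is the intersection number. A component of $f$ is the curve germ $\{f_i=0\}$ of an irreducible factor $f_i$ of $f$; it is smooth if $f_i$ is a submersion at $0$. $\mathcal{I}(f)\subset\mathbb{N}$ is the set of all (finite) natural numbers occurring as the order of vanishing at $0$ of $f\circ\alpha$, as $\alpha$ ranges over all germs of holomorphic immersions $(\mathbb{C},0)\to(\mathbb{C}^2,0)$. Put $$i_f=f_y^2f_{xx}-2f_xf_yf_{xy}+f_x^2f_{yy},$$ $$v_f=(f_x^2+f_y^2)\left(f_x^3f_{yyy}-3f_x^2f_yf_{xyy}+3f_xf_y^2f_{xxy}-f_y^3f_{xxx}\right)-3\left((f_x^2-f_y^2)f_{xy}-f_xf_y(f_{xx}-f_{yy})\right)i_f,$$ and $I_f=m(f,i_f)$, $V_f=m(f,v_f)$, a priori in $\mathbb{N}\cup\{0,\infty\}$. *)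

(* Defs.v *)
From HB Require Import structures.
From mathcomp Require Import all_boot all_order all_algebra.
From mathcomp Require Import complex.
From mathcomp Require Import all_classical all_reals all_analysis.

Set Implicit Arguments.
Unset Strict Implicit.
Unset Printing Implicit Defensive.

Import Order.TTheory GRing.Theory Num.Theory.
Import numFieldNormedType.Exports.

Local Open Scope classical_set_scope.
Local Open Scope ring_scope.

(* The field R[i] of complex numbers, packaged so that it carries the topology
   and normed-module structure of a numFieldType.  Its order is partial:
   0 < r means that r is real and positive. *)
Definition Cplx (R : realType) : numClosedFieldType := R[i].

Section Germs.
Variable R : realType.
Local Notation C := (Cplx R).

(* Germs at 0 are represented by functions, equality of germs being equality
   near 0.  Holomorphy is taken in Weierstrass's sense: near 0 the function is
   the sum of a convergent power series.  Values away from 0 are irrelevant to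
   every definition below. *)
Definition eq_germ (T : topologicalType) (U : Type) (z : T) (f g : T -> U) :=
  \forall w \near z, f w = g w.

Definition holo1 (phi : C -> C) : Prop :=
  exists (a : nat -> C) (r : C), 0 < r /\
    forall t : C, `|t| < r -> series (fun n => a n * t ^+ n) @ \oo --> phi t.

(* The series is required to converge absolutely at (r, r), so that the square
   partial sums compute its unconditional sum on the polydisc of radius r. *)
Definition holo2 (f : C * C -> C) : Prop :=
  exists (a : nat -> nat -> C) (r M : C), [/\ 0 < r,
    forall n, \sum_(i < n) \sum_(j < n) `|a i j| * r ^+ i * r ^+ j <= M &
    forall z : C * C, `|z.1| < r -> `|z.2| < r ->
      (fun n => \sum_(i < n) \sum_(j < n) a i j * z.1 ^+ i * z.2 ^+ j) @ \oo
        --> f z].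

Definition is_unit (u : C * C -> C) : Prop :=
  exists2 v, holo2 v & eq_germ (0 : C * C) (u \* v) (fun=> 1).

Definition divides (g f : C * C -> C) : Prop :=
  exists2 q, holo2 q & eq_germ (0 : C * C) f (q \* g).

Definition irreducible (g : C * C -> C) : Prop :=
  [/\ holo2 g, ~ eq_germ (0 : C * C) g (fun=> 0), ~ is_unit g &
    forall a b, holo2 a -> holo2 b -> eq_germ (0 : C * C) g (a \* b) ->
      is_unit a \/ is_unit b].

Definition no_repeated_factor (f : C * C -> C) : Prop :=
  forall g, irreducible g -> ~ divides (g \* g) f.

Definition dx (f : C * C -> C) : C * C -> C := 'D_(1, 0) f.
Definition dy (f : C * C -> C) : C * C -> C := 'D_(0, 1) f.

Definition submersion0 (g : C * C -> C) : Prop := (dx g 0, dy g 0) <> (0, 0).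

Definition no_smooth_component (f : C * C -> C) : Prop :=
  forall g, irreducible g -> divides g f -> ~ submersion0 g.

Definition immersion_germ (alpha : C -> C * C) : Prop :=
  [/\ holo1 (fst \o alpha), holo1 (snd \o alpha), alpha 0 = 0 &
    derive1 alpha 0 <> 0].

(* The index of the first nonzero derivative at 0; no k qualifies when h
   vanishes identically near 0. *)
Definition vanishing_order (h : C -> C) (k : nat) : Prop :=
  (forall j, (j < k)%N -> derive1n j h 0 = 0) /\ derive1n k h 0 <> 0.

Definition contact_orders (f : C * C -> C) : set nat :=
  [set k | exists2 alpha, immersion_germ alpha & vanishing_order (f \o alpha) k].

Definition in_ideal (f g h : C * C -> C) : Prop :=
  exists a b, [/\ holo2 a, holo2 b &
    eq_germ (0 : C * C) h (fun z => a z * f z + b z * g z)].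

Definition independent_mod (f g : C * C -> C) (n : nat)
    (h : 'I_n -> C * C -> C) : Prop :=
  (forall i, holo2 (h i)) /\
  forall c : 'I_n -> C,
    in_ideal f g (fun z => \sum_(i < n) c i * h i z) -> forall i, c i = 0.

(* The dimension over C of the quotient of the ring of germs by <f, g>: the
   supremum in [0, +oo] of the sizes of the linearly independent families. *)
Definition intersection_number (f g : C * C -> C) : \bar R :=
  ereal_sup [set (n%:R)%:E | n in
    [set n | exists h : 'I_n -> C * C -> C, independent_mod f g h]].

Definition inflection_germ (f : C * C -> C) : C * C -> C := fun z =>
  let fx := dx f z in let fy := dy f z in
  let fxx := dx (dx f) z in let fxy := dy (dx f) z in
  let fyy := dy (dy f) z in
  fy ^+ 2 * fxx - 2 * fx * fy * fxy + fx ^+ 2 * fyy.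

Definition vertex_germ (f : C * C -> C) : C * C -> C := fun z =>
  let fx := dx f z in let fy := dy f z in
  let fxx := dx (dx f) z in let fxy := dy (dx f) z in
  let fyy := dy (dy f) z in
  let fxxx := dx (dx (dx f)) z in let fxxy := dy (dx (dx f)) z in
  let fxyy := dy (dy (dx f)) z in let fyyy := dy (dy (dy f)) z in
  (fx ^+ 2 + fy ^+ 2) *
    (fx ^+ 3 * fyyy - 3 * fx ^+ 2 * fy * fxyy + 3 * fx * fy ^+ 2 * fxxy
     - fy ^+ 3 * fxxx)
  - 3 * ((fx ^+ 2 - fy ^+ 2) * fxy - fx * fy * (fxx - fyy))
    * inflection_germ f z.

End Germs.

(* Main.v *)
(** Work in the ring O of convergent power series in (X, Y).  No smooth germ
    divides f, in particular X does not, so f(0, Y) <> 0 and Weierstrass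
    division by f and by its factors is available without change of
    coordinates.  Division replaces unique factorisation: an ideal of O closed
    under division by X is principal.  Hence irreducible factors of f are prime,
    and two germs without common irreducible factor generate a power of X.

    Contact orders.  As f is reduced, X^N lies in (f, f_y).  An arc (a, b) with
    a'(0) <> 0 along which f vanishes to order more than 2N can be corrected,
    as in Tougeron's implicit function theorem, to an arc on which f vanishes
    identically; its image is a smooth component of f.  Arcs with b'(0) <> 0 are
    treated by exchanging the coordinates.

    Inflections and vertices.  If a component g of f divides i_f, its slope is
    annihilated by the derivation H = f_y d/dx - f_x d/dy, and if g divides v_f,
    so are its centre of curvature and radius (or its tangent is isotropic).
    Functions on g killed by H are constants, being algebraic over C{x}; so g
    lies on a line or a circle and is smooth.  Otherwise (f, i_f) and (f, v_f)
    contain a power of X, and O modulo (f, X^N) has finite dimension. *)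
Require Import Defs.
From HB Require Import structures.
From mathcomp Require Import all_boot all_order all_algebra.
From mathcomp Require Import complex.
From mathcomp Require Import all_classical all_reals all_analysis.
From mathcomp Require Import ring zify.

Set Implicit Arguments.
Unset Strict Implicit.
Unset Printing Implicit Defensive.

Import Order.TTheory GRing.Theory Num.Theory.
Import numFieldNormedType.Exports.

Local Open Scope classical_set_scope.
Local Open Scope ring_scope.

(** * Formal power series *)

(** The statement concerns functions; the argument is algebra in a ring whose members must converge.
    A germ is a double sequence bounded by some [M * t ^+ (i + j)], and every recursive construction
    (inverse, division, substitution) has to reproduce such a bound. The map [ev] from germs to
    functions is injective up to equality near 0, so laws of substitution are checked on values. The
    invariant behind the vertices is the squared curvature I^2 / s^3, with I = i_f and s = f_x^2 +
    f_y^2: its derivative along H is -2 I v_f / s^4. Such quotients are not germs. A first integral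
    u / v is therefore given by a pair with v H(u) - u H(v) in (g), and polynomials in u / v become
    binary forms in u and v. H acts on C{x} as f_y d/dx, so an algebraic relation can be
    differentiated to useful effect only if g does not divide f_y; reducedness of f guarantees
    this. *)

Record fps (R : Type) := Fps { fcoef :> nat -> R }.

Lemma fpsP (R : Type) (f g : fps R) : (forall n, f n = g n) -> f = g.
Proof. by case: f; case: g => g f /= fg; congr Fps; apply: funext. Qed.

HB.instance Definition _ (R : Type) := gen_eqMixin (fps R).
HB.instance Definition _ (R : Type) := gen_choiceMixin (fps R).

Section FormalPowerSeries.
Variable R : comNzRingType.
Implicit Types f g h : fps R.

Definition fps_add f g : fps R := Fps (fun n => f n + g n).
Definition fps_opp f : fps R := Fps (fun n => - f n).
Definition fps_zero : fps R := Fps (fun=> 0).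
Definition fps_mul f g : fps R :=
  Fps (fun n => \sum_(i < n.+1) f i * g (n - i)%N).
Definition fps_const (c : R) : fps R := Fps (fun n => if n == 0%N then c else 0).

(** The ring laws are inherited from polynomials: the coefficient of index n of a product depends
    only on the truncations of the factors at degree n. *)
Let trunc n f : {poly R} := \poly_(i < n.+1) f i.

Let coef_trunc n f k : (k <= n)%N -> (trunc n f)`_k = f k.
Proof. by move=> kn; rewrite coef_poly ltnS kn. Qed.

Let mul_trunc n f g (p q : {poly R}) :
  (forall k, (k <= n)%N -> f k = p`_k) ->
  (forall k, (k <= n)%N -> g k = q`_k) ->
  forall k, (k <= n)%N -> fps_mul f g k = (p * q)`_k.
Proof.
move=> fp gq k kn; rewrite coefM /=; apply: eq_bigr => i _.
rewrite fp ?gq //; first exact: leq_trans (leq_subr _ _) kn.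
exact: leq_trans (leq_ord i) kn.
Qed.

Let truncE n f k : (k <= n)%N -> f k = (trunc n f)`_k.
Proof. by move/coef_trunc ->. Qed.

Fact fps_addA : associative fps_add.
Proof. by move=> f g h; apply: fpsP => n /=; rewrite addrA. Qed.
Fact fps_addC : commutative fps_add.
Proof. by move=> f g; apply: fpsP => n /=; rewrite addrC. Qed.
Fact fps_add0 : left_id fps_zero fps_add.
Proof. by move=> f; apply: fpsP => n /=; rewrite add0r. Qed.
Fact fps_addN : left_inverse fps_zero fps_opp fps_add.
Proof. by move=> f; apply: fpsP => n /=; rewrite addNr. Qed.

HB.instance Definition _ :=
  GRing.isZmodule.Build (fps R) fps_addA fps_addC fps_add0 fps_addN.

Fact fps_mulA : associative fps_mul.
Proof.
move=> f g h; apply: fpsP => n.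
have fg := mul_trunc (@truncE n f) (@truncE n g).
have gh := mul_trunc (@truncE n g) (@truncE n h).
by rewrite (mul_trunc (@truncE n f) gh) // (mul_trunc fg (@truncE n h)) // mulrA.
Qed.
Fact fps_mulC : commutative fps_mul.
Proof.
move=> f g; apply: fpsP => n.
rewrite (mul_trunc (@truncE n f) (@truncE n g)) //.
by rewrite (mul_trunc (@truncE n g) (@truncE n f)) // mulrC.
Qed.
Fact fps_mul1 : left_id (fps_const 1) fps_mul.
Proof.
move=> f; apply: fpsP => n; rewrite /= big_ord_recl /= mul1r subn0.
by rewrite big1 ?addr0 // => i _; rewrite mul0r.
Qed.
Fact fps_mulDl : left_distributive fps_mul +%R.
Proof.
move=> f g h; apply: fpsP => n /=; rewrite -big_split /=.
by apply: eq_bigr => i _; rewrite mulrDl.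
Qed.
Fact fps_1_neq0 : fps_const 1 != 0.
Proof.
by apply/eqP => /(congr1 (fun f : fps R => f 0%N)) /= /eqP; rewrite oner_eq0.
Qed.

HB.instance Definition _ := GRing.Zmodule_isComNzRing.Build (fps R)
  fps_mulA fps_mulC fps_mul1 fps_mulDl fps_1_neq0.

Lemma fpsD f g n : (f + g) n = f n + g n. Proof. by []. Qed.
Lemma fpsN f n : (- f) n = - f n. Proof. by []. Qed.
Lemma fps1 n : (1 : fps R) n = (n == 0%N)%:R.
Proof. by rewrite /= ; case: (n == 0%N). Qed.
Lemma fpsM f g n : (f * g) n = \sum_(i < n.+1) f i * g (n - i)%N.
Proof. by []. Qed.
Lemma fps_sum (I : Type) (r : seq I) (P : pred I) (F : I -> fps R) n :
  (\sum_(i <- r | P i) F i) n = \sum_(i <- r | P i) F i n.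
Proof. by elim/big_rec2: _ => [//|i y x _ <-]. Qed.

Lemma fpsMn f k n : (f *+ k) n = f n *+ k.
Proof. by elim: k => [//|k IH]; rewrite !mulrS fpsD IH. Qed.

Lemma fps_constM c f n : (fps_const c * f) n = c * f n.
Proof.
by rewrite fpsM big_ord_recl subn0 big1 ?addr0 // => i _; rewrite mul0r.
Qed.

Definition fps_deriv f : fps R := Fps (fun n => f n.+1 *+ n.+1).

Lemma fps_derivM f g :
  fps_deriv (f * g) = fps_deriv f * g + f * fps_deriv g.
Proof.
have mulE m (u v : fps R) (p q : {poly R}) :
    (forall k, (k <= m)%N -> u k = p`_k) ->
    (forall k, (k <= m)%N -> v k = q`_k) ->
    forall k, (k <= m)%N -> (u * v) k = (p * q)`_k by exact: mul_trunc.
apply: fpsP => n.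
(* The truncation is at [n.+1], because the coefficient of index n of a derivative comes from the
   one of index [n.+1]. *)
have E u k : (k <= n)%N -> fps_deriv u k = ((trunc n.+1 u)^`())`_k.
  by move=> kn; rewrite coef_deriv coef_trunc.
have T (u : fps R) k : (k <= n)%N -> u k = (trunc n.+1 u)`_k.
  by move=> kn; rewrite coef_trunc // ltnW.
transitivity ((trunc n.+1 f * trunc n.+1 g)^`()`_n).
  rewrite coef_deriv; congr (_ *+ _).
  by rewrite (mulE _ _ _ _ _ (@truncE n.+1 f) (@truncE n.+1 g)).
rewrite derivM coefD fpsD.
by rewrite (mulE _ _ _ _ _ (E f) (T g)) // (mulE _ _ _ _ _ (T f) (E g)).
Qed.

End FormalPowerSeries.

(** The list [Q n] collects the first n values; by the locality hypothesis [F] does not see the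
    default [x0] found beyond its end. *)
Lemma strong_recursion (T : Type) (x0 : T) (F : nat -> (nat -> T) -> T) :
  (forall n u v, (forall i, (i < n)%N -> u i = v i) -> F n u = F n v) ->
  exists q : nat -> T, forall n, q n = F n q.
Proof.
move=> Floc.
pose Q := fix Q n := if n is m.+1 then rcons (Q m) (F m (nth x0 (Q m))) else [::].
have sQ n : size (Q n) = n by elim: n => //= n IH; rewrite size_rcons IH.
have nQ n m i : (n <= m)%N -> (i < n)%N -> nth x0 (Q m) i = nth x0 (Q n) i.
  elim: m => [|m IH]; first by rewrite leqn0 => /eqP ->.
  rewrite leq_eqVlt => /orP[/eqP -> //|]; rewrite ltnS => nm i_n.
  by rewrite /= nth_rcons sQ (leq_trans i_n nm) IH.
exists (fun n => nth x0 (Q n.+1) n) => n.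
rewrite {1}[Q n.+1]/= nth_rcons sQ ltnn eqxx; apply: Floc => i i_n.
exact: nQ.
Qed.

Lemma sum_triangle (V : nmodType) (F : nat -> nat -> V) N :
  \sum_(n < N) \sum_(i < n.+1) F i (n - i)%N =
  \sum_(i < N) \sum_(k < N - i) F i k.
Proof.
elim: N => [|N IH]; first by rewrite !big_ord0.
rewrite big_ord_recr /= IH [RHS]big_ord_recr /=.
have -> : \sum_(k < N.+1 - N) F N k = F N 0%N.
  by rewrite subSnn big_ord_recl big_ord0 addr0.
rewrite [X in _ + X]big_ord_recr /= subnn addrA; congr (_ + _).
rewrite -big_split /=; apply: eq_bigr => i _.
by rewrite subSn ?(ltnW (ltn_ord i)) // big_ord_recr.
Qed.

Lemma sum_triangle_le (K : numDomainType) (F : nat -> nat -> K) N :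
  (forall i j, 0 <= F i j) ->
  \sum_(n < N) \sum_(i < n.+1) F i (n - i)%N <=
  \sum_(i < N) \sum_(k < N) F i k.
Proof.
move=> F0; rewrite sum_triangle; apply: ler_sum => i _.
rewrite (big_ord_widen N (F i)) ?leq_subr // big_mkcond /=.
by apply: ler_sum => k _; case: ifP.
Qed.

Lemma ler_sum_ord (K : numDomainType) (F : nat -> K) m n :
  (forall i, 0 <= F i) -> (m <= n)%N -> \sum_(i < m) F i <= \sum_(i < n) F i.
Proof.
move=> F0 mn; rewrite (big_ord_widen n F) // big_mkcond /=.
by apply: ler_sum => k _; case: ifP.
Qed.

Lemma sum_geo_half (K : numFieldType) n :
  \sum_(i < n) (2^-1 : K) ^+ i <= 2.
Proof.
suff -> : \sum_(i < n) (2^-1 : K) ^+ i = 2 - 2 * 2^-1 ^+ n.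
  by rewrite gerBl mulr_ge0 // exprn_ge0 // invr_ge0.
elim: n => [|n IH]; first by rewrite big_ord0 expr0 mulr1 subrr.
by rewrite big_ord_recr /= IH exprS; field.
Qed.

(** * Weighted l^1 norms of power series in one variable *)

Section Norm.
Variable C : numFieldType.
Implicit Types (p q : fps C) (rho A B : C).

Definition fps_shift (R : Type) (e : nat) (f : fps R) : fps R :=
  Fps (fun n => f (n + e)%N).

(** A bound for the weighted l^1 norm of radius [rho], put on partial sums so that no limit has to
    be taken. This norm is submultiplicative. *)
Definition norm_bound rho p B :=
  forall n, \sum_(j < n) `|p j| * rho ^+ j <= B.

Lemma norm_bound_le rho p q A : 0 <= rho -> (forall j, `|q j| <= `|p j|) ->
  norm_bound rho p A -> norm_bound rho q A.
Proof.
move=> r0 qp pA n; apply: le_trans (pA n); apply: ler_sum => j _.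
by rewrite ler_wpM2r ?exprn_ge0.
Qed.

Lemma norm_bound_coef rho p A j : 0 < rho -> norm_bound rho p A ->
  `|p j| <= A * rho^-1 ^+ j.
Proof.
move=> r0 /(_ j.+1); rewrite big_ord_recr /= => pA.
rewrite exprVn ler_pdivlMr ?exprn_gt0 //; apply: le_trans pA.
by rewrite lerDr sumr_ge0 // => i _; rewrite mulr_ge0 ?exprn_ge0 // ltW.
Qed.

Lemma norm_bound0 rho : norm_bound rho 0 0.
Proof. by move=> n; rewrite big1 // => i _; rewrite normr0 mul0r. Qed.

Lemma norm_boundN rho p A : norm_bound rho p A -> norm_bound rho (- p) A.
Proof. by move=> pA n; under eq_bigr do rewrite fpsN normrN. Qed.

Lemma norm_boundD rho p q A B : 0 <= rho ->
  norm_bound rho p A -> norm_bound rho q B -> norm_bound rho (p + q) (A + B).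
Proof.
move=> r0 pA qB n; apply: le_trans (lerD (pA n) (qB n)).
rewrite -big_split /=; apply: ler_sum => i _.
by rewrite -mulrDl ler_wpM2r ?exprn_ge0 ?ler_normD.
Qed.

Lemma norm_bound_sum rho n (p : nat -> fps C) (A : nat -> C) : 0 <= rho ->
  (forall i, (i < n)%N -> norm_bound rho (p i) (A i)) ->
  norm_bound rho (\sum_(i < n) p i) (\sum_(i < n) A i).
Proof.
move=> r0; elim: n => [|n IH] pA.
  by rewrite !big_ord0; apply: norm_bound0.
rewrite !big_ord_recr /=; apply: norm_boundD => //; last exact: pA.
by apply: IH => i i_n; apply: pA; rewrite ltnW.
Qed.

Lemma norm_boundM rho p q A B : 0 <= rho ->
  norm_bound rho p A -> norm_bound rho q B -> norm_bound rho (p * q) (A * B).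
Proof.
move=> r0 pA qB n.
have T0 (u : fps C) i : 0 <= `|u i| * rho ^+ i by rewrite mulr_ge0 ?exprn_ge0.
have := sum_triangle_le n (fun i j => mulr_ge0 (T0 p i) (T0 q j)).
move=> H; apply: le_trans (le_trans _ H) _.
  apply: ler_sum => k _; rewrite fpsM.
  apply: le_trans (ler_wpM2r (exprn_ge0 _ r0) (ler_norm_sum _ _ _)) _.
  rewrite mulr_suml; apply: ler_sum => i _; rewrite normrM.
  rewrite mulrACA -exprD subnKC //; exact: leq_ord i.
under eq_bigr do rewrite -mulr_sumr.
rewrite -mulr_suml; apply: ler_pM => //; exact: sumr_ge0.
Qed.

Lemma norm_bound_shift rho p A e : 0 < rho -> norm_bound rho p A ->
  norm_bound rho (fps_shift e p) (A * rho^-1 ^+ e).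
Proof.
move=> r0 pA n; rewrite exprVn ler_pdivlMr ?exprn_gt0 //.
apply: le_trans (pA (e + n)%N); rewrite big_split_ord /= mulr_suml.
rewrite -[leLHS]add0r lerD ?sumr_ge0 // => [i _|].
  by rewrite mulr_ge0 ?exprn_ge0 // ltW.
by apply: ler_sum => i _; rewrite -mulrA -exprD addnC.
Qed.

Lemma norm_bound_geometric p A t : 0 < t ->
  0 <= A -> (forall j, `|p j| <= A * t ^+ j) ->
  norm_bound (2 * t)^-1 p (2 * A).
Proof.
move=> t0 A0 pA n; rewrite [2 * A]mulrC.
apply: le_trans (ler_wpM2l A0 (@sum_geo_half C n)).
rewrite mulr_sumr; apply: ler_sum => j _.
have t0' : 0 <= (2 * t)^-1 by rewrite invr_ge0 mulr_ge0 // ltW.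
apply: le_trans (ler_wpM2r (exprn_ge0 _ t0') (pA j)) _.
rewrite -mulrA -exprMn; suff -> : t * (2 * t)^-1 = 2^-1 by [].
by field; rewrite gt_eqF.
Qed.

(** The exact solution of the discrete Gronwall recursion b_n = t^n + K sum_{i<n} b_i t^(n-i). It
    turns recursive estimates into geometric bounds. *)
Lemma gronwall_sum (K t : C) n :
  t ^+ n + K * \sum_(i < n) ((1 + K) * t) ^+ i * t ^+ (n - i) =
  ((1 + K) * t) ^+ n.
Proof.
elim: n => [|n IH]; first by rewrite big_ord0 mulr0 addr0 !expr0.
rewrite big_ord_recr /= subSnn expr1.
have -> : \sum_(i < n) ((1 + K) * t) ^+ i * t ^+ (n.+1 - i) =
   t * \sum_(i < n) ((1 + K) * t) ^+ i * t ^+ (n - i).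
  rewrite mulr_sumr; apply: eq_bigr => i _.
  by rewrite subSn ?(ltnW (ltn_ord i)) // exprS mulrCA.
rewrite mulrDr addrA mulrCA !exprS -mulrDr IH; ring.
Qed.

Lemma fps_inverse p : p 0%N != 0 -> exists q, p * q = 1.
Proof.
move=> p0.
have [q qE] := @strong_recursion C 0
  (fun n u => (p 0%N)^-1 * ((n == 0%N)%:R - \sum_(i < n) u i * p (n - i)%N))
  (fun n u v uv => congr1 (fun s => _ * (_ - s))
    (eq_bigr _ (fun i _ => congr1 (fun c => c * _) (uv _ (ltn_ord i))))).
exists (Fps q); apply: fpsP => n.
rewrite mulrC [RHS]fps1 fpsM big_ord_recr subnn /= [q n]qE.
by rewrite [_ * p 0%N]mulrC mulVKf // subrKC.
Qed.

Lemma fps_inverse_geometric p q A t : 0 < A -> 0 < t ->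
  p * q = 1 -> (forall j, `|p j| <= A * t ^+ j) ->
  exists B s, [/\ 0 < B, 0 < s & forall j, `|q j| <= B * s ^+ j].
Proof.
move=> A0 t0 pq pA.
have p00 : p 0%N != 0.
  apply/eqP => p0; have /eqP := congr1 (fun f : fps C => f 0%N) pq.
  by rewrite fpsM big_ord_recl big_ord0 p0 mul0r add0r fps1 eq_sym oner_eq0.
have c0 : 0 < `|p 0%N|^-1 by rewrite invr_gt0 normr_gt0.
have K0 : 0 < `|p 0%N|^-1 * A by rewrite mulr_gt0.
(* Solving p q = 1 for q_n gives |q_n| <= c (delta_n + A sum_{i<n} |q_i| t^(n-i)) with c = 1 /
   |p_0|, which is the Gronwall recursion for K = c A. *)
exists `|p 0%N|^-1, ((1 + `|p 0%N|^-1 * A) * t); split => //.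
  by rewrite mulr_gt0 ?addr_gt0.
elim/ltn_ind => n IH.
have qE : q n = (p 0%N)^-1 * ((n == 0%N)%:R - \sum_(i < n) q i * p (n - i)%N).
  have := congr1 (fun f : fps C => f n) pq; rewrite mulrC fpsM fps1 big_ord_recr subnn /=.
  by move=> <-; rewrite addrAC subrr add0r mulrCA mulVf ?mulr1.
rewrite qE normrM normfV; apply: ler_wpM2l (ltW c0) _ _ _.
rewrite -gronwall_sum.
apply: le_trans (ler_normB _ _) _; apply: lerD.
  case: n {IH qE} => [|n]; first by rewrite normr1 expr0.
  by rewrite normr0 exprn_ge0 // ltW.
apply: le_trans (ler_norm_sum _ _ _) _; rewrite mulr_sumr.
apply: ler_sum => i _; rewrite normrM.
apply: le_trans (ler_pM _ _ (IH i (ltn_ord i)) (pA _)) _ => //.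
by rewrite [leLHS]mulrACA -mulrA.
Qed.

End Norm.

(** * The ring of convergent power series *)

Section Germ.
Variable C : numFieldType.

(* f i j is the coefficient of X^i Y^j. *)
Definition conv (f : fps (fps C)) : Prop :=
  exists M t : C, [/\ 0 < M, 0 < t & forall i j, `|f i j| <= M * t ^+ (i + j)].

Definition conv_pred : {pred fps (fps C)} := fun f => `[< conv f >].

Lemma conv2 (f g : fps (fps C)) : conv f -> conv g ->
  exists M t : C, [/\ 0 < M, 0 < t,
    forall i j, `|f i j| <= M * t ^+ (i + j) &
    forall i j, `|g i j| <= M * t ^+ (i + j)].
Proof.
move=> [M [t [M0 t0 fM]]] [N [s [N0 s0 gN]]].
have E (K L u v : C) n : 0 < K -> 0 < L -> 0 < u -> 0 < v ->
    K * u ^+ n <= (K + L) * (u + v) ^+ n.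
  move=> K0 L0 u0 v0; apply: ler_pM.
  - exact: ltW.
  - by rewrite exprn_ge0 // ltW.
  - by rewrite lerDl ltW.
  - by rewrite lerXn2r ?nnegrE ?lerDl // ?ltW // addr_gt0.
exists (M + N), (t + s); split; rewrite ?addr_gt0 // => i j.
- by apply: le_trans (fM i j) _; apply: E.
- by rewrite [M + N]addrC [t + s]addrC; apply: le_trans (gN i j) _; apply: E.
Qed.

Lemma fps2M (f g : fps (fps C)) i j : (f * g) i j =
  \sum_(k < i.+1) \sum_(l < j.+1) f k l * g (i - k)%N (j - l)%N.
Proof. by rewrite fpsM fps_sum. Qed.

Lemma fps2_1 i j : (1 : fps (fps C)) i j = ((i == 0) && (j == 0))%N%:R.
Proof. by rewrite fps1; case: (i == 0)%N => //; apply: fps1. Qed.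

Lemma natS_le_exp2 n : n.+1%:R <= 2 ^+ n :> C.
Proof. by rewrite -natrX ler_nat ltn_expl. Qed.

Lemma convM f g : conv f -> conv g -> conv (f * g).
Proof.
move=> cf cg; have [M [t [M0 t0 fM gM]]] := conv2 cf cg.
(* A coefficient of the product has (i+1)(j+1) <= 2^(i+j) terms, which doubles the ratio [t]. *)
exists (M * M), (2 * t); split; rewrite ?mulr_gt0 // => i j.
have T k : 0 <= t ^+ k by rewrite exprn_ge0 // ltW.
rewrite fps2M; apply: le_trans (ler_norm_sum _ _ _) _.
have B (k : 'I_i.+1) :
    `|\sum_(l < j.+1) f k l * g (i - k)%N (j - l)%N| <= M * M * t ^+ (i + j) * 2 ^+ j.
  apply: le_trans (ler_norm_sum _ _ _) _.
  apply: le_trans (_ : \sum_(l < j.+1) M * M * t ^+ (i + j) <= _).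
    apply: ler_sum => l _; rewrite normrM.
    apply: le_trans (ler_pM _ _ (fM _ _) (gM _ _)) _ => //.
    rewrite mulrACA -exprD; have := ltn_ord k; have := ltn_ord l.
    by rewrite !ltnS => lj ki; rewrite addnACA !subnKC.
  rewrite sumr_const card_ord -[X in X <= _]mulr_natr ler_wpM2l ?natS_le_exp2 //.
  by rewrite !mulr_ge0 // ltW.
apply: le_trans (ler_sum _ (fun k _ => B k)) _.
rewrite sumr_const card_ord -[X in X <= _]mulr_natr exprMn [X in _ <= _ * (X * _)]exprD.
have -> : M * M * (2 ^+ i * 2 ^+ j * t ^+ (i + j)) =
  M * M * t ^+ (i + j) * 2 ^+ j * 2 ^+ i by ring.
by rewrite ler_wpM2l ?natS_le_exp2 // !mulr_ge0 ?exprn_ge0 // ltW.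
Qed.

Fact conv_subring : subring_closed conv_pred.
Proof.
split=> [|f g /asboolP cf /asboolP cg|f g /asboolP cf /asboolP cg].
- apply/asboolP; exists 1, 1; split => // i j.
  by rewrite fps2_1 expr1n mulr1; case: (_ && _); rewrite ?normr1 ?normr0.
- apply/asboolP; have [M [t [M0 t0 fM gM]]] := conv2 cf cg.
  exists (M + M), t; split; rewrite ?addr_gt0 // => i j.
  by rewrite mulrDl; apply: le_trans (ler_normB _ _) (lerD (fM i j) (gM i j)).
- by apply/asboolP; apply: convM.
Qed.

HB.instance Definition _ :=
  GRing.isSubringClosed.Build _ conv_pred conv_subring.

Record germ := Germ { gser :> fps (fps C); gserP : gser \in conv_pred }.

HB.instance Definition _ := [isSub for gser].
HB.instance Definition _ := [Choice of germ by <:].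
HB.instance Definition _ := [SubChoice_isSubComNzRing of germ by <:].

Implicit Types a b f g h : germ.

Lemma germP a b : (forall i j, a i j = b i j) -> a = b.
Proof. by move=> ab; apply: val_inj; apply: fpsP => i; apply: fpsP. Qed.

Lemma germ_conv a : conv a. Proof. exact/asboolP/(gserP a). Qed.

Definition mkgerm (s : fps (fps C)) (cs : conv s) : germ := Germ (asboolT cs).

Lemma germD a b i j : (a + b) i j = a i j + b i j. Proof. by []. Qed.
Lemma germB a b i j : (a - b) i j = a i j - b i j. Proof. by []. Qed.
Lemma germ0 i j : (0 : germ) i j = 0. Proof. by []. Qed.
Lemma germ1 i j : (1 : germ) i j = ((i == 0) && (j == 0))%N%:R.
Proof. exact: fps2_1. Qed.
Lemma germM a b i j : (a * b) i j =
  \sum_(k < i.+1) \sum_(l < j.+1) a k l * b (i - k)%N (j - l)%N.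
Proof. exact: fps2M. Qed.
Lemma germ_sum (I : Type) (r : seq I) (P : pred I) (F : I -> germ) i j :
  (\sum_(k <- r | P k) F k) i j = \sum_(k <- r | P k) F k i j.
Proof. by elim/big_rec2: _ => [//|k y x _ <-]. Qed.
Lemma germ00M a b : (a * b) 0 0 = a 0 0 * b 0 0.
Proof. by rewrite germM !big_ord_recl !big_ord0 !addr0. Qed.

Definition monomial m n : fps (fps C) :=
  Fps (fun i => Fps (fun j => ((i == m) && (j == n))%:R)).

Fact conv_monomial m n : conv (monomial m n).
Proof.
exists 1, 1; split => // i j /=.
by rewrite expr1n mulr1; case: (_ && _); rewrite ?normr1 ?normr0.
Qed.

Definition gX : germ := mkgerm (conv_monomial 1 0).
Definition gY : germ := mkgerm (conv_monomial 0 1).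

Definition const_ser (c : C) : fps (fps C) := fps_const (fps_const c).

Fact conv_const c : conv (const_ser c).
Proof.
exists (1 + `|c|), 1; split; rewrite ?ltr_pwDl // => i j /=.
rewrite expr1n mulr1; case: (i == 0)%N => /=; rewrite ?normr0 ?addr_ge0 //.
by case: (j == 0)%N; rewrite ?normr0 ?addr_ge0 // lerDr.
Qed.

Definition gC (c : C) : germ := mkgerm (conv_const c).

Lemma gC_coef c i j : gC c i j = if (i == 0)%N && (j == 0)%N then c else 0.
Proof. by rewrite /=; case: (i == 0)%N => //=. Qed.

Lemma gCM_coef c a i j : (gC c * a) i j = c * a i j.
Proof.
by rewrite [LHS](_ : _ = (const_ser c * a) i j) // !fps_constM.
Qed.

Fact gC_is_zmod : zmod_morphism gC.
Proof.
move=> c d; apply: germP => i j; rewrite germB. rewrite !gC_coef.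
by case: ifP; rewrite ?subr0.
Qed.
Fact gC_is_monoid : monoid_morphism gC.
Proof.
split; first by apply: germP => i j; rewrite [RHS]germ1 gC_coef; case: ifP.
move=> c d; apply: germP => i j; rewrite gCM_coef !gC_coef.
by case: ifP; rewrite ?mulr0.
Qed.
HB.instance Definition _ := GRing.isZmodMorphism.Build C germ gC gC_is_zmod.
HB.instance Definition _ := GRing.isMonoidMorphism.Build C germ gC gC_is_monoid.

Lemma gX_coef i j : gX i j = ((i == 1%N) && (j == 0%N))%:R. Proof. by []. Qed.
Lemma gY_coef i j : gY i j = ((i == 0%N) && (j == 1%N))%:R. Proof. by []. Qed.

Lemma gXM_S a i j : (gX * a) i.+1 j = a i j.
Proof.
rewrite germM big_ord_recl big1 ?add0r => [|l _]; last by rewrite mul0r.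
rewrite big_ord_recl big_ord_recl /= mul1r subSS !subn0.
rewrite !big1 ?addr0 // => [k _|l _]; rewrite ?mul0r //.
by rewrite big1 // => l _; rewrite mul0r.
Qed.

Lemma gXM_0 a j : (gX * a) 0 j = 0.
Proof.
by rewrite germM big_ord_recl big_ord0 addr0 big1 // => l _; rewrite mul0r.
Qed.

Lemma gXnM_coef n a i j :
  (gX ^+ n * a) i j = if (i < n)%N then 0 else a (i - n)%N j.
Proof.
elim: n i => [|n IH] i; first by rewrite expr0 mul1r subn0.
rewrite exprS -mulrA; case: i => [|i]; first by rewrite gXM_0.
by rewrite gXM_S IH ltnS subSS.
Qed.

Lemma gX_lreg a b : gX * a = gX * b -> a = b.
Proof. by move=> ab; apply: germP => i j; rewrite -(gXM_S a) ab gXM_S. Qed.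

Lemma gXn_lreg n a b : gX ^+ n * a = gX ^+ n * b -> a = b.
Proof.
by elim: n => [|n IH]; rewrite ?mul1r // exprS -!mulrA => /gX_lreg /IH.
Qed.

Fact conv_shift n a : conv (fps_shift n a).
Proof.
have [M [t [M0 t0 aM]]] := germ_conv a.
exists (M * t ^+ n), t; split; rewrite ?mulr_gt0 ?exprn_gt0 // => i j.
by rewrite -mulrA -exprD addnA [(n + i)%N]addnC; apply: aM.
Qed.

Lemma gXn_divides n a : (forall i j, (i < n)%N -> a i j = 0) ->
  exists b, a = gX ^+ n * b.
Proof.
move=> a0; exists (mkgerm (conv_shift n a)); apply: germP => i j.
rewrite gXnM_coef; case: ltnP => [/a0 ->//|ni].
by rewrite /= subnK.
Qed.

Lemma conv_le (s : fps (fps C)) a : (forall i j, `|s i j| <= `|a i j|) -> conv s.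
Proof.
have [M [t [M0 t0 aM]]] := germ_conv a => sa.
by exists M, t; split => // i j; apply: le_trans (sa i j) _.
Qed.

Definition swap_ser a : fps (fps C) := Fps (fun i => Fps (fun j => a j i)).

Fact conv_swap a : conv (swap_ser a).
Proof.
have [M [t [M0 t0 aM]]] := germ_conv a.
by exists M, t; split => // i j; rewrite addnC; apply: aM.
Qed.

Definition swap a : germ := mkgerm (conv_swap a).

Lemma swap_coef a i j : swap a i j = a j i. Proof. by []. Qed.
Lemma swapK : involutive swap. Proof. by move=> a; apply: germP. Qed.

Fact swap_is_zmod : zmod_morphism swap.
Proof. by move=> a b; apply: germP. Qed.
Fact swap_is_monoid : monoid_morphism swap.
Proof.
split; first by apply: germP => i j; rewrite [LHS]germ1 germ1 andbC.
by move=> a b; apply: germP => i j; rewrite [LHS]germM germM exchange_big.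
Qed.
HB.instance Definition _ := GRing.isZmodMorphism.Build germ germ swap swap_is_zmod.
HB.instance Definition _ := GRing.isMonoidMorphism.Build germ germ swap swap_is_monoid.

Lemma gYM_S a i j : (gY * a) i j.+1 = a i j.
Proof.
have -> : gY = swap gX by apply: germP => k l /=; rewrite andbC.
by rewrite -[a in LHS]swapK -rmorphM swap_coef gXM_S.
Qed.

Lemma gYM_0 a i : (gY * a) i 0 = 0.
Proof.
have -> : gY = swap gX by apply: germP => k l /=; rewrite andbC.
by rewrite -[a in LHS]swapK -rmorphM swap_coef gXM_0.
Qed.

Definition d1_ser a : fps (fps C) := fps_deriv a.

Fact conv_d1 a : conv (d1_ser a).
Proof.
have [M [t [M0 t0 aM]]] := germ_conv a.
have T k : 0 <= t ^+ k by rewrite exprn_ge0 // ltW.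
exists (M * t), (2 * t); split; rewrite ?mulr_gt0 // => i j.
rewrite [d1_ser a i j]fpsMn normrMn -[X in X <= _]mulr_natr.
apply: le_trans (ler_pM _ _ (aM _ _) (natS_le_exp2 i)) _ => //.
rewrite addSn exprS exprMn.
have -> : M * t * (2 ^+ (i + j) * t ^+ (i + j)) =
  M * (t * t ^+ (i + j)) * 2 ^+ (i + j) by ring.
apply: ler_wpM2l; first by rewrite !mulr_ge0 // ltW.
by rewrite -!natrX ler_nat leq_exp2l // leq_addr.
Qed.

Definition d1 a : germ := mkgerm (conv_d1 a).
Definition d2 a : germ := swap (d1 (swap a)).

Lemma d1_coef a i j : d1 a i j = a i.+1 j *+ i.+1.
Proof.
exact: fpsMn.
Qed.
Lemma d2_coef a i j : d2 a i j = a i j.+1 *+ j.+1.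
Proof. by rewrite [LHS](d1_coef (swap a) j i). Qed.

Lemma d1M a b : d1 (a * b) = d1 a * b + a * d1 b.
Proof. by apply: val_inj; apply: fps_derivM. Qed.
Lemma d2M a b : d2 (a * b) = d2 a * b + a * d2 b.
Proof. by rewrite /d2 !rmorphM /= d1M rmorphD !rmorphM /= !swapK. Qed.
Fact d1_is_zmod : zmod_morphism d1.
Proof. by move=> a b; apply: germP => i j; rewrite germB !d1_coef germB mulrnBl. Qed.
HB.instance Definition _ := GRing.isZmodMorphism.Build germ germ d1 d1_is_zmod.
Fact d2_is_zmod : zmod_morphism d2.
Proof.
move=> a b; apply: germP => i j.
rewrite germB !swap_coef !d1_coef !swap_coef germB.
by rewrite mulrnBl.
Qed.
HB.instance Definition _ := GRing.isZmodMorphism.Build germ germ d2 d2_is_zmod.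
Lemma d1d2 a : d1 (d2 a) = d2 (d1 a).
Proof. by apply: germP => i j; rewrite !(d1_coef, d2_coef) -!mulrnA mulnC. Qed.

(** Membership in C{x}. These are the germs fixed by the ring morphism [restr], the substitution Y =
    0, whence the closure properties below. *)
Definition xonly a := forall i j, (0 < j)%N -> a i j = 0.

Definition restr_ser a : fps (fps C) :=
  Fps (fun i => Fps (fun j => if (j == 0)%N then a i j else 0)).

Fact conv_restr a : conv (restr_ser a).
Proof. by apply: (@conv_le _ a) => i j /=; case: ifP; rewrite ?normr0. Qed.

Definition restr a : germ := mkgerm (conv_restr a).

Lemma restr_xonly a : xonly (restr a). Proof. by move=> i [|j]. Qed.
Lemma xonly_restr a : xonly a -> restr a = a.
Proof.
by move=> ax; apply: germP => i [|j] //=; rewrite ax.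
Qed.

Fact restr_is_zmod : zmod_morphism restr.
Proof.
by move=> a b; apply: germP => i j; rewrite germB /=; case: ifP; rewrite ?subr0.
Qed.
Fact restr_is_monoid : monoid_morphism restr.
Proof.
split.
  by apply: germP => i j; rewrite /= !germ1; case: ifP => [/eqP ->|//]; rewrite ?andbF.
move=> a b; apply: germP => i j; rewrite [LHS]/= !germM; case: ifP => [/eqP ->|j0].
  by apply: eq_bigr => k _; rewrite !big_ord_recl !big_ord0.
rewrite big1 // => k _; rewrite big1 // => l _ /=.
by case: (altP (l =P 0 :> nat)) => [->|]; rewrite ?mul0r // subn0 j0 mulr0.
Qed.
HB.instance Definition _ := GRing.isZmodMorphism.Build germ germ restr restr_is_zmod.
HB.instance Definition _ := GRing.isMonoidMorphism.Build germ germ restr restr_is_monoid.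

Lemma xonlyB a b : xonly a -> xonly b -> xonly (a - b).
Proof. by move=> /xonly_restr <- /xonly_restr <-; rewrite -rmorphB; apply: restr_xonly. Qed.
Lemma xonlyD a b : xonly a -> xonly b -> xonly (a + b).
Proof. by move=> /xonly_restr <- /xonly_restr <-; rewrite -rmorphD; apply: restr_xonly. Qed.
Lemma xonlyM a b : xonly a -> xonly b -> xonly (a * b).
Proof. by move=> /xonly_restr <- /xonly_restr <-; rewrite -rmorphM; apply: restr_xonly. Qed.
Lemma xonlyX a n : xonly a -> xonly (a ^+ n).
Proof. by move=> /xonly_restr <-; rewrite -rmorphXn; apply: restr_xonly. Qed.
Lemma xonly_gX : xonly gX. Proof. by move=> i [|j] // _; rewrite gX_coef andbF. Qed.
Lemma xonly_gC c : xonly (gC c). Proof. by move=> i [|j] // _; rewrite gC_coef andbF. Qed.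
Lemma xonly0 : xonly 0. Proof. by []. Qed.
Lemma xonly1 : xonly 1. Proof. by rewrite -(rmorph1 gC); apply: xonly_gC. Qed.
Lemma xonly_d1 a : xonly a -> xonly (d1 a).
Proof. by move=> ax i j j0; rewrite d1_coef ax // mul0rn. Qed.
Lemma d2_xonly a : xonly a -> d2 a = 0.
Proof. by move=> ax; apply: germP => i j; rewrite d2_coef ax // mul0rn. Qed.

Lemma split_xonly a : exists b, a = restr a + gY * b.
Proof.
pose s : fps (fps C) := Fps (fun i => fps_shift 1 (a i)).
have cs : conv s.
  have [M [t [M0 t0 aM]]] := germ_conv a.
  exists (M * t), t; split; rewrite ?mulr_gt0 // => i j /=.
  by rewrite -mulrA -exprS -addnS addn1; apply: aM.
exists (mkgerm cs); apply: germP => i [|j]; rewrite germD ?gYM_0 ?gYM_S /=.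
  by rewrite addr0.
by rewrite add0r addn1.
Qed.

End Germ.

Section FpsX.
Variable R : comNzRingType.
Implicit Types f g : fps R.

Definition fpsX : fps R := Fps (fun n => (n == 1%N)%:R).

Lemma fpsXnM_coef n f i :
  (fpsX ^+ n * f) i = if (i < n)%N then 0 else f (i - n)%N.
Proof.
elim: n i => [|n IH] i; first by rewrite expr0 mul1r subn0.
rewrite exprS -mulrA fpsM big_ord_recl mul0r add0r.
case: i => [|i]; first by rewrite big_ord0.
rewrite big_ord_recl big1 ?addr0 => [|k _]; last by rewrite mul0r.
rewrite mul1r (_ : (i.+1 - lift ord0 ord0)%N = i) ?IH ?ltnS ?subSS //.
exact: subn0.
Qed.

Definition fps_trunc e f : fps R := Fps (fun j => if (j < e)%N then f j else 0).

Lemma fps_split e f : f = fps_trunc e f + fpsX ^+ e * fps_shift e f.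
Proof.
apply: fpsP => i; rewrite fpsD fpsXnM_coef /=; case: ltnP => ei.
  by rewrite addr0.
by rewrite add0r subnK.
Qed.

End FpsX.

(** * Weierstrass division *)

Section Weierstrass.
Variable C : numFieldType.
Implicit Types (a b f g h p q r : germ C).

(* The order in Y of a(0, Y). *)
Definition yord a e := (forall j, (j < e)%N -> a 0 j = 0) /\ a 0 e <> 0.

Definition ydeg_lt e a := forall i j, (e <= j)%N -> a i j = 0.

(** Coefficients of X^n are compared one after the other. As f(0, Y) = Y^e u with u invertible, q_n
    is u^-1 times the part of degree >= e of k_n = h_n - sum_{i<n} q_i f_(n-i), divided by Y^e, and
    r_n is the part of degree < e. Convergence is a Gronwall estimate in a weighted norm. *)
Lemma weierstrass_division f e : yord f e ->
  forall h, exists q r, h = q * f + r /\ ydeg_lt e r.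
Proof.
move=> [f0 fe] h.
have [M [t [M0 t0 fM hM]]] := conv2 (germ_conv f) (germ_conv h).
pose u := fps_shift e (f 0); have fE : f 0 = fpsX _ ^+ e * u.
  rewrite [LHS](fps_split e) [fps_trunc _ _](_ : _ = 0) ?add0r //.
  by apply: fpsP => j /=; case: ltnP => // /f0.
have u0 : u 0%N != 0 by apply/eqP.
have [w uw] := fps_inverse u0.
have uM j : `|u j| <= M * t ^+ e * t ^+ j.
  by rewrite -mulrA -exprD addnC; apply: fM.
have Mt0 : 0 < M * t ^+ e by rewrite mulr_gt0 ?exprn_gt0.
have [B [s [B0 s0 wB]]] := fps_inverse_geometric Mt0 t0 uw uM.
pose T := t + s; have T0 : 0 < T by rewrite addr_gt0.
pose rho := (2 * T)^-1; have rho0 : 0 < rho by rewrite invr_gt0 mulr_gt0.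
have rhoN : 0 < rho^-1 ^+ e by apply: exprn_gt0; rewrite invr_gt0.
have tT k : t ^+ k <= T ^+ k.
  by rewrite lerXn2r ?nnegrE ?(ltW t0) ?(ltW T0) // lerDl ltW.
have bnd (a : germ C) i : (forall i j, `|a i j| <= M * t ^+ (i + j)) ->
    norm_bound rho (a i) (2 * (M * T ^+ i)).
  move=> aM; apply: norm_bound_geometric => // [|j].
    by rewrite mulr_ge0 ?exprn_ge0 // ltW.
  by rewrite -mulrA -exprD; apply: le_trans (aM i j) _; rewrite ler_pM2l.
have wN : norm_bound rho w (2 * B).
  apply: norm_bound_geometric (ltW B0) _ => // j.
  apply: le_trans (wB j) _; rewrite ler_pM2l //.
  by rewrite lerXn2r ?nnegrE ?(ltW s0) ?(ltW T0) // lerDr ltW.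
pose k n (v : nat -> fps C) : fps C := h n - \sum_(i < n) v i * f (n - i)%N.
have kloc n v v' : (forall i, (i < n)%N -> v i = v' i) -> k n v = k n v'.
  by move=> vv; congr (_ - _); apply: eq_bigr => i _; rewrite vv.
have [q qE] := @strong_recursion _ 0 (fun n v => w * fps_shift e (k n v))
  (fun n v v' vv => congr1 (fun s => w * fps_shift e s) (kloc n v v' vv)).
(* [K] is the cost of one step of the recursion: the norm of [w], the constant in the norms of the
   rows of f, and [rho^-1 ^+ e] for the division by Y^e. With it [beta] reproduces itself through
   [gronwall_sum]. *)
pose K := 2 * B * (2 * M * rho^-1 ^+ e).
have K0 : 0 < K by rewrite !mulr_gt0.
pose beta n := K * ((1 + K) * T) ^+ n.
have beta0 n : 0 <= beta n.
  by rewrite mulr_ge0 ?exprn_ge0 ?mulr_ge0 ?addr_ge0 // ltW.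
have step n : (forall i, (i < n)%N -> norm_bound rho (q i) (beta i)) ->
    norm_bound rho (k n q) (2 * M * ((1 + K) * T) ^+ n).
  move=> IH; rewrite -gronwall_sum mulrDr.
  apply: norm_boundD; rewrite ?(ltW rho0) //; first by rewrite -mulrA; apply: bnd.
  apply: norm_boundN.
  rewrite mulrA mulr_sumr.
  apply: (@norm_bound_sum _ _ _ (fun i => q i * f (n - i)%N) 
    (fun i => 2 * M * K * (((1 + K) * T) ^+ i * T ^+ (n - i)))); rewrite ?(ltW rho0) //.
  move=> i i_n.
  have -> : 2 * M * K * (((1 + K) * T) ^+ i * T ^+ (n - i)) =
     beta i * (2 * (M * T ^+ (n - i))) by rewrite /beta; ring.
  by apply: norm_boundM; rewrite ?(ltW rho0) //; [apply: IH | apply: bnd].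
have qB n : norm_bound rho (q n) (beta n).
  elim/ltn_ind: n => n /step kn; rewrite qE.
  have -> : beta n = 2 * B * (2 * M * ((1 + K) * T) ^+ n * rho^-1 ^+ e).
    by rewrite /beta {1}/K; ring.
  apply: norm_boundM; rewrite ?(ltW rho0) //; exact: norm_bound_shift.
(* A bound A S^n for the norm of row n bounds its coefficients by A S^n rho^-j, so S + rho^-1 serves
   as a common ratio. *)
have convS (v : nat -> fps C) (A S : C) : 0 < A -> 0 < S ->
    (forall n, norm_bound rho (v n) (A * S ^+ n)) -> conv (Fps v).
  move=> A0 S0 vN; have r0 : 0 < rho^-1 by rewrite invr_gt0.
  exists A, (S + rho^-1); split => // [|i j]; first by rewrite addr_gt0.
  apply: le_trans (norm_bound_coef j rho0 (vN i)) _.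
  have SR : 0 < S + rho^-1 by rewrite addr_gt0.
  rewrite -mulrA exprD ler_pM2l //; apply: ler_pM.
  - by rewrite exprn_ge0 // ltW.
  - by rewrite exprn_ge0 // ltW.
  - by rewrite lerXn2r ?nnegrE ?(ltW S0) ?(ltW SR) // lerDl ltW.
  - by rewrite lerXn2r ?nnegrE ?(ltW r0) ?(ltW SR) // lerDr ltW.
have S0 : 0 < (1 + K) * T by rewrite mulr_gt0 ?addr_gt0.
have cq : conv (Fps q) by exact: convS qB.
have cr : conv (Fps (fun n => fps_trunc e (k n q))).
  apply: convS (S0) _ => [|n]; last first.
    apply: norm_bound_le (step n (fun i _ => qB i)); first exact: ltW.
    by move=> j /=; case: ifP; rewrite ?normr0.
  by rewrite mulr_gt0.
exists (mkgerm cq), (mkgerm cr); split; last first.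
  by move=> i j ej; rewrite /= ltnNge ej.
apply: val_inj; apply: fpsP => n.
rewrite [RHS]fpsD fpsM big_ord_recr subnn /= fE [q n]qE.
(* Since u w = 1, the summand q_n f(0, Y) is exactly the part of k_n of degree >= e, and the
   remainder supplies the rest. *)
have -> : w * fps_shift e (k n q) * (fpsX _ ^+ e * u) =
  u * w * (fpsX _ ^+ e * fps_shift e (k n q)) by ring.
rewrite uw mul1r -addrA [X in _ + X]addrC -fps_split.
by rewrite /k addrC subrK.
Qed.

End Weierstrass.

(** * Divisibility of germs *)

Section Divisibility.
Variable C : numFieldType.
Implicit Types (a b f g h p q r u v w : germ C).

Lemma gX_divides a : (forall j, a 0 j = 0) -> exists b, a = gX C * b.
Proof.
move=> a0; have [|b ->] := @gXn_divides C 1 a; last by exists b; rewrite expr1.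
by move=> [|i] j.
Qed.

Lemma yord_exists a : (exists j, a 0 j <> 0) -> exists e, yord a e.
Proof.
case=> j aj; have exP : exists j, a 0 j != 0 by exists j; apply/eqP.
exists (ex_minn exP); case: ex_minnP => e ae emin; split; last exact/eqP.
move=> i ie; apply/eqP; apply: contraTT ie => /emin.
by rewrite -leqNgt.
Qed.

Lemma gX_power_divides a : a != 0 -> exists n b, a = gX C ^+ n * b /\
  exists j, b 0 j <> 0.
Proof.
move=> a0; have exP : exists i, `[< exists j, a i j <> 0 >].
  apply: contrapT => H; case/eqP: a0; apply: germP => i j.
  by apply: contrapT => aij; apply: H; exists i; apply/asboolP; exists j.
case: (ex_minnP exP) => n /asboolP[j anj] nmin.
have [i k i_n|b ab] := @gXn_divides C n a.
  apply: contrapT => aik; have := nmin i (asboolT (ex_intro _ k aik)).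
  by rewrite leqNgt i_n.
exists n, b; split => //; exists j; move: anj.
by rewrite ab gXnM_coef ltnn subnn.
Qed.

Lemma yord_factor a : a != 0 -> exists n b e, a = gX C ^+ n * b /\ yord b e.
Proof.
move=> /gX_power_divides[n [b [-> /yord_exists[e be]]]].
by exists n, b, e.
Qed.

Lemma yord_coef0 a b j :
  (a * b) 0 j = \sum_(l < j.+1) a 0 l * b 0 (j - l)%N.
Proof. by rewrite germM big_ord_recl big_ord0 addr0. Qed.

Lemma yordM a b e e' : yord a e -> yord b e' -> yord (a * b) (e + e').
Proof.
move=> [a0 ae] [b0 be]; split => [j je|].
  rewrite yord_coef0 big1 // => l _; case: (ltnP l e) => le.
    by rewrite a0 ?mul0r.
  by rewrite b0 ?mulr0 //; have := ltn_ord l; lia.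
have le : (e < (e + e').+1)%N by lia.
rewrite yord_coef0 (bigD1 (Ordinal le)) //= addKn big1 ?addr0 => [|l /eqP nl].
  by apply/eqP; rewrite mulf_neq0 //; apply/eqP.
case: (ltngtP l e) => [lt_e|gt_e|eq_e].
- by rewrite a0 ?mul0r.
- by rewrite b0 ?mulr0 //; have := ltn_ord l; lia.
- by case: nl; apply: val_inj.
Qed.

Lemma yord_uniq a e e' : yord a e -> yord a e' -> e = e'.
Proof.
move=> [a0 ae] [b0 be]; case: (ltngtP e e') => // [/b0|/a0] //.
Qed.

Lemma yord_neq0 a e : yord a e -> a != 0.
Proof. by case=> _ ae; apply: contra_notN ae => /eqP ->. Qed.

Lemma yord_gXM a e : ~ yord (gX C * a) e.
Proof. by case=> _; rewrite gXM_0. Qed.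

(** Once powers of X are split off, both factors have a y-order, and y-orders add up. *)
Lemma germ_mulf_eq0 a b : a * b = 0 -> a = 0 \/ b = 0.
Proof.
move=> ab; have [->|a0] := eqVneq a 0; first by left.
have [->|b0] := eqVneq b 0; first by right.
have [m [a' [e [aE ae]]]] := yord_factor a0.
have [n [b' [e' [bE be]]]] := yord_factor b0.
have := yord_neq0 (yordM ae be); case/eqP.
apply: (@gXn_lreg _ (m + n)); rewrite mulr0 -ab aE bE exprD; ring.
Qed.

Definition dvd a b := exists q, b = q * a.
Definition unit_germ a := a 0%N 0%N <> 0.
Definition irr g := [/\ g != 0, ~ unit_germ g &
  forall a b, g = a * b -> unit_germ a \/ unit_germ b].

(** Such a germ has y-order 0, so dividing 1 by it leaves a remainder of y-degree less than 0, which
    is zero. *)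
Lemma unit_germ_inv a : unit_germ a -> exists b, b * a = 1.
Proof.
move=> a0; have [|q [r [E r0]]] := @weierstrass_division C a 0 _ 1.
  by split.
exists q; rewrite E [r](_ : _ = 0) ?addr0 //.
by apply: germP => i j; apply: r0.
Qed.

Lemma unit_germP a b : a * b = 1 -> unit_germ a.
Proof.
move=> ab a0; have := congr1 (fun c : germ C => c 0%N 0%N) ab.
by rewrite germ00M a0 mul0r germ1 => /eqP; rewrite eq_sym oner_eq0.
Qed.

Lemma yord_factorl a b e : yord (a * b) e -> exists e', yord a e'.
Proof.
move=> [_ ab]; apply: yord_exists; apply: contrapT => H.
case: ab; rewrite yord_coef0 big1 // => l _.
by rewrite (_ : a 0 l = 0) ?mul0r //; apply: contrapT => al; apply: H; exists l.
Qed.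

Lemma yord_dvd g f e : dvd g f -> yord f e -> exists e', yord g e'.
Proof. by case=> q ->; rewrite mulrC; apply: yord_factorl. Qed.

Lemma dvd_mulr a b c : dvd a b -> dvd a (b * c).
Proof. by case=> q ->; exists (q * c); ring. Qed.
Lemma dvd_mull a b c : dvd a b -> dvd a (c * b).
Proof. by case=> q ->; exists (c * q); ring. Qed.
Lemma dvdD a b c : dvd a b -> dvd a c -> dvd a (b + c).
Proof. by case=> q -> [p ->]; exists (q + p); ring. Qed.
Lemma dvdB a b c : dvd a b -> dvd a c -> dvd a (b - c).
Proof. by case=> q -> [p ->]; exists (q - p); ring. Qed.
Lemma dvd_refl a : dvd a a. Proof. by exists 1; rewrite mul1r. Qed.
Lemma dvd0 a : dvd a 0. Proof. by exists 0; rewrite mul0r. Qed.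
Lemma dvd_trans b a c : dvd a b -> dvd b c -> dvd a c.
Proof. by case=> q -> [p ->]; exists (p * q); ring. Qed.
Lemma dvd_sum a n (F : 'I_n -> germ C) :
  (forall i, dvd a (F i)) -> dvd a (\sum_(i < n) F i).
Proof.
move=> aF; elim/big_ind: _ => [||i _]; [exact: dvd0|exact: dvdD|exact: aF].
Qed.

Lemma irr_not1 g : irr g -> ~ dvd g 1.
Proof. by case=> _ ng _ [q]; rewrite mulrC => /esym/unit_germP. Qed.

(* An ideal closed under division by X is generated by any of its members of
   least y-order: division leaves a remainder of smaller y-degree, hence, up to
   a power of X, of smaller y-order. *)
Lemma saturated_principal (I : germ C -> Prop) :
  (forall a b, I a -> I b -> I (a + b)) ->
  (forall a b, I b -> I (a * b)) ->
  (forall a, I (gX C * a) -> I a) ->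
  (exists2 a, I a & a != 0) ->
  exists g e, [/\ I g, yord g e & forall a, I a -> dvd g a].
Proof.
move=> ID IM IX [a0 Ia0 a00].
have IXn n a : I (gX C ^+ n * a) -> I a.
  by elim: n => [|n IH]; rewrite ?mul1r // exprS -mulrA => /IX /IH.
have exP : exists e, `[< exists2 g, I g & yord g e >].
  have [n [b [e [aE be]]]] := yord_factor a00.
  by exists e; apply/asboolP; exists b => //; apply: (IXn n); rewrite -aE.
case: (ex_minnP exP) => e /asboolP[g Ig ge] emin.
exists g, e; split => // h Ih.
have [q [r [hE r0]]] := weierstrass_division ge h.
exists q; rewrite hE; suff -> : r = 0 by rewrite addr0.
apply/eqP; apply: contraT => /yord_factor[n [b [e' [rE be]]]].
have Ir : I r.
  have -> : r = h + (- q) * g by rewrite hE; ring.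
  by apply: ID => //; apply: IM.
have [ee'|e'e] := leqP e e'.
  case: be => _ []; have := r0 n e' ee'.
  by rewrite rE gXnM_coef ltnn subnn.
suff : (e <= e')%N by rewrite leqNgt e'e.
by apply: emin; apply/asboolP; exists b => //; apply: (IXn n); rewrite -rE.
Qed.

(** Write X w = p g. If p(0, Y) were nonzero, p g would have a y-order, which a multiple of X never
    has; so X divides p. *)
Lemma gX_dvd_cancel g w e : yord g e -> dvd g (gX C * w) -> dvd g w.
Proof.
move=> ge [p pE]; have [p0|/existsNP[j pj]] := pselect (forall j, p 0 j = 0).
  have [p' p'E] := gX_divides p0; exists p'.
  by apply: gX_lreg; rewrite pE p'E mulrA.
have [e' pe'] : exists e', yord p e' by apply: yord_exists; exists j.
by have := yordM pe' ge; rewrite -pE => /yord_gXM.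
Qed.

Lemma gX_ndvd g e : irr g -> yord g e -> forall n, ~ dvd g (gX C ^+ n).
Proof.
move=> ig ge; elim=> [|n IH]; first by rewrite expr0; apply: irr_not1.
by rewrite exprS => /(gX_dvd_cancel ge).
Qed.

(** The colon ideal (g : a) is closed under division by X, hence generated by some q, and q divides
    g. Either q is associate to g, and b, which lies in the colon ideal, is a multiple of g; or q is
    a unit, and g divides a. *)
Lemma irr_prime g e a b : irr g -> yord g e ->
  dvd g (a * b) -> dvd g a \/ dvd g b.
Proof.
move=> [g0 ng gI] ge gab.
have [||||q [e' [Iq _ qI]]] := @saturated_principal (fun q => dvd g (a * q)).
- by move=> u v; rewrite mulrDr; apply: dvdD.
- by move=> u v; rewrite mulrCA; apply: dvd_mull.
- by move=> u; rewrite mulrCA; apply: gX_dvd_cancel ge.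
- by exists g => //; apply: dvd_mull; apply: dvd_refl.
have [p gE] : dvd q g by apply: qI; apply: dvd_mull; apply: dvd_refl.
have [up|uq] := gI p q gE.
  have [p' p'p] := unit_germ_inv up; right; apply: dvd_trans (qI b gab).
  by exists p'; rewrite gE mulrA p'p mul1r.
have [q' q'q] := unit_germ_inv uq; left.
by rewrite -[a]mulr1 -q'q mulrCA; apply: dvd_mull.
Qed.

(** By additivity of y-orders, one of two factors has y-order 0 and is a unit. *)
Lemma yord1_irr g : yord g 1 -> irr g.
Proof.
move=> g1; case: (g1) => g0 _; split; first exact: yord_neq0 g1.
  by rewrite /unit_germ g0.
move=> a b gE; rewrite gE in g1.
have [e ae] := yord_factorl g1.
have [e' be] : exists e', yord b e'.
  by rewrite mulrC in g1; apply: yord_factorl g1.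
have := yord_uniq (yordM ae be) g1.
case: e ae => [[_ ?]|e ae]; first by left.
by case: e' be => [[_ ?]|e' be]; [right | lia].
Qed.

Lemma irr_gX : irr (gX C).
Proof.
have X0 : gX C != 0.
  apply/eqP => /(congr1 (fun a : germ C => a 1%N 0%N)).
  by rewrite gX_coef germ0 /= => /eqP; rewrite oner_eq0.
split => //.
have U a b : gX C = a * b -> (forall j, a 0 j = 0) -> unit_germ b.
  move=> E /gX_divides[a' aE]; apply: (@unit_germP _ a').
  by rewrite mulrC; apply: gX_lreg; rewrite mulrA -aE -E mulr1.
move=> a b ab; case: (pselect (forall j, a 0 j = 0)) => [/(U _ _ ab)|]; first by right.
move=> /existsNP[j aj]; left; rewrite mulrC in ab; apply: (U _ _ ab) => i.
have [e ae] : exists e, yord a e by apply: yord_exists; exists j.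
apply: contrapT => bi; have [e' be] : exists e', yord b e' by apply: yord_exists; exists i.
by have := yordM be ae; rewrite -ab -[gX C]mulr1 => /yord_gXM.
Qed.

(** Induction on the y-order, which drops when a cofactor that is not a unit is removed. *)
Lemma irr_factor a e : yord a e -> (0 < e)%N -> exists2 g, irr g & dvd g a.
Proof.
elim/ltn_ind: e a => e IH a ae e0.
have na : ~ unit_germ a by case: ae => a0 _; rewrite /unit_germ a0.
case: (pselect (irr a)) => [ia|nia]; first by exists a => //; apply: dvd_refl.
have [b [c [aE nb nc]]] : exists b c, [/\ a = b * c, ~ unit_germ b & ~ unit_germ c].
  apply: contrapT => H; apply: nia; split=> [||b c aE]; rewrite ?(yord_neq0 ae) //.
  by apply: contrapT => /not_orP[nb nc]; apply: H; exists b, c.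
rewrite aE in ae.
have [e1 be] := yord_factorl ae.
have [e2 ce] : exists e', yord c e'.
  by move: ae; rewrite mulrC; apply: yord_factorl.
have e12 := yord_uniq (yordM be ce) ae.
have e10 : (0 < e1)%N by case: e1 be {e12} => // -[].
have e20 : (0 < e2)%N by case: e2 ce {e12} => // -[].
have [|g ig gb] := IH e1 _ b be e10; first by lia.
by exists g => //; rewrite aE; apply: dvd_mulr.
Qed.

(** The germs that some power of X carries into (f, h) form an ideal with a generator g. If g is a
    unit, a power of X lies in (f, h); otherwise an irreducible factor of g divides f and h. *)
Lemma common_factor f h e : yord f e ->
  (exists N a b, gX C ^+ N = a * f + b * h) \/
  (exists g, [/\ irr g, dvd g f & dvd g h]).
Proof.
move=> fe.
have [||||g [e' [[N [a [b E]]] ge gI]]] := @saturated_principal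
  (fun q => exists N a b, gX C ^+ N * q = a * f + b * h).
- move=> u v [N [a [b E]]] [M [c [d F]]]; exists (N + M), 
    (gX C ^+ M * a + gX C ^+ N * c), (gX C ^+ M * b + gX C ^+ N * d).
  have -> : gX C ^+ (N + M) * (u + v) =
    gX C ^+ M * (gX C ^+ N * u) + gX C ^+ N * (gX C ^+ M * v) by rewrite exprD; ring.
  by rewrite E F; ring.
- move=> u v [N [a [b E]]]; exists N, (u * a), (u * b).
  by rewrite mulrCA E; ring.
- by move=> u [N [a [b E]]]; exists N.+1, a, b; rewrite exprSr -mulrA.
- by exists f; rewrite ?(yord_neq0 fe) //; exists 0, 1, 0; rewrite expr0; ring.
have gf : dvd g f by apply: gI; exists 0, 1, 0; rewrite expr0; ring.
have gh : dvd g h by apply: gI; exists 0, 0, 1; rewrite expr0; ring.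
case: e' ge => [[_ /unit_germ_inv[g' g'g]]|e' ge].
  left; exists N, (g' * a), (g' * b).
  by rewrite -!mulrA -mulrDr -E mulrCA g'g mulr1.
have [//|k ik kg] := irr_factor ge _.
by right; exists k; split => //; apply: dvd_trans kg _.
Qed.

End Divisibility.

(** * Germs in X alone and linear algebra over C{x} *)

Section XOnly.
Variable C : numFieldType.
Implicit Types (a b f g u v : germ C).

Lemma xonly_factor a : xonly a -> a != 0 ->
  exists n b, [/\ a = gX C ^+ n * b, xonly b & unit_germ b].
Proof.
move=> ax a0; have [n [b [aE [j bj]]]] := gX_power_divides a0.
have bx : xonly b.
  by move=> i k k0; have := ax (i + n)%N k k0; rewrite aE gXnM_coef ltnNge leq_addl /= addnK.
exists n, b; split=> //; move=> b00; apply: bj.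
by case: j => [//|j]; apply: bx.
Qed.

(** A nonzero germ in X alone is a power of X times a unit, and the prime g, having a y-order,
    divides neither. *)
Lemma xonly_ndvd g e a : irr g -> yord g e -> xonly a -> a != 0 -> ~ dvd g a.
Proof.
move=> ig ge ax a0; have [n [b [-> _ /unit_germ_inv[b' b'b]]]] := xonly_factor ax a0.
case/(irr_prime ig ge) => [|[q bq]]; first exact: gX_ndvd ge n.
by apply: (irr_not1 ig); exists (b' * q); rewrite -mulrA -bq.
Qed.

Lemma d1_gX : d1 (gX C) = 1.
Proof.
apply: germP => i j; rewrite d1_coef gX_coef germ1 eqSS.
by case: i => [|i] //=; rewrite mul0rn.
Qed.

Lemma d2_gY : d2 (gY C) = 1.
Proof.
apply: germP => i j; rewrite d2_coef gY_coef germ1 eqSS.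
by case: j => [|j] //=; rewrite andbF mul0rn.
Qed.

Lemma d1_gY : d1 (gY C) = 0.
Proof. by apply: germP => i j; rewrite d1_coef gY_coef mul0rn. Qed.

Lemma d2_gC c : d2 (gC c : germ C) = 0.
Proof. exact/d2_xonly/xonly_gC. Qed.

Lemma d1_gC c : d1 (gC c : germ C) = 0.
Proof. by apply: germP => i j; rewrite d1_coef gC_coef mul0rn. Qed.

Lemma gX_d1_gXn n : gX C * d1 (gX C ^+ n) = n%:R * gX C ^+ n.
Proof.
elim: n => [|n IH]; first by rewrite expr0 -(rmorph1 (@gC C)) d1_gC mulr0 mul0r.
by rewrite exprS d1M d1_gX mulrDr mulrCA IH mulrS; ring.
Qed.

Lemma natr_gC n : n%:R = gC n%:R :> germ C. Proof. by rewrite rmorph_nat. Qed.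

(** The quotient b / a has derivative zero. The constant is read off at the order k of a. If d = b -
    c a were nonzero, its order l would differ from k, while a d' - a' d has lowest coefficient (l -
    k) times a nonzero number. *)
Lemma xonly_wronskian a b : xonly a -> xonly b -> a != 0 ->
  a * d1 b = d1 a * b -> exists c, b = gC c * a.
Proof.
move=> ax bx a0 ab; have [k [a' [aE a'x a'u]]] := xonly_factor ax a0.
have ak : a k 0%N = a' 0%N 0%N by rewrite aE gXnM_coef ltnn subnn.
exists (b k 0%N / a k 0%N); apply/eqP; rewrite -subr_eq0; apply: contraT.
set c := b k 0%N / _; set d := b - _ => d0.
have dx : xonly d by apply: xonlyB => //; apply: xonlyM => //; apply: xonly_gC.
have dk : d k 0%N = 0 by rewrite germB gCM_coef mulfVK ?subrr // ak; apply/eqP.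
have ad : a * d1 d = d1 a * d.
  by rewrite /d raddfB /= d1M d1_gC mul0r add0r !mulrBr ab; congr (_ - _); ring.
have [l [d' [dE d'x d'u]]] := xonly_factor dx d0.
have lk : l != k.
  by apply/eqP => lk; apply: d'u; rewrite -dk dE lk gXnM_coef ltnn subnn.
have E : (l%:R - k%:R) * (a' * d') + gX C * (a' * d1 d' - d1 a' * d') = 0.
  apply: (@gXn_lreg _ (k + l)).
  rewrite mulr0 -(subrr (gX C * (d1 a * d))) -{1}ad aE dE !d1M exprD.
  have := gX_d1_gXn k; have := gX_d1_gXn l.
  set xk := gX C ^+ k; set xl := gX C ^+ l => El Ek.
  have -> : gX C * (xk * a' * (d1 xl * d' + xl * d1 d')) =
    xk * a' * d' * (gX C * d1 xl) + gX C * (xk * xl * a' * d1 d') by ring.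
  have -> : gX C * ((d1 xk * a' + xk * d1 a') * (xl * d')) =
    xl * a' * d' * (gX C * d1 xk) + gX C * (xk * xl * d1 a' * d') by ring.
  by rewrite El Ek; ring.
have := congr1 (fun w : germ C => w 0%N 0%N) E.
rewrite germD gXM_0 addr0 natr_gC natr_gC -rmorphB gCM_coef germ00M => /eqP.
rewrite !mulf_eq0 subr_eq0 eqr_nat (negPf lk) /=.
by case/orP => /eqP.
Qed.

(** Fraction-free Gaussian elimination: a row p with nonzero last entry clears the last column of
    the other rows, which [bump p] enumerates. *)
Lemma xonly_dependent m (M : nat -> nat -> germ C) :
  (forall i j, xonly (M i j)) ->
  exists a : nat -> germ C, [/\ forall i, xonly (a i),
    exists2 i, (i <= m)%N & a i != 0 &
    forall j, (j < m)%N -> \sum_(i < m.+1) a i * M i j = 0].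
Proof.
elim: m M => [|m IH] M Mx.
  exists (fun=> 1); split=> // [i|]; first exact: xonly1.
  by exists 0%N => //; apply: oner_neq0.
have [[p Mp]|nM] := pselect (exists p : 'I_m.+2, M p m != 0).
  pose M' i j := M p m * M (bump p i) j - M (bump p i) m * M p j.
  have [|a' [a'x [i0 i0m a'i] a'M]] := IH M'.
    by move=> i j; apply: xonlyB; apply: xonlyM.
  (* The solution of the smaller system is multiplied by the pivot, and the pivot row gets the
     coefficient that cancels the last column. *)
  pose a (k : nat) := if k == p :> nat then - \sum_(i < m.+1) a' i * M (bump p i) m
    else a' (unbump p k) * M p m.
  have aB i : a (bump p i) = a' i * M p m.
    by rewrite /a eq_sym (negPf (neq_bump _ _)) bumpK.
  exists a; split.
  - move=> i; rewrite /a; case: eqP => _; last exact: xonlyM.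
    rewrite -sub0r; apply: xonlyB; first exact: xonly0.
    by elim/big_ind: _ => [|b c|k _]; [exact: xonly0|exact: xonlyD|exact: xonlyM].
  - exists (bump p i0).
      by rewrite /bump; case: (p <= i0)%N; rewrite ?add1n ?add0n ?ltnS // ltnW.
    rewrite aB; apply/eqP => /germ_mulf_eq0[/eqP|/eqP].
      by rewrite (negPf a'i).
    by rewrite (negPf Mp).
  move=> j; rewrite (bigD1_ord p) //= {1}/a eqxx mulNr mulr_suml.
  under [X in _ + X]eq_bigr => i _ do rewrite aB.
  rewrite addrC -sumrB => jm.
  transitivity (\sum_(i < m.+1) a' i * M' i j).
    by apply: eq_bigr => i _; rewrite /M'; ring.
  move: jm; rewrite ltnS leq_eqVlt => /orP[/eqP -> | /a'M //].
  by rewrite big1 // => i _; rewrite /M' [M p m * _]mulrC subrr mulr0.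
have M0 (i : 'I_m.+2) : M i m = 0.
  by apply/eqP; apply: contrapT => Mi; apply: nM; exists i; apply/negP.
have [a [ax [i0 i0m ai] aM]] := IH M Mx.
exists (fun i => if (i <= m)%N then a i else 0); split.
- by move=> i; case: ifP => _; [apply: ax | apply: xonly0].
- by exists i0; rewrite ?i0m // leqW.
move=> j; rewrite ltnS leq_eqVlt => /orP[/eqP -> | /aM E].
  by rewrite big1 // => i _; rewrite M0 mulr0.
rewrite big_ord_recr /= ltnn mul0r addr0 -[RHS]E; apply: eq_bigr => i _.
by rewrite -ltnS ltn_ord.
Qed.

Lemma ydeg_lt_decomposition e r : ydeg_lt e r ->
  exists2 c : nat -> germ C, (forall j, xonly (c j)) &
    r = \sum_(j < e) c j * gY C ^+ j.
Proof.
elim: e r => [|e IH] r rd.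
  exists (fun=> 0) => [j|]; first exact: xonly0.
  by rewrite big_ord0; apply: germP => i j; apply: rd.
have [b rE] := split_xonly r.
have [|c cx bE] := IH b.
  move=> i j ej; have := rd i j.+1 ej; rewrite rE germD gYM_S.
  by rewrite restr_xonly // add0r.
exists (fun j => if j is k.+1 then c k else restr r) => [[|j]//|].
  exact: restr_xonly.
rewrite big_ord_recl /= expr0 mulr1 {1}rE bE; congr (_ + _).
by rewrite mulr_sumr; apply: eq_bigr => i _; rewrite exprS mulrCA.
Qed.

End XOnly.

(** * First integrals along a component *)

Section Hamiltonian.
Variable C : numFieldType.
Implicit Types (a b f g u v w : germ C).

Definition ham f u := d2 f * d1 u - d1 f * d2 u.

Lemma hamM f u v : ham f (u * v) = ham f u * v + u * ham f v.
Proof. by rewrite /ham d1M d2M; ring. Qed.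
Lemma hamD f u v : ham f (u + v) = ham f u + ham f v.
Proof. by rewrite /ham !raddfD /=; ring. Qed.
Lemma hamB f u v : ham f (u - v) = ham f u - ham f v.
Proof. by rewrite /ham !raddfB /=; ring. Qed.
Lemma ham_gC f c : ham f (gC c) = 0.
Proof. by rewrite /ham d1_gC d2_gC !mulr0 subr0. Qed.
Lemma ham1 f : ham f 1 = 0.
Proof. by rewrite -(rmorph1 (@gC C)) ham_gC. Qed.
Lemma ham_gX f : ham f (gX C) = d2 f.
Proof. by rewrite /ham d1_gX (d2_xonly (@xonly_gX C)) mulr0 mulr1 subr0. Qed.
Lemma ham_gY f : ham f (gY C) = - d1 f.
Proof. by rewrite /ham d1_gY d2_gY mulr0 mulr1 sub0r. Qed.
Lemma ham_exp f u n : ham f (u ^+ n.+1) = n.+1%:R * u ^+ n * ham f u.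
Proof.
elim: n => [|n IH]; first by rewrite !expr1 expr0 mulr1 mul1r.
by rewrite exprS hamM IH [n.+2%:R]mulrS exprS; ring.
Qed.

(** For f = k g one has H(g) = g (k_y g_x - k_x g_y), so H preserves the ideal (g) and acts on O
    modulo g. *)
Lemma ham_dvd f k g u : f = k * g -> dvd g u -> dvd g (ham f u).
Proof.
move=> -> [q ->]; exists (ham (k * g) q + q * (d2 k * d1 g - d1 k * d2 g)).
by rewrite /ham !d1M !d2M; ring.
Qed.

(** The homogenised value v^n p(u / v), where p is the polynomial with coefficients [a]. *)
Definition binary_form (u v : germ C) n (a : nat -> germ C) :=
  \sum_(i < n.+1) a i * u ^+ i * v ^+ (n - i).

Lemma binary_formS u v n (a : nat -> germ C) :
  binary_form u v n.+1 a = v * binary_form u v n a + a n.+1 * u ^+ n.+1.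
Proof.
rewrite /binary_form big_ord_recr /= subnn expr0 mulr1; congr (_ + _).
rewrite mulr_sumr; apply: eq_bigr => i _.
by rewrite subSn ?exprS; [ring | rewrite -ltnS ltn_ord].
Qed.

Lemma binary_form0 u v (a : nat -> germ C) : binary_form u v 0 a = a 0%N.
Proof. by rewrite /binary_form big_ord_recl big_ord0 !expr0 !mulr1 addr0. Qed.

(** Leibniz and Euler: H(F) is f_y times the form with differentiated coefficients, plus F_u H(u) +
    F_v H(v), and v F_v = n F - u F_u. The witness [w] is F_u. *)
Lemma ham_binary_form f u v n (a : nat -> germ C) : (forall i, xonly (a i)) ->
  exists w, v * ham f (binary_form u v n a) =
    v * d2 f * binary_form u v n (@d1 C \o a) + n%:R * ham f v * binary_form u v n a
    + w * (v * ham f u - u * ham f v).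
Proof.
move=> ax; have hx b : xonly b -> ham f b = d2 f * d1 b.
  by move=> bx; rewrite /ham (d2_xonly bx) mulr0 subr0.
elim: n => [|n [w IH]].
  by exists 0; rewrite !binary_form0 hx //=; ring.
exists (v * w + n.+1%:R * a n.+1 * u ^+ n).
rewrite !binary_formS hamD hamM [ham f (a _ * _)]hamM ham_exp (hx _ (ax n.+1)).
set S := binary_form u v n a in IH *; set S' := binary_form _ _ _ _ in IH *.
rewrite [(_ \o _) _]/= !addrA mulrDr mulrDr mulrDr [v * (v * _)]mulrCA.
rewrite IH [n.+1%:R]mulrS exprS; ring.
Qed.

End Hamiltonian.

Section Constants.
Variable C : numClosedFieldType.
Implicit Types (a b f g u v w : germ C).

(** Over an algebraically closed field the form splits into linear factors, all of the shape u - c v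
    because the leading coefficient of [p] is nonzero; the prime g divides one of them. *)
Lemma binary_form_root g e u v n (p : {poly C}) : irr g -> yord g e ->
  size p = n.+1 -> dvd g (binary_form u v n (fun i => gC p`_i)) ->
  exists c, dvd g (u - gC c * v).
Proof.
move=> ig ge; elim: n p => [|n IH] p sp.
  rewrite binary_form0 => /(xonly_ndvd ig ge (@xonly_gC _ _)) H; case: H.
  rewrite -(rmorph0 (@gC C)); apply/eqP => /(congr1 (fun w : germ C => w 0%N 0%N)).
  rewrite !gC_coef /= => p0; have : lead_coef p != 0.
    by rewrite lead_coef_eq0 -size_poly_eq0 sp.
  by rewrite lead_coefE sp /= p0 eqxx.
have [r /factor_theorem[q pE]] : exists r, root p r.
  by apply/closed_rootP; rewrite sp.
have sq : size q = n.+1.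
  have q0 : q != 0.
    by apply: contra_eq_neq sp => q0; rewrite pE q0 mul0r size_poly0.
  by move: sp; rewrite pE size_Mmonic ?monicXsubC // size_XsubC addn2 /= => -[].
have qn : q`_n.+1 = 0 by apply: nth_default; rewrite sq.
have -> : binary_form u v n.+1 (fun i => gC p`_i) =
    (u - gC r * v) * binary_form u v n (fun i => gC q`_i).
  rewrite /binary_form pE.
  under eq_bigr => i _ do rewrite mulrBr coefB coefMX coefMC rmorphB /= !mulrBl.
  rewrite sumrB mulrBl; congr (_ - _).
    rewrite big_ord_recl /= rmorph0 !mul0r add0r mulr_sumr.
    by apply: eq_bigr => i _; rewrite exprS subSS; ring.
  rewrite big_ord_recr /= qn mul0r rmorph0 !mul0r addr0 mulr_sumr.
  apply: eq_bigr => i _; rewrite subSn ?exprS ?rmorphM /=; first ring.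
  by rewrite -ltnS ltn_ord.
by case/(irr_prime ig ge) => [|/(IH q sq)//]; exists r.
Qed.

(* The germs u^i v^(e-i) are linearly dependent over C{x} modulo g, so u / v
   is algebraic over C{x}; applying the derivation to a relation of least
   degree shows that its coefficients are proportional to constants, hence
   u / v is a root of a polynomial over C. *)
Lemma ham_constant f g k e u v : irr g -> yord g e -> f = k * g ->
  ~ dvd g (d2 f) -> ~ dvd g v -> dvd g (v * ham f u - u * ham f v) ->
  exists c, dvd g (u - gC c * v).
Proof.
move=> ig ge fE nf nv uv.
have [N [a0 [a0x [i0 i0N ai0] da0]]] : exists N (a : nat -> germ C),
   [/\ forall i, xonly (a i), exists2 i, (i <= N)%N & a i != 0 &
      dvd g (binary_form u v N a)].
  (* By division O modulo g is generated over C{x} by 1, Y, ..., Y^(e-1), so the e + 1 products u^i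
     v^(e-i) are dependent. *)
  have /choice[r rP] : forall i, exists r, ydeg_lt e r /\
      dvd g (u ^+ i * v ^+ (e - i) - r).
    move=> i; have [q [r [E rd]]] := weierstrass_division ge (u ^+ i * v ^+ (e - i)).
    by exists r; split => //; exists q; rewrite E addrK.
  have /choice[M MP] : forall i, exists c : nat -> germ C,
      (forall j, xonly (c j)) /\ r i = \sum_(j < e) c j * gY C ^+ j.
    by move=> i; have [c cx cE] := ydeg_lt_decomposition (rP i).1; exists c.
  have [a [ax an aM]] := @xonly_dependent C e M (fun i => (MP i).1).
  exists e, a; split => //.
  have -> : binary_form u v e a = \sum_(i < e.+1) a i * (u ^+ i * v ^+ (e - i) - r i).
    rewrite /binary_form; under [RHS]eq_bigr do rewrite mulrBr.
    rewrite sumrB [X in _ - X](_ : _ = 0) ?subr0.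
      by apply: eq_bigr => i _; rewrite mulrA.
    under eq_bigr => i _ do rewrite (MP i).2 mulr_sumr.
    rewrite exchange_big /= big1 // => j _.
    under eq_bigr do rewrite mulrA; rewrite -mulr_suml.
    by rewrite aM ?mul0r.
  by apply: dvd_sum => i; apply: dvd_mull; apply: (rP i).2.
have exP : exists n, `[< exists a : nat -> germ C,
   [/\ forall i, xonly (a i), exists2 i, (i <= n)%N & a i != 0 &
      dvd g (binary_form u v n a)] >].
  by exists N; apply/asboolP; exists a0; split => //; exists i0.
case: (ex_minnP exP) => n /asboolP[a [ax [i ilen ai] da]] nmin.
(* A relation with vanishing top coefficient is v times a relation of smaller degree, so by
   minimality it is trivial. *)
have top (b : nat -> germ C) : (forall i, xonly (b i)) -> dvd g (binary_form u v n b) -> b n = 0 ->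
    forall i, (i <= n)%N -> b i = 0.
  move=> bx db bn j jn; apply/eqP; apply: contraT => bj.
  have jn' : (j < n)%N.
    by rewrite ltn_neqAle jn andbT; apply: contraNneq bj => ->; rewrite bn.
  case: n nmin db bn jn jn' {ilen da} => // m nmin db bn jn jm.
  suff : (m.+1 <= m)%N by rewrite ltnn.
  apply: nmin; apply/asboolP; exists b; split => //; first by exists j.
  move: db; rewrite binary_formS bn mul0r addr0.
  by case/(irr_prime ig ge).
have an : a n != 0.
  by apply: contraNneq ai => /(top a ax da)->.
(* H of the relation lies in (g). Up to multiples of g it is, after multiplication by v, the
   differentiated relation times v f_y, and g divides neither v nor f_y. *)
have dd : dvd g (binary_form u v n (@d1 C \o a)).
  have [w E] := ham_binary_form f u v n ax.
  have : dvd g (v * d2 f * binary_form u v n (@d1 C \o a)).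
    have -> : v * d2 f * binary_form u v n (@d1 C \o a) =
      v * ham f (binary_form u v n a) - n%:R * ham f v * binary_form u v n a
      - w * (v * ham f u - u * ham f v) by rewrite E; ring.
    apply: dvdB; last exact: dvd_mull.
    by apply: dvdB; apply: dvd_mull => //; apply: ham_dvd fE da.
  by case/(irr_prime ig ge) => // /(irr_prime ig ge)[].
have bx (b c : nat -> germ C) : (forall i, xonly (b i)) -> (forall i, xonly (c i)) ->
   binary_form u v n (fun i => a n * b i - d1 (a n) * c i) =
   a n * binary_form u v n b - d1 (a n) * binary_form u v n c.
  move=> _ _; rewrite /binary_form !mulr_sumr -sumrB; apply: eq_bigr => j _; ring.
(* The combinations a_n a_i' - a_n' a_i form a relation whose top coefficient vanishes; so all are
   zero and each a_i is a constant multiple of a_n. *)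
have /choice[c cE] : forall i, exists c, (i <= n)%N -> a i = gC c * a n.
  move=> j; have [jn|_] := leqP j n; last by exists 0.
  have [|c cE] := xonly_wronskian (ax n) (ax j) an; last by exists c.
  apply/eqP; rewrite -subr_eq0; apply/eqP.
  apply: (top (fun i => a n * d1 (a i) - d1 (a n) * a i)) jn => [l||].
  - by apply: xonlyB; apply: xonlyM => //; apply: xonly_d1.
  - rewrite (bx (@d1 C \o a)) // => [|l]; last exact: xonly_d1.
    by apply: dvdB; apply: dvd_mull.
  - by rewrite [d1 _ * _]mulrC subrr.
have cn : c n != 0.
  apply: contraNneq an => cn.
  by rewrite (cE n (leqnn n)) cn rmorph0 mul0r.
apply: (@binary_form_root g e u v n (\poly_(i < n.+1) c i)) => //.
  by rewrite size_poly_eq.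
have : dvd g (a n * binary_form u v n (fun i => gC (\poly_(i < n.+1) c i)`_i)).
  suff -> : a n * binary_form u v n (fun i => gC (\poly_(i < n.+1) c i)`_i) =
     binary_form u v n a by [].
  rewrite /binary_form mulr_sumr; apply: eq_bigr => j _.
  rewrite coef_poly ltn_ord [in RHS]cE; last by rewrite -ltnS.
  ring.
by case/(irr_prime ig ge) => // /(xonly_ndvd ig ge (ax n) an).
Qed.

End Constants.

(** * Inflections and vertices *)

Section SingularComponents.
Variable C : numClosedFieldType.
Implicit Types (a b f g h u v w : germ C).

Lemma d1_natr n : d1 (n%:R : germ C) = 0. Proof. by rewrite natr_gC d1_gC. Qed.
Lemma d2_natr n : d2 (n%:R : germ C) = 0. Proof. by rewrite natr_gC d2_gC. Qed.

Lemma d1D a b : d1 (a + b) = d1 a + d1 b. Proof. exact: raddfD. Qed.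
Lemma d2D a b : d2 (a + b) = d2 a + d2 b. Proof. exact: raddfD. Qed.
Lemma d1N a : d1 (- a) = - d1 a. Proof. exact: raddfN. Qed.
Lemma d2N a : d2 (- a) = - d2 a. Proof. exact: raddfN. Qed.

Definition d_simp := (d1M, d2M, d1D, d2D, d1N, d2N, d1_natr, d2_natr, d1_gX, d2_gY,
  d1_gY, d1_gC, d2_gC, d2_xonly (@xonly_gX C)).

Lemma gC_natr00 n : (n%:R : germ C) 0%N 0%N = n%:R.
Proof. by rewrite natr_gC gC_coef. Qed.

Definition infl f := d2 f ^+ 2 * d1 (d1 f) - 2 * d1 f * d2 f * d2 (d1 f)
  + d1 f ^+ 2 * d2 (d2 f).

Definition vert f :=
  (d1 f ^+ 2 + d2 f ^+ 2) *
    (d1 f ^+ 3 * d2 (d2 (d2 f)) - 3 * d1 f ^+ 2 * d2 f * d2 (d2 (d1 f))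
     + 3 * d1 f * d2 f ^+ 2 * d2 (d1 (d1 f)) - d2 f ^+ 3 * d1 (d1 (d1 f)))
  - 3 * ((d1 f ^+ 2 - d2 f ^+ 2) * d2 (d1 f) - d1 f * d2 f * (d1 (d1 f) - d2 (d2 f)))
    * infl f.

(** In other words i_f = f_y^2 H(f_x / f_y), the derivative of the slope along the curve. *)
Lemma infl_ham f : infl f = d2 f * ham f (d1 f) - d1 f * ham f (d2 f).
Proof. by rewrite /infl /ham d1d2; ring. Qed.

(** With s = f_x^2 + f_y^2 and I = i_f, the right side is -(s^4 / I) H(I^2 / s^3): vertices are
    where the squared curvature is stationary. *)
Lemma vert_ham f : 2 * vert f = 3 * infl f * ham f (d1 f ^+ 2 + d2 f ^+ 2)
  - 2 * (d1 f ^+ 2 + d2 f ^+ 2) * ham f (infl f).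
Proof.
rewrite /vert /infl /ham !expr2 !d_simp. rewrite !d1d2; ring.
Qed.

Lemma dvd_double g u : dvd g (2 * u) -> dvd g u.
Proof.
move=> gu; have -> : u = gC (2^-1) * (2 * u); last exact: dvd_mull.
by rewrite mulrA natr_gC -rmorphM /= mulVf ?pnatr_eq0 // rmorph1 mul1r.
Qed.

(** The irreducible g vanishes at 0, so its whole 1-jet is zero, and this passes to multiples. It is
    the obstruction to g lying on a line or a circle. *)
Lemma dvd_singular g w : irr g -> g 1%N 0%N = 0 -> g 0%N 1%N = 0 -> dvd g w ->
  [/\ w 0%N 0%N = 0, d1 w 0%N 0%N = 0 & d2 w 0%N 0%N = 0].
Proof.
move=> [_ ng _] g1 g2 [q ->]; have g0 : g 0%N 0%N = 0 by apply: contrapT.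
have g1' : d1 g 0%N 0%N = 0 by rewrite d1_coef g1 mul0rn.
have g2' : d2 g 0%N 0%N = 0 by rewrite d2_coef g2 mul0rn.
rewrite d1M d2M germ00M g0 mulr0.
by rewrite germD [(d1 q * g) _ _]germ00M [(q * d1 g) _ _]germ00M g0 g1'
  germD [(d2 q * g) _ _]germ00M [(q * d2 g) _ _]germ00M g0 g2' !mulr0 addr0.
Qed.

Section Component.
Variables (f g k : germ C) (e : nat).
Hypotheses (ig : irr g) (ge : yord g e) (fE : f = k * g).
Hypotheses (g10 : g 1%N 0%N = 0) (g01 : g 0%N 1%N = 0) (nf : ~ dvd g (d2 f)).

Let const u v := @ham_constant C f g k e u v ig ge fE nf.

(** If f_x = c f_y on g, then H(Y + c X) = -f_x + c f_y vanishes on g. So g divides some Y + c X -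
    c', whose Y-derivative at 0 is 1. *)
Lemma line_component c : ~ dvd g (d1 f - gC c * d2 f).
Proof.
move=> gc; have [|c' gl] := const (@irr_not1 C g ig) (u := gY C + gC c * gX C).
  rewrite ham1 mulr0 subr0 mul1r hamD hamM ham_gC ham_gX ham_gY.
  have -> : - d1 f + (0 * gX C + gC c * d2 f) = 0 - (d1 f - gC c * d2 f) by ring.
  by apply: dvdB => //; apply: dvd0.
have [_ _ /eqP] := dvd_singular ig g10 g01 gl.
rewrite mulr1 !d_simp mul0r mulr0 !addr0 subr0 germ1 /=.
by rewrite oner_eq0.
Qed.

Lemma infl_component : ~ dvd g (infl f).
Proof.
rewrite infl_ham => /(const nf)[c].
exact: line_component.
Qed.

Lemma vert_component : ~ dvd g (vert f).
Proof.
move=> gv; pose s := d1 f ^+ 2 + d2 f ^+ 2; pose I := infl f.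
have factor u v : u ^+ 2 + v ^+ 2 = (u - gC 'i * v) * (u - gC (- 'i) * v).
  rewrite rmorphN; transitivity (u ^+ 2 - gC 'i ^+ 2 * v ^+ 2); last by ring.
  by rewrite -rmorphXn sqrCi rmorphN rmorph1; ring.
(* The two factors of s correspond to the isotropic tangent directions; a constant direction makes
   the component a line. *)
have ns : ~ dvd g s.
  by rewrite /s factor => /(irr_prime ig ge)[] /line_component.
have nI : ~ dvd g I by exact: infl_component.
have gW : dvd g (2 * s * ham f I - 3 * I * ham f s).
  rewrite -opprB -vert_ham -sub0r; apply: dvdB; first exact: dvd0.
  exact: dvd_mull.
have IE : I = d2 f * ham f (d1 f) - d1 f * ham f (d2 f) by apply: infl_ham.
have hs : ham f s = 2 * (d1 f * ham f (d1 f) + d2 f * ham f (d2 f)).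
  by rewrite /s hamD !expr2 !hamM; ring.
(* The centre of curvature ((X I - f_x s) / I, (Y I - f_y s) / I) is constant
   along the component, which therefore lies on a circle. *)
have [|a0 ga] := const nI (u := gX C * I - d1 f * s).
  apply: dvd_double; rewrite hamB !hamM ham_gX.
  have -> : 2 * (I * (d2 f * I + gX C * ham f I - (ham f (d1 f) * s + d1 f * ham f s)) -
    (gX C * I - d1 f * s) * ham f I) = d1 f * (2 * s * ham f I - 3 * I * ham f s).
    by rewrite hs; move: (ham f I) => hI; rewrite IE /s; ring.
  exact: dvd_mull.
have [|b0 gb] := const nI (u := gY C * I - d2 f * s).
  apply: dvd_double; rewrite hamB !hamM ham_gY.
  have -> : 2 * (I * (- d1 f * I + gY C * ham f I - (ham f (d2 f) * s + d2 f * ham f s)) -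
    (gY C * I - d2 f * s) * ham f I) = d2 f * (2 * s * ham f I - 3 * I * ham f s).
    by rewrite hs; move: (ham f I) => hI; rewrite IE /s; ring.
  exact: dvd_mull.
(* The squared distance to the constant centre (a0, b0). In I H(w) the terms containing s cancel,
   because the field (f_y, -f_x) is orthogonal to the gradient. *)
pose w := (gX C - gC a0) ^+ 2 + (gY C - gC b0) ^+ 2.
have gw : dvd g (ham f w).
  have : dvd g (I * ham f w).
    have -> : I * ham f w = 2 * d2 f * (gX C * I - d1 f * s - gC a0 * I)
       - 2 * d1 f * (gY C * I - d2 f * s - gC b0 * I).
      by rewrite /w hamD !expr2 !hamM !hamB !ham_gC ham_gX ham_gY; ring.
    by apply: dvdB; apply: dvd_mull.
  by case/(irr_prime ig ge).
have [|c gc] := const (@irr_not1 C g ig) (u := w).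
  by rewrite ham1 mulr0 subr0 mul1r.
(* The 1-jet of w - c vanishes, which forces a0 = b0 = c = 0. The circle degenerates to X^2 + Y^2, a
   product of two linear forms. *)
have [w0 w1 w2] := dvd_singular ig g10 g01 gc.
have two0 (x : C) (z : germ C) : z 0%N 0%N = 0 -> (2 * (z - gC x)) 0%N 0%N = 0 -> x = 0.
  move=> z0; rewrite germ00M gC_natr00 germB z0 gC_coef sub0r => /eqP.
  by rewrite mulf_eq0 pnatr_eq0 oppr_eq0 => /eqP.
have a00 : a0 = 0.
  apply: (two0 _ (gX C)); rewrite ?gX_coef // -[RHS]w1; congr (gser _ _ _).
  by rewrite mulr1 /w !expr2 !d_simp; ring.
have b00 : b0 = 0.
  apply: (two0 _ (gY C)); rewrite ?gY_coef // -[RHS]w2; congr (gser _ _ _).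
  by rewrite mulr1 /w !expr2 !d_simp; ring.
have c0 : c = 0.
  apply/eqP; rewrite -oppr_eq0 -[X in _ == X]w0 /w a00 b00 rmorph0 !subr0 mulr1 !expr2.
  rewrite germB germD [(gX C * _) _ _]germ00M [(gY C * _) _ _]germ00M gC_coef.
  by rewrite gX_coef gY_coef !mul0r !add0r.
move: gc; rewrite c0 /w a00 b00 rmorph0 mul0r !subr0 factor => gc.
have nl (b : C) : ~ dvd g (gX C - gC b * gY C).
  move=> gl; have [_ /eqP + _] := dvd_singular ig g10 g01 gl.
  by rewrite !d_simp mul0r mulr0 addr0 subr0 germ1 oner_eq0.
by case: (irr_prime ig ge gc) => /nl.
Qed.

End Component.

(** * Powers of X in the Jacobian, inflection and vertex ideals *)

Section Reduced.
Variables (f : germ C) (d : nat).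
Hypotheses (fd : yord f d).
Hypothesis reduced : forall g, irr g -> ~ dvd (g * g) f.

Lemma yord_d2 g e : yord g e.+1 -> yord (d2 g) e.
Proof.
move=> [g0 ge]; split => [j je|]; rewrite d2_coef.
  by rewrite g0 // mul0rn.
by apply/eqP; rewrite mulrn_eq0 /=; apply/eqP.
Qed.

(** With f = k g, the hypothesis g | f_y gives g | k g_y. The prime g does not divide k, as f is
    reduced, nor g_y, whose y-order is one less than that of g. *)
Lemma reduced_d2 g : irr g -> dvd g f -> ~ dvd g (d2 f).
Proof.
move=> ig gf; have [e ge] := yord_dvd gf fd; case: gf => k fE.
rewrite fE d2M => gd.
have : dvd g (k * d2 g).
  have -> : k * d2 g = d2 k * g + k * d2 g - d2 k * g by ring.
  by apply: dvdB => //; apply: dvd_mull; apply: dvd_refl.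
case/(irr_prime ig ge) => [[q kE]|[q qE]].
  by apply: (reduced ig); exists q; rewrite fE kE; ring.
case: e ge => [[_ g0]|e ge]; first by case: ig => _ [].
have [e' qe] : exists e', yord q e'.
  by apply: (@yord_factorl _ q g e); rewrite -qE; apply: yord_d2.
have := yordM qe ge; rewrite -qE => /(yord_uniq (yord_d2 ge)); lia.
Qed.

Lemma jacobian_power : exists N a b, gX C ^+ N = a * f + b * d2 f.
Proof.
have [//|[g [ig gf gd]]] := common_factor (d2 f) fd.
by case: (reduced_d2 ig gf).
Qed.

Hypothesis singular : forall g, irr g -> dvd g f ->
  g 1%N 0%N = 0 /\ g 0%N 1%N = 0.

Lemma infl_power : exists N a b, gX C ^+ N = a * f + b * infl f.
Proof.
have [//|[g [ig gf gi]]] := common_factor (infl f) fd.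
have [e ge] := yord_dvd gf fd; have [g1 g2] := singular ig gf.
have nd := reduced_d2 ig gf; case: gf => k fE.
by case: (infl_component ig ge fE).
Qed.

Lemma vert_power : exists N a b, gX C ^+ N = a * f + b * vert f.
Proof.
have [//|[g [ig gf gi]]] := common_factor (vert f) fd.
have [e ge] := yord_dvd gf fd; have [g1 g2] := singular ig gf.
have nd := reduced_d2 ig gf; case: gf => k fE.
by case: (vert_component ig ge fE).
Qed.

End Reduced.

(** Modulo f each germ is a remainder of y-degree below d, and modulo X^N such a remainder is known
    by N d coefficients. More than N d germs thus have a combination whose remainder is a multiple
    of X^N. *)
Lemma codim_bound f h d N a b n (H : 'I_n -> germ C) : yord f d ->
  gX C ^+ N = a * f + b * h -> (N * d < n)%N ->
  exists c : 'I_n -> C, (exists i, c i != 0) /\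
    exists p q, \sum_(i < n) gC (c i) * H i = p * f + q * h.
Proof.
move=> fd XN Nn.
have /choice[q qP] : forall i, exists q, ydeg_lt d (H i - q * f).
  move=> i; have [q [r [E rd]]] := weierstrass_division fd (H i).
  by exists q; rewrite E addrC addKr.
pose r i := H i - q i * f.
pose M : 'M[C]_(n, N * d) := \matrix_(i, j)
  mxvec (\matrix_(k < N, l < d) r i k l) 0 j.
have : kermx M != 0.
  rewrite kermx_eq0 /row_free; apply/eqP => rM.
  by have := rank_leq_col M; rewrite rM leqNgt Nn.
case/rowV0Pn => c /sub_kermxP cM c0.
exists (fun i => c 0 i); split.
  apply/existsP; apply: contraT; rewrite negb_exists => /forallP c00.
  by case/negP: c0; apply/eqP/rowP => i; rewrite mxE; apply/eqP; rewrite -[_ == _]negbK c00.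
have [s sE] : exists s, \sum_(i < n) gC (c 0 i) * r i = gX C ^+ N * s.
  apply: gXn_divides => k l kN; rewrite germ_sum.
  have [ld|dl] := ltnP l d; last first.
    by rewrite big1 // => i _; rewrite gCM_coef qP ?mulr0.
  have := congr1 (fun A : 'rV[C]_(N * d) => A 0 (mxvec_index (Ordinal kN) (Ordinal ld))) cM.
  rewrite !mxE => E; rewrite -[RHS]E; apply: eq_bigr => i _.
  by rewrite gCM_coef mxE mxvecE mxE.
exists (\sum_(i < n) gC (c 0 i) * q i + s * a), (s * b).
have -> : \sum_(i < n) gC (c 0 i) * H i =
   \sum_(i < n) gC (c 0 i) * r i + (\sum_(i < n) gC (c 0 i) * q i) * f.
  by rewrite mulr_suml -big_split /=; apply: eq_bigr => i _; rewrite /r; ring.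
by rewrite sE XN; ring.
Qed.

End SingularComponents.

(** * Evaluation of convergent series *)

Section GeometricLimits.
Variable R : realType.
Local Notation C := (Cplx R).

Lemma cplx_gt0P (x : C) : 0 < x -> exists2 e : R, 0 < e & x = e%:C%C.
Proof.
move=> x0; have xr : x \is Num.real by rewrite realE ltW.
exists (complex.Re x); last by rewrite RRe_real.
by rewrite -ltcR RRe_real.
Qed.

Lemma cplx_ge0P (x : C) : 0 <= x -> exists2 e : R, 0 <= e & x = e%:C%C.
Proof.
move=> x0; have xr : x \is Num.real by rewrite realE x0.
exists (complex.Re x); last by rewrite RRe_real.
by rewrite -lecR RRe_real.
Qed.

Lemma half_pow_small (K e : C) : 0 <= K -> 0 < e ->
  exists N, forall n, (N <= n)%N -> K * 2^-1 ^+ n < e.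
Proof.
move=> /cplx_ge0P[k k0 ->] /cplx_gt0P[d d0 ->].
exists (Num.bound (k / d)) => n Nn.
have kd : k / d < n%:R.
  apply: lt_le_trans (_ : (Num.bound (k / d))%:R <= n%:R); last by rewrite ler_nat.
  by apply: archi_boundP; rewrite divr_ge0 // ltW.
have n2 : n%:R <= 2 ^+ n :> C by rewrite -natrX ler_nat ltnW // ltn_expl.
rewrite exprVn ltr_pdivrMr ?exprn_gt0 //.
apply: lt_le_trans (_ : d%:C%C * n%:R <= _); last first.
  by rewrite ler_wpM2l // (_ : 0 = 0%:C%C) // lecR ltW.
rewrite -(rmorph_nat (@real_complex R)) -rmorphM /= ltcR.
by rewrite mulrC -ltr_pdivrMr.
Qed.

Lemma real_geometric_cvg (v : nat -> R) (k : R) : 0 <= k ->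
  (forall n m, (n <= m)%N -> `|v m - v n| <= k * 2^-1 ^+ n) -> cvgn v.
Proof.
move=> k0 vk; apply/cauchy_cvgP/cauchy_exP => e e0.
have [|| N HN] := @half_pow_small k%:C%C e%:C%C.
- by rewrite (_ : 0 = 0%:C%C) // lecR.
- by rewrite (_ : 0 = 0%:C%C) // ltcR.
exists (v N); exists N => // n /= Nn; apply: (le_lt_trans (_ : _ <= k * 2^-1 ^+ N)).
  by rewrite distrC; apply: vk.
have := HN N (leqnn N).
have -> : (2^-1 : C) = (2^-1)%:C%C by rewrite fmorphV rmorph_nat.
by rewrite -rmorphXn -rmorphM /= ltcR.
Qed.

Lemma normc_ge_Im (x : R[i]) : `|complex.Im x|%:C%C <= `|x|.
Proof.
case: x => a b; rewrite normc_def /= lecR -sqrtr_sqr ler_wsqrtr //.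
by rewrite lerDr sqr_ge0.
Qed.

(** Completeness of C, deduced from that of the reals through real and imaginary parts. *)
Lemma geometric_cvg (u : nat -> C) (K : C) : 0 <= K ->
  (forall n m, (n <= m)%N -> `|u m - u n| <= K * 2^-1 ^+ n) ->
  exists l : C, u @ \oo --> l.
Proof.
move=> /cplx_ge0P[k k0 ->] uk.
have part (P : R[i] -> R) : (forall x, `|P x|%:C%C <= `|x|) -> (forall x y, P (x - y) = P x - P y) ->
    cvgn (P \o u).
  move=> P1 PB; apply: (real_geometric_cvg k0) => n m nm.
  have := le_trans (P1 _) (uk n m nm).
  have -> : (2^-1 : C) = (2^-1)%:C%C by rewrite fmorphV rmorph_nat.
  by rewrite -rmorphXn -rmorphM /= lecR PB.
have cr : cvgn (@complex.Re R \o u) by apply: part => [x|[a b] [c d]//]; exact: normc_ge_Re.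
have ci : cvgn (@complex.Im R \o u) by apply: part => [x|[a b] [c d]//]; exact: normc_ge_Im.
exists ((limn (@complex.Re R \o u)) +i* (limn (@complex.Im R \o u)))%C.
apply/cvgrPdist_lt => _ /cplx_gt0P[e e0 ->].
have e20 : 0 < e / 2 by rewrite divr_gt0.
move/cvgrPdist_lt: cr => /(_ _ e20); move/cvgrPdist_lt: ci => /(_ _ e20).
apply: filterS2 => n /= imn ren.
set l1 := limn _ in ren *; set l2 := limn _ in imn *.
have -> : (l1 +i* l2)%C - u n = (l1 - complex.Re (u n))%:C%C + 'i%C * (l2 - complex.Im (u n))%:C%C.
  by rewrite [LHS]complexE; case: (u n).
apply: le_lt_trans (ler_normD _ _) _; rewrite normrM.
have -> : `|'i%C : C| = 1 by rewrite normc_def /= expr0n add0r expr1n sqrtr1.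
rewrite mul1r.
have nR (x : R) : `|x%:C%C : C| = `|x|%:C%C by rewrite normc_def /= expr0n addr0 sqrtr_sqr.
by rewrite !nR -rmorphD /= ltcR [e]splitr ltrD.
Qed.

End GeometricLimits.

(** * Estimates for rectangular partial sums of double series *)

Section Rectangles.
Variable K : numFieldType.
Implicit Types F G : nat -> nat -> K.

Definition rect m n F := \sum_(i < m) \sum_(j < n) F i j.

Lemma half_geo_rect m n : \sum_(i < m) \sum_(j < n) (2^-1 : K) ^+ (i + j) <= 4.
Proof.
have E : \sum_(i < m) \sum_(j < n) (2^-1 : K) ^+ (i + j) =
    (\sum_(i < m) 2^-1 ^+ i) * (\sum_(j < n) 2^-1 ^+ j).
  rewrite mulr_suml; apply: eq_bigr => i _; rewrite mulr_sumr.
  by apply: eq_bigr => j _; rewrite exprD.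
have S0 k : 0 <= \sum_(i < k) (2^-1 : K) ^+ i.
  by apply: sumr_ge0 => i _; rewrite exprn_ge0 // invr_ge0.
rewrite E (_ : 4 = 2 * 2); last by rewrite -natrM.
by apply: ler_pM => //; apply: sum_geo_half.
Qed.

Lemma rect_half F B m n : 0 <= B ->
  (forall i j, `|F i j| <= B * 2^-1 ^+ (i + j)) -> `|rect m n F| <= 4 * B.
Proof.
move=> B0 FB; rewrite [4 * B]mulrC; apply: le_trans (ler_wpM2l B0 (half_geo_rect m n)).
rewrite mulr_sumr; apply: le_trans (ler_norm_sum _ _ _) (ler_sum _ _) => i _.
by rewrite mulr_sumr; apply: le_trans (ler_norm_sum _ _ _) (ler_sum _ _) => j _.
Qed.

Lemma rectB m n F G : rect m n F - rect m n G = rect m n (fun i j => F i j - G i j).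
Proof.
by rewrite -sumrB; apply: eq_bigr => i _; rewrite -sumrB; apply: eq_bigr => j _.
Qed.

Lemma rect_widen F n m m' : (n <= m)%N -> (n <= m')%N ->
  rect n n F = rect m m' (fun i j => if (i < n)%N && (j < n)%N then F i j else 0).
Proof.
move=> nm nm'; rewrite /rect (big_ord_widen m (fun i => \sum_(j < n) F i j)) // big_mkcond /=.
apply: eq_bigr => i _; case: ifP => i_n; last by rewrite big1.
by rewrite (big_ord_widen m' (F i)) // big_mkcond.
Qed.

(** One half of the decay 4^-k pays for the tail factor 2^-n, the other keeps the series
    summable. *)
Lemma quarter_half n k : (n <= k)%N -> (4^-1 : K) ^+ k <= 2^-1 ^+ n * 2^-1 ^+ k.
Proof.
move=> nk; have -> : (4^-1 : K) = 2^-1 * 2^-1 by rewrite -invfM -natrM.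
rewrite exprMn ler_wpM2r ?exprn_ge0 ?invr_ge0 //.
by rewrite ler_wiXn2l ?invr_ge0 ?invf_le1 ?ler1n.
Qed.

Lemma rect_tail F B n m m' : 0 <= B ->
  (forall i j, `|F i j| <= B * 4^-1 ^+ (i + j)) -> (n <= m)%N -> (n <= m')%N ->
  `|rect m m' F - rect n n F| <= 4 * B * 2^-1 ^+ n.
Proof.
move=> B0 FB nm nm'; rewrite (rect_widen F nm nm') rectB -mulrA.
have h0 : 0 <= (2^-1 : K) ^+ n by rewrite exprn_ge0 // invr_ge0.
apply: rect_half => [|i j]; first by rewrite mulr_ge0.
case: ifP => [_|ij].
  by rewrite subrr normr0 !mulr_ge0 // exprn_ge0 // invr_ge0.
rewrite subr0; apply: le_trans (FB i j) _; rewrite -mulrA ler_wpM2l //.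
by apply: quarter_half; lia.
Qed.

Lemma rect_product F G n :
  \sum_(p < n) \sum_(q < n) \sum_(i < p.+1) \sum_(j < q.+1)
     F i j * G (p - i)%N (q - j)%N =
  \sum_(i < n) \sum_(k < n - i) \sum_(j < n) \sum_(l < n - j) F i j * G k l.
Proof.
transitivity (\sum_(p < n) \sum_(i < p.+1) \sum_(q < n) \sum_(j < q.+1)
     F i j * G (p - i)%N (q - j)%N).
  by apply: eq_bigr => p _; rewrite exchange_big.
rewrite (sum_triangle (fun i k => \sum_(q < n) \sum_(j < q.+1) F i j * G k (q - j)%N)).
apply: eq_bigr => i _; apply: eq_bigr => k _.
exact: (sum_triangle (fun j l => F i j * G k l)).
Qed.

Lemma rectM m n F G : rect m m F * rect n n G =
  \sum_(i < m) \sum_(k < n) \sum_(j < m) \sum_(l < n) F i j * G k l.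
Proof.
rewrite mulr_suml; apply: eq_bigr => i _; rewrite mulr_sumr.
by apply: eq_bigr => k _; rewrite mulr_suml; apply: eq_bigr => j _; rewrite mulr_sumr.
Qed.

Lemma rect_product_le F G n : (forall i j, 0 <= F i j) -> (forall i j, 0 <= G i j) ->
  \sum_(p < n) \sum_(q < n) \sum_(i < p.+1) \sum_(j < q.+1)
     F i j * G (p - i)%N (q - j)%N <= rect n n F * rect n n G.
Proof.
move=> F0 G0; rewrite rect_product rectM; apply: ler_sum => i _.
apply: le_trans (_ : \sum_(k < n - i) \sum_(j < n) \sum_(l < n) F i j * G k l <= _).
  apply: ler_sum => k _; apply: ler_sum => j _.
  apply: (@ler_sum_ord _ (fun l => F i j * G k l)); last exact: leq_subr.
  by move=> l; rewrite mulr_ge0.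
apply: (@ler_sum_ord _ (fun k => \sum_(j < n) \sum_(l < n) F i j * G k l)); last exact: leq_subr.
by move=> k; apply: sumr_ge0 => j _; apply: sumr_ge0 => l _; rewrite mulr_ge0.
Qed.

(** The products missing from the Cauchy product have i + k >= n or j + l >= n, hence total degree
    at least n, where [quarter_half] applies. The factor 16 bounds two double geometric sums by 4
    each. *)
Lemma rect_product_error F G A B n : 0 <= A -> 0 <= B ->
  (forall i j, `|F i j| <= A * 4^-1 ^+ (i + j)) ->
  (forall i j, `|G i j| <= B * 4^-1 ^+ (i + j)) ->
  `|rect n n F * rect n n G -
    \sum_(p < n) \sum_(q < n) \sum_(i < p.+1) \sum_(j < q.+1)
     F i j * G (p - i)%N (q - j)%N| <= 16 * A * B * 2^-1 ^+ n.
Proof.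
move=> A0 B0 FA GB; rewrite rect_product rectM.
have -> : \sum_(i < n) \sum_(k < n - i) \sum_(j < n) \sum_(l < n - j) F i j * G k l =
   \sum_(i < n) \sum_(k < n) \sum_(j < n) \sum_(l < n)
     (if (k < n - i)%N && (l < n - j)%N then F i j * G k l else 0).
  apply: eq_bigr => i _.
  rewrite (big_ord_widen n (fun k => \sum_(j < n) \sum_(l < n - j) F i j * G k l)) ?leq_subr //.
  rewrite big_mkcond /=; apply: eq_bigr => k _; case: ifP => ki; last first.
    by rewrite big1 // => j _; rewrite big1.
  apply: eq_bigr => j _.
  by rewrite (big_ord_widen n (fun l => F i j * G k l)) ?leq_subr // big_mkcond.
have H (k : nat) : 0 <= (2^-1 : K) ^+ k by rewrite exprn_ge0 // invr_ge0.
have T (i j k l : 'I_n) :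
    `|F i j * G k l - (if (k < n - i)%N && (l < n - j)%N then F i j * G k l else 0)|
    <= A * B * 2^-1 ^+ n * (2^-1 ^+ (i + j) * 2^-1 ^+ (k + l)).
  case: ifP => [_|kl]; first by rewrite subrr normr0 !mulr_ge0.
  rewrite subr0 normrM; apply: le_trans (ler_pM _ _ (FA i j) (GB k l)) _ => //.
  rewrite mulrACA -[leRHS]mulrA; apply: ler_wpM2l; first exact: mulr_ge0.
  by rewrite -[leLHS]exprD -[X in _ <= _ * X]exprD; apply: quarter_half; lia.
have -> : 16 * A * B * 2^-1 ^+ n = A * B * 2^-1 ^+ n * (4 * 4) by ring.
apply: le_trans (_ : _ <= A * B * 2^-1 ^+ n *
   (rect n n (fun i j => 2^-1 ^+ (i + j)) * rect n n (fun k l => 2^-1 ^+ (k + l)))) _.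
  rewrite rectM mulr_sumr -sumrB; apply: le_trans (ler_norm_sum _ _ _) (ler_sum _ _) => i _.
  rewrite mulr_sumr -sumrB; apply: le_trans (ler_norm_sum _ _ _) (ler_sum _ _) => k _.
  rewrite mulr_sumr -sumrB; apply: le_trans (ler_norm_sum _ _ _) (ler_sum _ _) => j _.
  rewrite mulr_sumr -sumrB; apply: le_trans (ler_norm_sum _ _ _) (ler_sum _ _) => l _.
  exact: T.
apply: ler_wpM2l; first by rewrite !mulr_ge0.
have R0 : 0 <= rect n n (fun i j => (2^-1 : K) ^+ (i + j)).
  by apply: sumr_ge0 => i _; apply: sumr_ge0.
by apply: ler_pM => //; apply: half_geo_rect.
Qed.

(** The remainders satisfy E_(i+1) = (x + h) E_i + i h^2 x^(i-1). Each of the two summands is at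
    most 2 s times the bound for i, and together they give the new factor 4 s. *)
Lemma taylor_remainder_bound (x h s : K) i : 0 < s -> `|x| <= s -> `|h| <= s ->
  `|(x + h) ^+ i - x ^+ i - i%:R * h * x ^+ i.-1| <= `|h| ^+ 2 / s ^+ 2 * (4 * s) ^+ i.
Proof.
move=> s0 xs hs; have s4 : 0 < 4 * s by rewrite mulr_gt0.
elim: i => [|i IH].
  by rewrite !expr0 subrr mul0r mul0r subr0 normr0 mulr1 divr_ge0 ?exprn_ge0 // ltW.
have -> : (x + h) ^+ i.+1 - x ^+ i.+1 - i.+1%:R * h * x ^+ i.+1.-1 =
    (x + h) * ((x + h) ^+ i - x ^+ i - i%:R * h * x ^+ i.-1) + i%:R * h ^+ 2 * x ^+ i.-1.
  case: i {IH} => [|i]; first by rewrite !expr1 !expr0; ring.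
  by rewrite /= !exprS [i.+2%:R]mulrS; ring.
apply: le_trans (ler_normD _ _) _.
have xh : `|x + h| <= 2 * s.
  by apply: le_trans (ler_normD _ _) _; rewrite mulr_natl mulr2n lerD.
have A : `|(x + h) * ((x + h) ^+ i - x ^+ i - i%:R * h * x ^+ i.-1)| <=
    2 * s * (`|h| ^+ 2 / s ^+ 2 * (4 * s) ^+ i) by rewrite normrM ler_pM.
have B : `|i%:R * h ^+ 2 * x ^+ i.-1| <= 2 * s * (`|h| ^+ 2 / s ^+ 2 * (4 * s) ^+ i).
  case: i {IH A} => [|i].
    rewrite mul0r mul0r normr0; apply: mulr_ge0; first by rewrite mulr_ge0 // ltW.
    by rewrite mulr_ge0 ?divr_ge0 ?exprn_ge0 // ltW.
  rewrite !normrM normr_nat !normrX /=.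
  have -> : 2 * s * (`|h| ^+ 2 / s ^+ 2 * (4 * s) ^+ i.+1) =
     8 * 4 ^+ i * `|h| ^+ 2 * s ^+ i.
    by rewrite exprMn !exprS; field; rewrite gt_eqF.
  apply: ler_pM; rewrite ?mulr_ge0 ?exprn_ge0 //.
    apply: ler_pM; rewrite ?exprn_ge0 //.
    have : i.+1%:R <= 4 ^+ i :> K by rewrite -natrX ler_nat; apply: ltn_expl.
    move/le_trans; apply; rewrite ler_peMl ?exprn_ge0 // ler1n //.
  by rewrite lerXn2r ?nnegrE // ltW.
apply: le_trans (lerD A B) _; rewrite [(4 * s) ^+ i.+1]exprS.
by rewrite le_eqVlt; apply/orP; left; apply/eqP; ring.
Qed.

End Rectangles.

Section PartialSums.
Variable R : realType.
Local Notation C := (Cplx R).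

Definition term (a : germ C) (z : C * C) (i j : nat) : C :=
  a i j * z.1 ^+ i * z.2 ^+ j.

Definition psum (a : germ C) (z : C * C) (n : nat) : C := rect n n (term a z).

End PartialSums.

HB.lock Definition ev (R : realType) (a : germ (Cplx R)) (z : Cplx R * Cplx R) :
  Cplx R := lim (psum a z @ \oo).

(** * The sum of a germ near the origin *)

Section Evaluation.
Variable R : realType.
Local Notation C := (Cplx R).
Local Notation germ := (germ C).
Implicit Types (a b : germ) (r s : C) (z : C * C).

Lemma lim_norm_le (u : nat -> C) (l x B : C) : u @ \oo --> l ->
  (forall n, `|u n - x| <= B) -> `|l - x| <= B.
Proof.
move=> ul uB; apply/ler_addgt0Pr => e e0.
move/cvgrPdist_lt: ul => /(_ _ e0)[N _ /(_ N (leqnn N)) lN].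
have -> : l - x = (u N - x) + (l - u N) by ring.
by apply: le_trans (ler_normD _ _) (lerD (uB N) (ltW lN)).
Qed.

Lemma geometric_cvg0 (u : nat -> C) (K : C) : 0 <= K ->
  (forall n, `|u n| <= K * 2^-1 ^+ n) -> u @ \oo --> (0 : C).
Proof.
move=> K0 uK; apply/cvgrPdist_lt => e e0.
have [N HN] := half_pow_small K0 e0; exists N => // n /= Nn.
by rewrite sub0r normrN; apply: le_lt_trans (uK n) (HN n Nn).
Qed.

Lemma cvgn_unique (u : nat -> C) (l l' : C) : u @ \oo --> l -> u @ \oo --> l' -> l = l'.
Proof. by move=> ul ul'; apply: (cvg_unique (@norm_hausdorff _ C) ul ul'). Qed.

Lemma cvgn_ext (u v : nat -> C) (l : C) :
  u @ \oo --> l -> (forall n, u n = v n) -> v @ \oo --> l.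
Proof. by move=> ul uv; rewrite -(_ : u = v) //; apply: funext. Qed.

Lemma below2 r s : 0 < r -> 0 < s -> exists t : C, [/\ 0 < t, t <= r & t <= s].
Proof.
move=> r0 s0; have rs : 0 < r + s by rewrite addr_gt0.
(* The order of C is only partial; this quotient stands in for a minimum of r and s. *)
exists (r * s / (r + s)); split.
- by rewrite divr_gt0 ?mulr_gt0.
- by rewrite ler_pdivrMr // ler_pM2l // lerDr ltW.
- by rewrite ler_pdivrMr // [r * s]mulrC ler_pM2l // lerDl ltW.
Qed.

(** Absolute convergence at (r, r), through bounded square sums. For a fixed r > 0 it is stable
    under the ring operations. *)
Definition disc r a := exists2 B : C, 0 <= B &
  forall n, rect n n (fun i j => `|a i j| * r ^+ (i + j)) <= B.

Lemma disc_coef r (a : nat -> nat -> C) B : 0 < r ->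
  (forall n, rect n n (fun i j => `|a i j| * r ^+ (i + j)) <= B) ->
  forall i j, `|a i j| <= B * r^-1 ^+ (i + j).
Proof.
move=> r0 aB i j; rewrite exprVn ler_pdivlMr ?exprn_gt0 //.
apply: le_trans (aB (i + j).+1).
have T k l : 0 <= `|a k l| * r ^+ (k + l) by rewrite mulr_ge0 // exprn_ge0 // ltW.
have li : (i < (i + j).+1)%N by rewrite ltnS leq_addr.
have lj : (j < (i + j).+1)%N by rewrite ltnS leq_addl.
rewrite /rect (bigD1 (Ordinal li)) //= (bigD1 (Ordinal lj)) //= -addrA lerDl.
by rewrite addr_ge0 ?sumr_ge0 // => k _; rewrite sumr_ge0.
Qed.

Lemma disc_le r s a : 0 <= s -> s <= r -> disc r a -> disc s a.
Proof.
move=> s0 sr [B B0 aB]; exists B => // n; apply: le_trans (aB n).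
apply: ler_sum => i _; apply: ler_sum => j _; apply: ler_wpM2l => //.
by rewrite lerXn2r ?nnegrE // (le_trans s0).
Qed.

Lemma disc_geometric a (M t : C) : 0 < M -> 0 < t ->
  (forall i j, `|a i j| <= M * t ^+ (i + j)) -> disc (2 * t)^-1 a.
Proof.
move=> M0 t0 aM; have t2 : 0 < (2 * t)^-1 by rewrite invr_gt0 mulr_gt0.
exists (4 * M) => [|n]; first by rewrite mulr_ge0 // ltW.
have S0 : 0 <= rect n n (fun i j => `|a i j| * (2 * t)^-1 ^+ (i + j)).
  by apply: sumr_ge0 => i _; apply: sumr_ge0 => j _; rewrite mulr_ge0 // exprn_ge0 // ltW.
rewrite -[leLHS]ger0_norm //; apply: rect_half => [|i j]; first exact: ltW.
rewrite ger0_norm; last by rewrite mulr_ge0 // exprn_ge0 // ltW.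
apply: le_trans (ler_wpM2r (exprn_ge0 _ (ltW t2)) (aM i j)) _.
rewrite -mulrA -exprMn; suff -> : t * (2 * t)^-1 = 2^-1 :> C by [].
by field; rewrite gt_eqF.
Qed.

Lemma disc_exists a : exists2 r, 0 < r & disc r a.
Proof.
have [M [t [M0 t0 aM]]] := germ_conv a; exists (2 * t)^-1; last exact: disc_geometric aM.
by rewrite invr_gt0 mulr_gt0.
Qed.

Lemma disc_exists2 a b : exists r, [/\ 0 < r, disc r a & disc r b].
Proof.
have [r r0 ra] := disc_exists a; have [s s0 sb] := disc_exists b.
have [t [t0 tr ts]] := below2 r0 s0.
exists t; split; first exact: t0.
  exact: disc_le (ltW t0) tr ra.
exact: disc_le (ltW t0) ts sb.
Qed.

Lemma discD r a b : 0 < r -> disc r a -> disc r b -> disc r (a + b).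
Proof.
move=> r0 [A A0 aA] [B B0 bB]; exists (A + B) => [|n]; first exact: addr_ge0.
apply: le_trans (lerD (aA n) (bB n)); rewrite /rect -big_split; apply: ler_sum => i _ /=.
rewrite -big_split; apply: ler_sum => j _ /=.
by rewrite -mulrDl ler_wpM2r ?exprn_ge0 ?(ltW r0) //; apply: ler_normD.
Qed.

Lemma discM_bound r a b A B : 0 < r ->
  (forall n, rect n n (fun i j => `|a i j| * r ^+ (i + j)) <= A) ->
  (forall n, rect n n (fun i j => `|b i j| * r ^+ (i + j)) <= B) ->
  (forall n, rect n n (fun i j => `|(a * b) i j| * r ^+ (i + j)) <= A * B).
Proof.
move=> r0 aA bB n.
have P (u : germ) i j : 0 <= `|u i j| * r ^+ (i + j) by rewrite mulr_ge0 // exprn_ge0 // ltW.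
have S0 u : 0 <= rect n n (fun i j => `|(u : germ) i j| * r ^+ (i + j)).
  by apply: sumr_ge0 => i _; apply: sumr_ge0.
apply: le_trans (ler_pM (S0 a) (S0 b) (aA n) (bB n)).
apply: le_trans (rect_product_le n (P a) (P b)).
apply: ler_sum => p _; apply: ler_sum => q _; rewrite germM.
apply: le_trans (ler_wpM2r (exprn_ge0 _ (ltW r0)) (ler_norm_sum _ _ _)) _.
rewrite mulr_suml; apply: ler_sum => i _.
apply: le_trans (ler_wpM2r (exprn_ge0 _ (ltW r0)) (ler_norm_sum _ _ _)) _.
rewrite mulr_suml; apply: ler_sum => j _.
have -> : (p + q = (i + j) + (p - i + (q - j)))%N.
  by have := ltn_ord i; have := ltn_ord j; lia.
by rewrite normrM [in leLHS]exprD mulrACA.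
Qed.

Lemma discM r a b : 0 < r -> disc r a -> disc r b -> disc r (a * b).
Proof.
move=> r0 [A A0 aA] [B B0 bB]; exists (A * B); first exact: mulr_ge0.
exact: discM_bound.
Qed.

Lemma disc_gC_bound r c n :
  rect n n (fun i j => `|(gC c : germ) i j| * r ^+ (i + j)) <= `|c|.
Proof.
case: n => [|n]; first by rewrite /rect big_ord0.
rewrite /rect big_ord_recl big_ord_recl /= mulr1 !big1 ?addr0 //.
  by move=> i _; rewrite big1 // => j _; rewrite normr0 mul0r.
by move=> j _; rewrite normr0 mul0r.
Qed.

Lemma disc_gC r c : disc r (gC c).
Proof. by exists `|c| => // n; apply: disc_gC_bound. Qed.

Lemma disc_sum r n (F : 'I_n -> germ) : 0 < r -> (forall i, disc r (F i)) ->
  disc r (\sum_(i < n) F i).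
Proof.
move=> r0 rF; elim/big_ind: _ => [|a b|i _]; [|exact: discD|exact: rF].
by rewrite -(rmorph0 (@gC C)); apply: disc_gC.
Qed.

Lemma disc_exp_bound r a B n : 0 < r ->
  (forall n, rect n n (fun i j => `|a i j| * r ^+ (i + j)) <= B) ->
  (forall k, rect k k (fun i j => `|(a ^+ n) i j| * r ^+ (i + j)) <= B ^+ n).
Proof.
move=> r0 aB; elim: n => [|n IH].
  move=> k; rewrite !expr0 -(rmorph1 (@gC C)).
  by apply: le_trans (disc_gC_bound _ _ _) _; rewrite normr1.
by rewrite !exprS; apply: discM_bound.
Qed.

Lemma disc_exp r a n : 0 < r -> disc r a -> disc r (a ^+ n).
Proof.
move=> r0 [B B0 aB]; exists (B ^+ n); first exact: exprn_ge0.
exact: disc_exp_bound.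
Qed.

(** At radius r / 4 the terms decay like 4^-(i+j), the rate which [quarter_half] splits. *)
Definition pdisc r z := `|z.1| <= r / 4 /\ `|z.2| <= r / 4.

Lemma term_bound r a B z : 0 < r -> pdisc r z ->
  (forall n, rect n n (fun i j => `|a i j| * r ^+ (i + j)) <= B) ->
  forall i j, `|term a z i j| <= B * 4^-1 ^+ (i + j).
Proof.
move=> r0 [z1 z2] aB i j; have r4 : 0 <= r / 4 by rewrite divr_ge0 // ltW.
rewrite /term -mulrA normrM.
have -> : B * 4^-1 ^+ (i + j) = B * r^-1 ^+ (i + j) * (r / 4) ^+ (i + j).
  by rewrite -mulrA -exprMn mulrA mulVf ?mul1r // gt_eqF.
apply: ler_pM => //; first exact: disc_coef aB _ _.
by rewrite normrM !normrX exprD; apply: ler_pM; rewrite ?exprn_ge0 // lerXn2r ?nnegrE.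
Qed.

Lemma term_bound_exists r a z : 0 < r -> disc r a -> pdisc r z ->
  exists2 B : C, 0 <= B & forall i j, `|term a z i j| <= B * 4^-1 ^+ (i + j).
Proof. by move=> r0 [B B0 aB] zr; exists B => //; apply: term_bound aB. Qed.

Lemma ev_cvg r a z : 0 < r -> disc r a -> pdisc r z -> psum a z @ \oo --> ev a z.
Proof.
move=> r0 ra zr; have [B B0 tB] := term_bound_exists r0 ra zr.
have [|n m nm|l ul] := @geometric_cvg R (psum a z) (4 * B).
- exact: mulr_ge0.
- exact: rect_tail.
by rewrite (_ : ev a z = l) // ev.unlock; apply: norm_cvg_lim.
Qed.

Lemma ev_unique a z l : psum a z @ \oo --> l -> ev a z = l.
Proof. by move=> ul; rewrite ev.unlock; apply: norm_cvg_lim. Qed.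

Lemma ev_bound r a z B n : 0 < r -> disc r a -> pdisc r z -> 0 <= B ->
  (forall i j, `|term a z i j| <= B * 4^-1 ^+ (i + j)) ->
  (forall i j, (i + j < n)%N -> a i j = 0) -> `|ev a z| <= 4 * B * 2^-1 ^+ n.
Proof.
move=> r0 ra zr B0 tB a0; have h0 k : 0 <= (2^-1 : C) ^+ k by rewrite exprn_ge0 // invr_ge0.
rewrite -[ev a z]subr0; apply: (lim_norm_le (ev_cvg r0 ra zr)) => m.
rewrite subr0 -mulrA; apply: rect_half => [|i j]; first by rewrite mulr_ge0.
have [ij|ij] := ltnP (i + j) n.
  by rewrite /term a0 // !mul0r normr0 !mulr_ge0.
apply: le_trans (tB i j) _; rewrite -mulrA; apply: ler_wpM2l => //.
exact: quarter_half.
Qed.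

(** Differentiation shifts the first index: the n x n partial sums of [d1 a] arise from the (n+1) x
    n ones of [a]. *)
Lemma ev_rect_cvg r a z : 0 < r -> disc r a -> pdisc r z ->
  (fun n => rect n.+1 n (term a z)) @ \oo --> ev a z.
Proof.
move=> r0 ra zr; have [B B0 tB] := term_bound_exists r0 ra zr.
have H : (fun n => rect n.+1 n (term a z) - rect n n (term a z)) @ \oo --> (0 : C).
  by apply: (@geometric_cvg0 _ (4 * B)) => [|n]; [exact: mulr_ge0 | exact: rect_tail].
rewrite -[ev a z]add0r; apply: (cvgn_ext (cvgD H (ev_cvg r0 ra zr))) => n.
by rewrite !fctE /psum subrK.
Qed.

Lemma evD r a b z : 0 < r -> disc r a -> disc r b -> pdisc r z ->
  ev (a + b) z = ev a z + ev b z.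
Proof.
move=> r0 ra rb zr; apply: ev_unique.
apply: (cvgn_ext (cvgD (ev_cvg r0 ra zr) (ev_cvg r0 rb zr))) => n; rewrite !fctE /psum /rect -big_split /=.
apply: eq_bigr => i _; rewrite -big_split /=; apply: eq_bigr => j _.
by rewrite /term germD; ring.
Qed.

Lemma evM r a b z : 0 < r -> disc r a -> disc r b -> pdisc r z ->
  ev (a * b) z = ev a z * ev b z.
Proof.
move=> r0 ra rb zr; apply: ev_unique.
have [A A0 tA] := term_bound_exists r0 ra zr.
have [B B0 tB] := term_bound_exists r0 rb zr.
have H : (fun n => psum a z n * psum b z n - psum (a * b) z n) @ \oo --> (0 : C).
  apply: (@geometric_cvg0 _ (16 * A * B)) => [|n]; first by rewrite !mulr_ge0.
  have -> : psum (a * b) z n = \sum_(p < n) \sum_(q < n) \sum_(i < p.+1) \sum_(j < q.+1)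
     term a z i j * term b z (p - i)%N (q - j)%N.
    apply: eq_bigr => p _; apply: eq_bigr => q _; rewrite /term germM !mulr_suml.
    apply: eq_bigr => i _; rewrite !mulr_suml; apply: eq_bigr => j _.
    have -> : z.1 ^+ p = z.1 ^+ i * z.1 ^+ (p - i) by rewrite -exprD subnKC // -ltnS.
    have -> : z.2 ^+ q = z.2 ^+ j * z.2 ^+ (q - j) by rewrite -exprD subnKC // -ltnS.
    by ring.
  exact: rect_product_error.
rewrite -[ev a z * _]subr0.
apply: (cvgn_ext (cvgB (cvgM (ev_cvg r0 ra zr) (ev_cvg r0 rb zr)) H)) => n.
by rewrite !fctE /= subKr.
Qed.

Lemma ev_gC c z : ev (gC c) z = c.
Proof.
apply: ev_unique; apply/cvgrPdist_lt => e e0; exists 1%N => // -[//|n] _ /=.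
rewrite /psum /rect big_ord_recl big_ord_recl !big1 ?addr0.
- by rewrite /term gC_coef !expr0 !mulr1 subrr normr0.
- by move=> i _; rewrite big1 // => j _; rewrite /term gC_coef !mul0r.
- by move=> j _; rewrite /term gC_coef !mul0r.
Qed.

Lemma ev0 z : ev 0 z = 0. Proof. by rewrite -(rmorph0 (@gC C)) ev_gC. Qed.
Lemma ev1 z : ev 1 z = 1. Proof. by rewrite -(rmorph1 (@gC C)) ev_gC. Qed.

Lemma ev_gX z : ev (gX C) z = z.1.
Proof.
apply: ev_unique; apply/cvgrPdist_lt => e e0; exists 2%N => // -[//|[//|n]] _ /=.
rewrite /psum /rect big_ord_recl big_ord_recl big1 ?add0r; last first.
  by move=> j _; rewrite /term gX_coef !mul0r.
rewrite big_ord_recl !big1 ?addr0.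
- by rewrite /term gX_coef /= expr1 expr0 mul1r mulr1 subrr normr0.
- by move=> i _; rewrite big1 // => j _; rewrite /term gX_coef !mul0r.
- by move=> j _; rewrite /term gX_coef /= !mul0r.
Qed.

Lemma ev_swap a z : ev (swap a) z = ev a (z.2, z.1).
Proof.
rewrite ev.unlock; congr (lim (_ @ \oo)); apply: funext => n.
rewrite /psum /rect exchange_big /=; apply: eq_bigr => i _; apply: eq_bigr => j _.
by rewrite /term swap_coef /=; ring.
Qed.

Lemma ev_gY z : ev (gY C) z = z.2.
Proof.
have -> : gY C = swap (gX C) by apply: germP => i j; rewrite swap_coef gX_coef andbC.
by rewrite ev_swap ev_gX.
Qed.

Lemma ev_restr a z : ev (restr a) z = ev a (z.1, 0).
Proof.
rewrite ev.unlock; congr (lim (_ @ \oo)); apply: funext => n.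
apply: eq_bigr => i _; apply: eq_bigr => -[[|j] jn] _; rewrite /term /=.
  by rewrite !expr0.
by rewrite expr0n /= mulr0 !mul0r.
Qed.

Lemma ev_at0 a : ev a 0 = a 0%N 0%N.
Proof.
apply: ev_unique; apply/cvgrPdist_lt => e e0; exists 1%N => // -[//|n] _ /=.
rewrite /psum /rect big_ord_recl big_ord_recl !big1 ?addr0.
- by rewrite /term !expr0 !mulr1 subrr normr0.
- by move=> i _; rewrite big1 // => j _; rewrite /term /= exprS mul0r mulr0 mul0r.
- by move=> j _; rewrite /term /= exprS mul0r mulr0.
Qed.

(** [taylor_remainder_bound] is applied term by term. The choice s = r / 8 keeps x + h within r / 4
    and makes 4 s / r equal to 1/2, so that the bounds are summable. *)
Lemma ev_difference_quotient a : exists (K s : C), [/\ 0 <= K, 0 < s &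
  forall x y h : C, `|x| <= s -> `|y| <= s -> `|h| <= s ->
    `|ev a (x + h, y) - ev a (x, y) - h * ev (d1 a) (x, y)| <= K * `|h| ^+ 2].
Proof.
have [r [r0 ra rd]] := disc_exists2 a (d1 a).
have [B B0 aB] := ra; pose s : C := r / 8.
have s0 : 0 < s by rewrite divr_gt0.
have sr : s + s = r / 4 by rewrite /s; field.
have s_le : s <= r / 4 by rewrite -sr lerDl ltW.
exists (4 * B / s ^+ 2), s; split => //.
  by rewrite divr_ge0 ?exprn_ge0 ?mulr_ge0 // ltW.
move=> x y h xs ys hs.
have zxy : pdisc r (x, y) by split => /=; apply: le_trans s_le.
have zh : pdisc r (x + h, y).
  split => /=; last exact: le_trans s_le.
  by rewrite -sr; apply: le_trans (ler_normD _ _) (lerD xs hs).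
rewrite -[X in `|X|]subr0.
have H := cvgB (cvgB (ev_rect_cvg r0 ra zh) (ev_rect_cvg r0 ra zxy))
  (cvgM (@cvg_cst C h _ \oo _) (ev_cvg r0 rd zxy)).
apply: (lim_norm_le (H _ _ _ _)) => n; rewrite subr0 !fctE /=.
have E : rect n.+1 n (term a (x + h, y)) - rect n.+1 n (term a (x, y)) -
    h * psum (d1 a) (x, y) n = rect n.+1 n (fun i j => a i j *
      ((x + h) ^+ i - x ^+ i - i%:R * h * x ^+ i.-1) * y ^+ j).
  have -> : h * psum (d1 a) (x, y) n =
      rect n.+1 n (fun i j => a i j * (i%:R * h * x ^+ i.-1) * y ^+ j).
    rewrite /rect big_ord_recl [X in _ = X + _]big1 ?add0r => [|j _]; last first.
      by rewrite !mul0r mulr0 mul0r.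
    rewrite mulr_sumr; apply: eq_bigr => i _; rewrite mulr_sumr; apply: eq_bigr => j _.
    by rewrite /term d1_coef lift0 -[_ *+ _]mulr_natr /=; ring.
  by rewrite !rectB; apply: eq_bigr => i _; apply: eq_bigr => j _; rewrite /term /=; ring.
rewrite E.
have -> : 4 * B / s ^+ 2 * `|h| ^+ 2 = 4 * (B * (`|h| ^+ 2 / s ^+ 2)) by ring.
have hs0 : 0 <= `|h| ^+ 2 / s ^+ 2 by rewrite divr_ge0 ?exprn_ge0 // ltW.
apply: rect_half => [|i j]; first by rewrite mulr_ge0.
rewrite !normrM normrX.
have A := disc_coef r0 aB i j.
have T := taylor_remainder_bound i s0 xs hs.
have Y : `|y| ^+ j <= (4 * s) ^+ j.
  have s4 : 0 <= 4 * s by rewrite mulr_ge0 // ltW.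
  have y4 : `|y| <= 4 * s.
    by apply: le_trans ys _; rewrite ler_peMl ?(ltW s0) // ler1n.
  by rewrite lerXn2r ?nnegrE.
apply: le_trans (ler_pM _ _ (ler_pM _ _ A T) Y) _; rewrite ?mulr_ge0 ?exprn_ge0 //.
have -> : B * r^-1 ^+ (i + j) * (`|h| ^+ 2 / s ^+ 2 * (4 * s) ^+ i) * (4 * s) ^+ j =
  B * (`|h| ^+ 2 / s ^+ 2) * (r^-1 * (4 * s)) ^+ (i + j).
  by move: (4 * s) => w; rewrite [(r^-1 * w) ^+ _]exprMn [w ^+ (i + j)]exprD; ring.
suff -> : r^-1 * (4 * s) = 2^-1 by [].
by rewrite /s; field; rewrite gt_eqF.
Qed.

End Evaluation.

(** * Passage between germs and functions *)

Section Dictionary.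
Variable R : realType.
Local Notation C := (Cplx R).
Local Notation germ := (germ C).
Implicit Types (a b c : germ) (r s : C) (z w : C * C) (f g : C * C -> C).

Lemma near0P (P : C * C -> Prop) : (\forall z \near (0 : C * C), P z) <->
  exists2 r : C, 0 < r & forall z, `|z.1| <= r -> `|z.2| <= r -> P z.
Proof.
split=> [/nbhs_normP[r /= r0 H]|[r r0 H]].
  have r2 : r / 2 < r by rewrite ltr_pdivrMr // ltr_pMr // ltr1n.
  exists (r / 2) => [|z z1 z2]; first by rewrite divr_gt0.
  apply: H; rewrite /ball_ /= sub0r normrN prod_normE /Order.max.
  by case: ifP => _; apply: le_lt_trans r2.
apply/nbhs_normP; exists r => // z; rewrite /ball_ /= sub0r normrN prod_normE /Order.max.
case: ifP => [z12 z2|/negbT z12 z1]; apply: H; rewrite ltW //.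
  exact: lt_trans z2.
by apply: le_lt_trans z1; rewrite real_leNgt ?normr_real.
Qed.

Lemma near0S2 (P Q S : C * C -> Prop) : (forall z, P z -> Q z -> S z) ->
  (\forall z \near (0 : C * C), P z) -> (\forall z \near (0 : C * C), Q z) ->
  \forall z \near (0 : C * C), S z.
Proof. exact: (@filterS2 _ (nbhs (0 : C * C)) _ P Q S). Qed.

Lemma near0W (P : C * C -> Prop) : (forall z, P z) -> \forall z \near (0 : C * C), P z.
Proof. by move=> H; apply/near0P; exists 1. Qed.

Lemma near_pdisc r : 0 < r -> \forall z \near (0 : C * C), pdisc r z.
Proof. by move=> r0; apply/near0P; exists (r / 4); rewrite ?divr_gt0 // => z. Qed.

Lemma evD_near a b : \forall z \near (0 : C * C), ev (a + b) z = ev a z + ev b z.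
Proof.
have [r [r0 ra rb]] := disc_exists2 a b.
by apply: filterS (near_pdisc r0) => z; apply: evD.
Qed.

Lemma evM_near a b : \forall z \near (0 : C * C), ev (a * b) z = ev a z * ev b z.
Proof.
have [r [r0 ra rb]] := disc_exists2 a b.
by apply: filterS (near_pdisc r0) => z; apply: evM.
Qed.

Lemma evN_near a : \forall z \near (0 : C * C), ev (- a) z = - ev a z.
Proof.
apply: filterS (evM_near (gC (-1)) a) => z.
by rewrite ev_gC mulN1r rmorphN rmorph1 mulN1r.
Qed.

Lemma evB_near a b : \forall z \near (0 : C * C), ev (a - b) z = ev a z - ev b z.
Proof. by apply: near0S2 (evD_near a (- b)) (evN_near b) => z -> ->. Qed.

Lemma evX_near a n : \forall z \near (0 : C * C), ev (a ^+ n) z = ev a z ^+ n.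
Proof.
elim: n => [|n IH]; first by apply: near0W => z; rewrite !expr0 ev1.
by apply: near0S2 IH (evM_near a (a ^+ n)) => z IH; rewrite !exprS => ->; rewrite IH.
Qed.

Lemma quotient_cvg (g : C -> C) (l K s : C) : 0 <= K -> 0 < s ->
  (forall h, `|h| <= s -> `|g h - h * l| <= K * `|h| ^+ 2) ->
  h^-1 *: g h @[h --> (0 : C)^'] --> l.
Proof.
move=> K0 s0 gl; apply/cvgrPdist_le => e e0.
have K1 : 0 < K + 1 by rewrite ltr_wpDl.
have eK : 0 < e / (K + 1) by rewrite divr_gt0.
near=> h.
have h0 : h != 0 by near: h; apply: nbhs_dnbhs_neq.
have hs : `|h| <= s by near: h; apply: dnbhs0_le.
have he : `|h| <= e / (K + 1) by near: h; apply: dnbhs0_le.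
have nh : 0 < `|h| by rewrite normr_gt0.
have -> : l - h^-1 *: g h = - (h^-1 * (g h - h * l)).
  by rewrite mulrBr mulKf // opprB.
rewrite normrN normrM normfV.
apply: le_trans (ler_wpM2l _ (gl h hs)) _; first by rewrite invr_ge0.
rewrite mulrCA expr2 mulKf ?gt_eqF //.
apply: le_trans (ler_wpM2l K0 he) _.
by rewrite mulrCA ler_piMr ?(ltW e0) // ler_pdivrMr // mul1r lerDl.
Unshelve. all: by end_near. Qed.

Lemma quotient_lim (g : C -> C) (l K s : C) : 0 <= K -> 0 < s ->
  (forall h, `|h| <= s -> `|g h - h * l| <= K * `|h| ^+ 2) ->
  lim (h^-1 *: g h @[h --> (0 : C)^']) = l.
Proof. by move=> K0 s0 gl; apply: norm_cvg_lim; apply: quotient_cvg gl. Qed.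

Lemma dxE f (x y : C) :
  dx f (x, y) = lim (h^-1 *: (f (x + h, y) - f (x, y)) @[h --> (0 : C)^']).
Proof.
congr (lim (_ @ (0 : C)^')); apply: funext => h; congr (_ *: (f _ - _)).
by congr pair => /=; [rewrite addrC; congr (_ + _); apply: mulr1
  | rewrite -[RHS]add0r; congr (_ + _); apply: mulr0].
Qed.

Lemma dyE f (x y : C) :
  dy f (x, y) = lim (h^-1 *: (f (x, y + h) - f (x, y)) @[h --> (0 : C)^']).
Proof.
congr (lim (_ @ (0 : C)^')); apply: funext => h; congr (_ *: (f _ - _)).
by congr pair => /=; [rewrite -[RHS]add0r; congr (_ + _); apply: mulr0
  | rewrite addrC; congr (_ + _); apply: mulr1].
Qed.

Lemma dx_ev a : \forall z \near (0 : C * C), dx (ev a) z = ev (d1 a) z.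
Proof.
have [K [s [K0 s0 H]]] := ev_difference_quotient a.
apply/near0P; exists s => // -[x y] /= xs ys; rewrite dxE.
by apply: (quotient_lim K0 s0) => h hs; apply: H.
Qed.

Lemma dy_ev a : \forall z \near (0 : C * C), dy (ev a) z = ev (d2 a) z.
Proof.
have [K [s [K0 s0 H]]] := ev_difference_quotient (swap a).
apply/near0P; exists s => // -[x y] /= xs ys; rewrite dyE.
rewrite /d2 ev_swap /=; apply: (quotient_lim K0 s0) => h hs.
by have := H y x h ys xs hs; rewrite !ev_swap.
Qed.

Lemma eq_germ_dx f g : eq_germ (0 : C * C) f g -> eq_germ (0 : C * C) (dx f) (dx g).
Proof.
by move=> fg; apply: filterS (nbhs_interior fg) => z; apply: near_eq_derive.
Qed.

Lemma eq_germ_dy f g : eq_germ (0 : C * C) f g -> eq_germ (0 : C * C) (dy f) (dy g).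
Proof.
by move=> fg; apply: filterS (nbhs_interior fg) => z; apply: near_eq_derive.
Qed.

Lemma dx_germ f a : eq_germ (0 : C * C) f (ev a) -> eq_germ (0 : C * C) (dx f) (ev (d1 a)).
Proof. by move=> /eq_germ_dx fa; apply: near0S2 fa (dx_ev a) => z -> ->. Qed.

Lemma dy_germ f a : eq_germ (0 : C * C) f (ev a) -> eq_germ (0 : C * C) (dy f) (ev (d2 a)).
Proof. by move=> /eq_germ_dy fa; apply: near0S2 fa (dy_ev a) => z -> ->. Qed.

(** Up to nonzero integer factors the coefficients are iterated partial derivatives at 0, and those
    of the zero function vanish. *)
Lemma ev_eq0 a : eq_germ (0 : C * C) (ev a) (fun=> 0) -> a = 0.
Proof.
move=> a0; apply: germP => i j; rewrite germ0.
elim: i j a a0 => [|i IH] j a a0.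
  elim: j a a0 => [|j IH] a a0.
    by rewrite -ev_at0; have := nbhs_singleton a0.
  have : d2 a 0%N j = 0.
    apply: IH; have := eq_germ_dy a0.
    apply: near0S2 (dy_ev a) => z -> ->.
    by rewrite /dy derive_cst.
  by rewrite d2_coef => /eqP; rewrite mulrn_eq0 /= => /eqP.
have : d1 a i j = 0.
  apply: IH; have := eq_germ_dx a0.
  apply: near0S2 (dx_ev a) => z -> ->.
  by rewrite /dx derive_cst.
by rewrite d1_coef => /eqP; rewrite mulrn_eq0 /= => /eqP.
Qed.

Lemma ev_inj a b : eq_germ (0 : C * C) (ev a) (ev b) -> a = b.
Proof.
move=> ab; apply/eqP; rewrite -subr_eq0; apply/eqP/ev_eq0.
by apply: near0S2 ab (evB_near a b) => z -> ->; rewrite subrr.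
Qed.

Lemma holo2_ev a : holo2 (ev a).
Proof.
have [r r0 ra] := disc_exists a.
have r4 : 0 < r / 4 by rewrite divr_gt0.
have r4r : r / 4 <= r by rewrite ler_pdivrMr // ler_peMr ?ler1n // ltW.
have [B B0 aB] := disc_le (ltW r4) r4r ra.
exists (fun i j => a i j), (r / 4), B; split => // [n|z z1 z2].
  by under eq_bigr do under eq_bigr do rewrite -mulrA -exprD; apply: aB.
by apply: (ev_cvg r0 ra); split; apply: ltW.
Qed.

Lemma holo2_germ f : holo2 f -> exists a, eq_germ (0 : C * C) f (ev a).
Proof.
case=> A [r [M [r0 AM fA]]].
have T n : rect n n (fun i j => `|A i j| * r ^+ (i + j)) <= M.
  rewrite /rect; under eq_bigr do under eq_bigr do rewrite exprD mulrA; exact: AM.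
have M0 : 0 <= M by have := T 0%N; rewrite /rect big_ord0.
pose s : fps (fps C) := Fps (fun i => Fps (A i)).
have cs : conv s.
  exists (M + 1), r^-1; split; rewrite ?invr_gt0 ?ltr_wpDl // => i j /=.
  apply: le_trans (disc_coef r0 T i j) _; apply: ler_wpM2r; last by rewrite lerDl.
  by rewrite exprn_ge0 // invr_ge0 ltW.
have [rho rho0 rhoa] := disc_exists (mkgerm cs); have [t [t0 tr trho]] := below2 r0 rho0.
exists (mkgerm cs); apply/near0P; exists (t / 8) => [|z z1 z2]; first by rewrite divr_gt0.
have t8 : t / 8 < r.
  by apply: lt_le_trans tr; rewrite ltr_pdivrMr // ltr_pMr // ltr1n.
symmetry; apply: ev_unique; apply: fA; exact: le_lt_trans t8.
Qed.

Lemma iter_d1_coef n : exists m : nat -> nat, (forall i, (0 < m i)%N) /\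
  forall a i j, iter n (@d1 C) a i j = a (i + n)%N j *+ m i.
Proof.
elim: n => [|n [m [m0 mE]]]; first by exists (fun=> 1%N); split=> // a i j; rewrite addn0.
exists (fun i => m i.+1 * i.+1)%N; split=> [i|a i j]; first by rewrite muln_gt0 m0.
by rewrite iterS d1_coef mE -mulrnA addSnnS.
Qed.

Lemma derive1_ev (F : C -> C) a : (\forall t \near (0 : C), F t = ev a (t, 0)) ->
  \forall t \near (0 : C), derive1 F t = ev (d1 a) (t, 0).
Proof.
move=> Fa; have [K [s [K0 s0 H]]] := ev_difference_quotient a.
have ns : \forall t \near (0 : C), `|t| <= s.
  apply/nbhs_normP; exists s => // t; rewrite /ball_ /= sub0r normrN; exact: ltW.
apply: filterS2 (nbhs_interior Fa) ns => t Ft ts.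
rewrite derive1E.
have -> : 'D_1 F t = 'D_1 (fun t => ev a (t, 0)) t by apply: near_eq_derive.
rewrite -derive1E.
apply: (quotient_lim K0 s0) => h hs; rewrite [h + t]addrC.
by apply: H => //; rewrite normr0 ltW.
Qed.

Lemma derive1n_ev (F : C -> C) a n : (\forall t \near (0 : C), F t = ev a (t, 0)) ->
  (derive1n n F 0 == 0) = (a n 0%N == 0).
Proof.
move=> Fa.
have H : \forall t \near (0 : C), derive1n n F t = ev (iter n (@d1 C) a) (t, 0).
  by elim: n => [//|n IH]; rewrite /derive1n !iterS; apply: derive1_ev.
have [m [m0 mE]] := iter_d1_coef n.
have /= -> := nbhs_singleton H.
by rewrite [ev _ _](ev_at0) mE mulrn_eq0 eqn0Ngt m0.
Qed.

(** The terms of the series at r / 2 tend to 0, hence are bounded, which is the coefficient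
    estimate. A function of one variable becomes a germ constant in Y. *)
Lemma holo1_germ (F : C -> C) : holo1 F -> exists2 a,
  xonly a & \forall t \near (0 : C), forall y, F t = ev a (t, y).
Proof.
case=> A [r [r0 FA]].
have r2 : 0 < r / 2 by rewrite divr_gt0.
have r2r : `|r / 2| < r by rewrite gtr0_norm // ltr_pdivrMr // ltr_pMr // ltr1n.
have [M M0 AM] : exists2 M : C, 0 < M & forall n, `|A n| <= M * (r / 2)^-1 ^+ n.
  have cA : cvgn (series (fun n => A n * (r / 2) ^+ n)).
    by apply/cvg_ex; exists (F (r / 2)); apply: FA.
  have u0 := cvg_series_cvg_0 cA.
  have [M [Mr HM]] : bounded_fun (fun n => A n * (r / 2) ^+ n).
    by apply: cvg_seq_bounded; apply/cvg_ex; exists 0.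
  exists (`|M| + 1) => [|n]; first by rewrite ltr_wpDl.
  rewrite exprVn ler_pdivlMr ?exprn_gt0 //.
  have M1 : M < `|M| + 1 by apply: le_lt_trans (real_ler_norm Mr) _; rewrite ltrDl.
  by have := HM _ M1 n I; rewrite /= normrM normrX [`|r / 2|]gtr0_norm.
pose s : fps (fps C) := Fps (fun i => fps_const (A i)).
have cs : conv s.
  exists M, (r / 2)^-1; split; rewrite ?invr_gt0 // => i j /=.
  case: eqP => [->|_]; first by rewrite addn0.
  by rewrite normr0 mulr_ge0 ?exprn_ge0 ?invr_ge0 // ltW.
exists (mkgerm cs); first by move=> i [|j].
apply/nbhs_normP; exists r => // t; rewrite /ball_ /= sub0r normrN => tr y.
symmetry; apply: ev_unique; have := FA t tr; rewrite /series /=.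
move/cvgn_ext; apply => -[|n]; first by rewrite big_geq // /psum /rect big_ord0.
rewrite big_mkord; apply: eq_bigr => i _.
rewrite big_ord_recl big1 ?addr0 => [|j _]; first by rewrite /term /= expr0 mulr1.
by rewrite /term /= !mul0r.
Qed.

Lemma discN r a : 0 < r -> disc r a -> disc r (- a).
Proof.
move=> r0 ra; have -> : - a = gC (-1) * a by rewrite rmorphN rmorph1 mulN1r.
by apply: discM => //; apply: disc_gC.
Qed.

Lemma evB r a b z : 0 < r -> disc r a -> disc r b -> pdisc r z ->
  ev (a - b) z = ev a z - ev b z.
Proof.
move=> r0 ra rb zr; have -> : - b = gC (-1) * b by rewrite rmorphN rmorph1 mulN1r.
have rc : disc r (gC (-1)) := disc_gC r _.
by rewrite (evD r0 ra (discM r0 rc rb) zr) (evM r0 rc rb zr) ev_gC mulN1r.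
Qed.

Lemma ev_exp r a z n : 0 < r -> disc r a -> pdisc r z -> ev (a ^+ n) z = ev a z ^+ n.
Proof.
move=> r0 ra zr; elim: n => [|n IH]; first by rewrite !expr0 ev1.
by rewrite !exprS (evM r0 ra (disc_exp n r0 ra) zr) IH.
Qed.

Lemma ev_sum r n (F : 'I_n -> germ) z : 0 < r -> (forall i, disc r (F i)) ->
  pdisc r z -> ev (\sum_(i < n) F i) z = \sum_(i < n) ev (F i) z.
Proof.
move=> r0; elim: n F => [|n IH] F rF zr; first by rewrite !big_ord0 ev0.
rewrite !big_ord_recl (evD r0 (rF _) _ zr) ?IH //.
by apply: disc_sum.
Qed.

(** If t r <= d / 2 with d <= 1, the terms of degree k >= 1 are at most N d 2^-k; d is chosen so
    that 4 N d <= s. *)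
Lemma disc_small b s : b 0%N 0%N = 0 -> 0 < s -> exists2 r0 : C, 0 < r0 &
  forall r, 0 < r -> r <= r0 ->
    forall n, rect n n (fun i j => `|b i j| * r ^+ (i + j)) <= s.
Proof.
move=> b0 s0; have [N [t [N0 t0 bN]]] := germ_conv b.
pose d : C := s / (4 * N + s).
have Ns : 0 < 4 * N + s by rewrite addr_gt0 // mulr_gt0.
have d0 : 0 < d by rewrite divr_gt0.
have d1 : d <= 1 by rewrite ler_pdivrMr // mul1r lerDr mulr_ge0 // ltW.
have Nd : 4 * (N * d) <= s.
  have -> : 4 * (N * d) = s * (4 * N / (4 * N + s)) by rewrite /d; ring.
  by rewrite ler_piMr ?(ltW s0) // ler_pdivrMr // mul1r lerDl ltW.
exists (d / (2 * t)) => [|r r0 rd n]; first by rewrite divr_gt0 // mulr_gt0.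
have P i j : 0 <= `|b i j| * r ^+ (i + j) by rewrite mulr_ge0 // exprn_ge0 // ltW.
apply: le_trans Nd; rewrite -[leLHS]ger0_norm; last first.
  by apply: sumr_ge0 => i _; apply: sumr_ge0.
apply: rect_half => [|i j]; first by rewrite mulr_ge0 // ltW.
rewrite ger0_norm //.
have [/eqP|ij0] := posnP (i + j).
  rewrite addn_eq0 => /andP[/eqP -> /eqP ->]; rewrite b0 normr0 mul0r.
  by rewrite !mulr_ge0 ?exprn_ge0 ?invr_ge0 // ltW.
apply: le_trans (ler_wpM2r (exprn_ge0 _ (ltW r0)) (bN i j)) _.
rewrite -mulrA -exprMn -mulrA ler_pM2l //.
have tr : t * r <= d * 2^-1.
  rewrite mulrC -ler_pdivlMr //.
  by have -> : d * 2^-1 / t = d / (2 * t) by rewrite invfM; ring.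
have tr0 : 0 <= t * r by rewrite mulr_ge0 // ltW.
have dh : 0 <= d * 2^-1 by rewrite mulr_ge0 ?invr_ge0 // ltW.
apply: le_trans (_ : (d * 2^-1) ^+ (i + j) <= _); first by rewrite lerXn2r ?nnegrE.
rewrite exprMn ler_wpM2r ?exprn_ge0 ?invr_ge0 //.
by case: (i + j)%N ij0 => // k _; rewrite exprS ler_piMr ?(ltW d0) // exprn_ile1 ?(ltW d0).
Qed.

Lemma near_comp b1 b2 (P : C * C -> Prop) : b1 0%N 0%N = 0 -> b2 0%N 0%N = 0 ->
  (\forall w \near (0 : C * C), P w) ->
  \forall z \near (0 : C * C), P (ev b1 z, ev b2 z).
Proof.
move=> b10 b20 /near0P[s s0 HP].
have [r1 r10 H1] := disc_small b10 s0; have [r2 r20 H2] := disc_small b20 s0.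
have [r [r0 rr1 rr2]] := below2 r10 r20.
have E b z : (forall n, rect n n (fun i j => `|b i j| * r ^+ (i + j)) <= s) ->
    pdisc r z -> `|ev b z| <= s.
  move=> bs zr; have rb : disc r b by exists s => //; apply: ltW.
  rewrite -[ev b z]subr0; apply: (lim_norm_le (ev_cvg r0 rb zr)) => n; rewrite subr0.
  apply: le_trans (bs n); apply: le_trans (ler_norm_sum _ _ _) (ler_sum _ _) => i _.
  apply: le_trans (ler_norm_sum _ _ _) (ler_sum _ _) => j _.
  have [z1 z2] := zr; have r4 : r / 4 <= r by rewrite ler_pdivrMr // ler_peMr ?ler1n // ltW.
  rewrite /term -mulrA normrM ler_wpM2l // normrM !normrX exprD.
  apply: ler_pM; rewrite ?exprn_ge0 // lerXn2r ?nnegrE ?(ltW r0) //.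
    exact: le_trans z1 r4.
  exact: le_trans z2 r4.
by apply: filterS (near_pdisc r0) => z zr; apply: HP; apply: E => // n; [apply: H1 | apply: H2].
Qed.

Definition tord n a := forall i j, (i + j < n)%N -> a i j = 0.

Lemma tordM m n a b : tord m a -> tord n b -> tord (m + n) (a * b).
Proof.
move=> am bn i j ij; rewrite germM big1 // => k _; rewrite big1 // => l _.
have := ltn_ord k; have := ltn_ord l => lj ki.
have [kl|kl] := ltnP (k + l) m; first by rewrite am ?mul0r.
by rewrite bn ?mulr0 //; lia.
Qed.

Lemma tord_exp n b : b 0%N 0%N = 0 -> tord n (b ^+ n).
Proof.
move=> b0; elim: n => [//|n IH]; rewrite exprS -add1n; apply: tordM => // i j.
by case: i => [|i]; case: j.
Qed.

(** As b1^i b2^j has order at least i + j, the coefficient of index (k, l) of the substituted series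
    is a finite sum over i, j <= k + l, which defines [c]. It agrees with the substituted partial
    sum [cn n] below total degree n, and the difference evaluates to O(2^-n). *)
Lemma comp_exists a b1 b2 : b1 0%N 0%N = 0 -> b2 0%N 0%N = 0 ->
  exists c, \forall z \near (0 : C * C), ev c z = ev a (ev b1 z, ev b2 z).
Proof.
move=> b10 b20; have [M [t [M0 t0 aM]]] := germ_conv a.
have [ra ra0 raa] := disc_exists a.
(* On a disc where b1 and b2 have norm at most s = 1 / (2 t), the norm of a_ij b1^i b2^j is at most
   M 2^-(i+j). *)
pose s : C := (2 * t)^-1; have s0 : 0 < s by rewrite invr_gt0 mulr_gt0.
have ts : t * s = 2^-1 by rewrite /s; field; rewrite gt_eqF.
have [r1 r10 H1] := disc_small b10 s0; have [r2 r20 H2] := disc_small b20 s0.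
have [r [r0 rr1 rr2]] := below2 r10 r20.
pose p i j := b1 ^+ i * b2 ^+ j.
have pB i j n : rect n n (fun k l => `|p i j k l| * r ^+ (k + l)) <= s ^+ (i + j).
  rewrite exprD; apply: discM_bound => // m; apply: disc_exp_bound => // l.
    exact: H1.
  exact: H2.
have pcoef i j k l : `|p i j k l| <= s ^+ (i + j) * r^-1 ^+ (k + l).
  exact: (disc_coef r0 (pB i j)).
have p0 i j k l : (k + l < i + j)%N -> p i j k l = 0.
  by apply: tordM; apply: tord_exp.
pose F k l i j := a i j * p i j k l.
have FB k l i j : `|F k l i j| <= M * r^-1 ^+ (k + l) * 2^-1 ^+ (i + j).
  rewrite normrM; apply: le_trans (ler_pM _ _ (aM i j) (pcoef i j k l)) _ => //.
  by rewrite -ts exprMn le_eqVlt; apply/orP; left; apply/eqP; ring.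
have rV k : 0 <= M * r^-1 ^+ k by rewrite mulr_ge0 ?exprn_ge0 ?invr_ge0 // ltW.
have RB n k l : `|rect n n (F k l)| <= 4 * M * r^-1 ^+ (k + l).
  by rewrite -mulrA; apply: rect_half.
pose cs : fps (fps C) := Fps (fun k => Fps (fun l => rect (k + l).+1 (k + l).+1 (F k l))).
have ccs : conv cs.
  exists (4 * M), r^-1; split; rewrite ?mulr_gt0 ?invr_gt0 // => i j.
  exact: RB.
pose c := mkgerm ccs; exists c.
pose cn n := \sum_(i < n) \sum_(j < n) gC (a i j) * p i j.
have cnE n k l : cn n k l = rect n n (F k l).
  rewrite germ_sum; apply: eq_bigr => i _; rewrite germ_sum.
  by apply: eq_bigr => j _; rewrite gCM_coef.
have agree n k l : (k + l < n)%N -> (c - cn n) k l = 0.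
  move=> kln; rewrite germB cnE; apply/eqP; rewrite subr_eq0; apply/eqP.
  rewrite [LHS](rect_widen (F k l) kln kln); apply: eq_bigr => i _; apply: eq_bigr => j _.
  case: ifP => // ij; rewrite /F p0 ?mulr0 //; lia.
(* At half the radius the coefficient bound 4 M r^-(k+l) of [c] becomes summable. *)
pose r' : C := (2 * r^-1)^-1.
have r'E : r' = r / 2 by rewrite /r'; field; rewrite gt_eqF.
have r'0 : 0 < r' by rewrite r'E divr_gt0.
have r'r : r' <= r by rewrite r'E ler_pdivrMr // ler_peMr ?ler1n // ltW.
have rc : disc r' c.
  apply: (@disc_geometric _ _ (4 * M)) => [||i j]; rewrite ?mulr_gt0 ?invr_gt0 //.
  exact: RB.
have rp i j : disc r' (p i j).
  apply: disc_le (ltW r'0) r'r _; exists (s ^+ (i + j)); last exact: pB.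
  by rewrite exprn_ge0 // ltW.
have rgp i j : disc r' (gC (a i j) * p i j)
  by exact: (discM r'0 (disc_gC r' (a i j)) (rp i j)).
have rcn n : disc r' (cn n).
  by apply: (disc_sum r'0) => i; apply: (disc_sum r'0).
have rb1 : disc r' b1 by have := rp 1%N 0%N; rewrite /p expr1 expr0 mulr1.
have rb2 : disc r' b2 by have := rp 0%N 1%N; rewrite /p expr1 expr0 mul1r.
apply: near0S2 (near_pdisc r'0) (near_comp b10 b20 (near_pdisc ra0)) => z zr wr.
apply: (@cvgn_unique R (psum a (ev b1 z, ev b2 z))); last exact: ev_cvg wr.
have evcn n : ev (cn n) z = psum a (ev b1 z, ev b2 z) n.
  rewrite (ev_sum r'0 _ zr) => [|i]; last exact: disc_sum.
  apply: eq_bigr => i _; rewrite (ev_sum r'0 _ zr) //; apply: eq_bigr => j _.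
  rewrite (evM r'0 (disc_gC _ _) (rp i j) zr) ev_gC.
  by rewrite /p (evM r'0 (disc_exp i r'0 rb1) (disc_exp j r'0 rb2) zr)
    (ev_exp _ r'0 rb1 zr) (ev_exp _ r'0 rb2 zr) mulrA.
have small : (fun n => ev (c - cn n) z) @ \oo --> (0 : C).
  apply: (@geometric_cvg0 _ _ (4 * (8 * M))) => [|n]; first by rewrite !mulr_ge0 // ltW.
  apply: (ev_bound r'0 _ zr); [|by rewrite mulr_ge0 // ltW| |exact: agree].
    exact: discD r'0 rc (discN r'0 (rcn n)).
  move=> i j; have [z1 z2] := zr; rewrite /term -mulrA normrM.
  have r4 : 0 <= r' / 4 by rewrite divr_ge0 // ltW.
  have zz : `|z.1 ^+ i * z.2 ^+ j| <= (r' / 4) ^+ (i + j).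
    by rewrite normrM !normrX exprD; apply: ler_pM; rewrite ?exprn_ge0 // lerXn2r ?nnegrE.
  have cc : `|(c - cn n) i j| <= 8 * M * r^-1 ^+ (i + j).
    have -> : 8 * M * r^-1 ^+ (i + j) = 4 * M * r^-1 ^+ (i + j) + 4 * M * r^-1 ^+ (i + j) by ring.
    rewrite germB cnE; apply: le_trans (ler_normB _ _) (lerD _ _); exact: RB.
  apply: le_trans (ler_pM _ _ cc zz) _ => //; rewrite -[leLHS]mulrA -exprMn.
  have -> : r^-1 * (r' / 4) = 2^-1 * 4^-1 by rewrite r'E; field; rewrite gt_eqF.
  rewrite ler_wpM2l ?mulr_ge0 ?(ltW M0) // exprMn ler_piMl ?exprn_ge0 ?invr_ge0 //.
  by rewrite exprn_ile1 ?invr_ge0 // invf_le1 // ler1n.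
have cE : (fun _ : nat => ev c z) @ \oo --> ev c z by apply: cvg_cst.
rewrite -[ev c z]subr0; apply: (cvgn_ext (cvgB cE small)) => n.
by rewrite !fctE /= (evB r'0 rc (rcn n) zr) evcn subKr.
Qed.

End Dictionary.

(** * Substitution and contact with smooth arcs *)

(* A junk value unless b1 and b2 vanish at 0. *)
HB.lock Definition comp (R : realType) (a b1 b2 : germ (Cplx R)) : germ (Cplx R) :=
  xget 0 [set c | \forall z \near (0 : Cplx R * Cplx R),
                    ev c z = ev a (ev b1 z, ev b2 z)].

Section Composition.
Variable R : realType.
Local Notation C := (Cplx R).
Local Notation germ := (germ C).
Local Notation X := (gX C).
Local Notation Y := (gY C).
Implicit Types (a b c f g h u : germ) (z w : C * C).

Lemma near0S4 (P Q S T U : C * C -> Prop) :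
  (forall z, P z -> Q z -> S z -> T z -> U z) ->
  (\forall z \near (0 : C * C), P z) -> (\forall z \near (0 : C * C), Q z) ->
  (\forall z \near (0 : C * C), S z) -> (\forall z \near (0 : C * C), T z) ->
  \forall z \near (0 : C * C), U z.
Proof.
move=> H nP nQ nS nT.
have PQ := near0S2 (fun z => @conj (P z) (Q z)) nP nQ.
have ST := near0S2 (fun z => @conj (S z) (T z)) nS nT.
by apply: near0S2 PQ ST => z [? ?] [? ?]; apply: H.
Qed.

Section Morphism.
Variables b1 b2 : germ.
Hypotheses (b10 : b1 0%N 0%N = 0) (b20 : b2 0%N 0%N = 0).

Lemma comp_ev a :
  \forall z \near (0 : C * C), ev (comp a b1 b2) z = ev a (ev b1 z, ev b2 z).
Proof. by rewrite comp.unlock; apply: (xgetPex 0 (comp_exists a b10 b20)). Qed.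

(** Injectivity of [ev] reduces every law of substitution to an identity between values. *)
Lemma comp_eq a c :
  (\forall z \near (0 : C * C), ev c z = ev a (ev b1 z, ev b2 z)) -> comp a b1 b2 = c.
Proof. by move=> cE; apply: ev_inj; apply: near0S2 (comp_ev a) cE => z -> ->. Qed.

Lemma compD a a' : comp (a + a') b1 b2 = comp a b1 b2 + comp a' b1 b2.
Proof.
apply: comp_eq.
apply: near0S4 (comp_ev a) (comp_ev a') (evD_near (comp a b1 b2) (comp a' b1 b2))
  (near_comp b10 b20 (evD_near a a')) => z E1 E2 E3 E4.
by rewrite E3 E4 E1 E2.
Qed.

Lemma compM a a' : comp (a * a') b1 b2 = comp a b1 b2 * comp a' b1 b2.
Proof.
apply: comp_eq.
apply: near0S4 (comp_ev a) (comp_ev a') (evM_near (comp a b1 b2) (comp a' b1 b2))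
  (near_comp b10 b20 (evM_near a a')) => z E1 E2 E3 E4.
by rewrite E3 E4 E1 E2.
Qed.

Lemma comp_gX : comp X b1 b2 = b1.
Proof. by apply: comp_eq; apply: near0W => z; rewrite ev_gX. Qed.

Lemma comp_gY : comp Y b1 b2 = b2.
Proof. by apply: comp_eq; apply: near0W => z; rewrite ev_gY. Qed.

Lemma comp_gC (c : C) : comp (gC c) b1 b2 = gC c.
Proof. by apply: comp_eq; apply: near0W => z; rewrite !ev_gC. Qed.

Lemma compB a a' : comp (a - a') b1 b2 = comp a b1 b2 - comp a' b1 b2.
Proof. by apply/esym/eqP; rewrite subr_eq -compD subrK. Qed.

Lemma comp_exp a n : comp (a ^+ n) b1 b2 = comp a b1 b2 ^+ n.
Proof.
elim: n => [|n IH]; last by rewrite !exprS compM IH.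
by rewrite !expr0 -(rmorph1 (@gC C)) comp_gC.
Qed.

Lemma comp00 a : comp a b1 b2 0%N 0%N = a 0%N 0%N.
Proof.
rewrite -ev_at0 (nbhs_singleton (comp_ev a)) (ev_at0 b1) (ev_at0 b2) b10 b20.
exact: ev_at0.
Qed.

End Morphism.

Lemma comp_swap a b1 b2 : b1 0%N 0%N = 0 -> b2 0%N 0%N = 0 ->
  comp (swap a) b1 b2 = comp a b2 b1.
Proof.
move=> b10 b20; apply: ev_inj; apply: near0S2 (comp_ev b10 b20 (swap a)) (comp_ev b20 b10 a).
by move=> z E1 E2; rewrite E1 E2 [LHS]ev_swap.
Qed.

Lemma comp_comp a b1 b2 c1 c2 : b1 0%N 0%N = 0 -> b2 0%N 0%N = 0 ->
  c1 0%N 0%N = 0 -> c2 0%N 0%N = 0 ->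
  comp (comp a b1 b2) c1 c2 = comp a (comp b1 c1 c2) (comp b2 c1 c2).
Proof.
move=> b10 b20 c10 c20; symmetry; apply: comp_eq; rewrite ?comp00 //.
apply: near0S4 (comp_ev c10 c20 (comp a b1 b2)) (comp_ev c10 c20 b1)
  (comp_ev c10 c20 b2) (near_comp c10 c20 (comp_ev b10 b20 a)).
by move=> z -> -> ->.
Qed.

Lemma restr_comp a : comp a X 0 = restr a.
Proof.
by apply: comp_eq => //; apply: near0W => z; rewrite ev_restr ev_gX ev0.
Qed.

Lemma comp_xonly_arg a b1 b2 b2' : b1 0%N 0%N = 0 -> b2 0%N 0%N = 0 ->
  b2' 0%N 0%N = 0 -> xonly a -> comp a b1 b2 = comp a b1 b2'.
Proof.
move=> b10 b20 b20' ax; apply: ev_inj; apply: near0S2 (comp_ev b10 b20 a) (comp_ev b10 b20' a).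
by move=> z -> ->; rewrite -(xonly_restr ax) !ev_restr.
Qed.

Lemma comp_xonly_id a b2 : b2 0%N 0%N = 0 -> xonly a -> comp a X b2 = a.
Proof.
move=> b20 ax; rewrite (@comp_xonly_arg a X b2 0) ?gX_coef //.
by rewrite restr_comp xonly_restr.
Qed.

Lemma comp_xonly a b1 b2 : b1 0%N 0%N = 0 -> b2 0%N 0%N = 0 ->
  xonly b1 -> xonly b2 -> xonly (comp a b1 b2).
Proof.
move=> b10 b20 b1x b2x.
suff <- : restr (comp a b1 b2) = comp a b1 b2 by apply: restr_xonly.
by rewrite -restr_comp comp_comp // !restr_comp !xonly_restr.
Qed.

(** Neither b1 nor b2 depends on Y, so a step h in Y moves the second argument by exactly h: both
    sides are limits of the same difference quotients. *)
Lemma d2_comp f b1 b2 : b1 0%N 0%N = 0 -> b2 0%N 0%N = 0 -> xonly b1 -> xonly b2 ->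
  d2 (comp f b1 (b2 + Y)) = comp (d2 f) b1 (b2 + Y).
Proof.
move=> b10 b20 b1x b2x.
have bY0 : (b2 + Y) 0%N 0%N = 0 by rewrite germD b20 gY_coef addr0.
have evx b x y y' : xonly b -> ev b (x, y) = ev b (x, y').
  by move=> bx; rewrite -(xonly_restr bx) !ev_restr.
pose P := comp f b1 (b2 + Y); pose F w := ev f (ev b1 w, ev b2 w + w.2).
have PF : eq_germ (0 : C * C) (ev P) F.
  apply: near0S2 (comp_ev b10 bY0 f) (evD_near b2 Y) => z -> ->.
  by rewrite ev_gY.
symmetry; apply: (comp_eq b10 bY0).
apply: near0S4 (dy_ev P) (eq_germ_dy PF) (near_comp b10 bY0 (dy_ev f)) (evD_near b2 Y).
move=> [x y] <- -> <- ->; rewrite ev_gY !dyE.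
congr (lim (_ @ (0 : C)^')); apply: funext => h; rewrite /F /=.
by rewrite (evx b1 x (y + h) y) // (evx b2 x (y + h) y) // addrA.
Qed.

(** The image of the arc is the graph Y = phi(X) with phi = b2 o b1^-1. Division of f by Y - phi(X)
    leaves some r in C{x} with r o b1 = 0, and this forces r = 0 because b1 is not zero. *)
Lemma smooth_component f b1 b2 : f != 0 -> xonly b1 -> xonly b2 ->
  b1 0%N 0%N = 0 -> b2 0%N 0%N = 0 -> b1 1%N 0%N != 0 -> comp f b1 b2 = 0 ->
  exists g, [/\ irr g, dvd g f & g 0%N 1%N != 0].
Proof.
move=> f0 b1x b2x b10 b20 b11 fb.
have X0 : X 0%N 0%N = 0 by [].
(* Division replaces the inverse function theorem: X - b1(Y) has y-order 1, and the remainder phi(X)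
   of b2(Y) satisfies b2 = phi o b1 after the substitution of (b1, X). *)
pose D := X - swap b1.
have D1 : yord D 1.
  split=> [[|//] _|]; rewrite germB swap_coef.
    by rewrite b10 subr0.
  by rewrite gX_coef sub0r; apply/eqP; rewrite oppr_eq0.
have [q [phi [E phid]]] := weierstrass_division D1 (swap b2).
have phix : xonly phi by move=> i j; apply: phid.
have b2E : b2 = comp phi b1 b2.
  have : comp (swap b2) b1 X = b2 by rewrite comp_swap // comp_xonly_id.
  rewrite E compD // compM // compB // comp_gX // comp_swap // comp_xonly_id //.
  by rewrite subrr mulr0 add0r => {1}<-; apply: comp_xonly_arg.
have phi0 : phi 0%N 0%N = 0 by rewrite -(comp00 b10 b20) -b2E.
pose L := Y - phi.
have L01 : L 0%N 1%N = 1 by rewrite germB gY_coef phix // subr0.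
have L1 : yord L 1.
  split=> [[|//] _|]; first by rewrite germB gY_coef phi0 subr0.
  by rewrite L01; apply/eqP; apply: oner_neq0.
exists L; split; [exact: yord1_irr | | by rewrite L01 oner_neq0].
have [q' [r [fE rd]]] := weierstrass_division L1 f.
have rx : xonly r by move=> i j; apply: rd.
exists q'; rewrite fE; suff -> : r = 0 by rewrite addr0.
have rb : comp r b1 b2 = 0.
  move: fb; rewrite fE compD // compM // compB // comp_gY // -b2E subrr.
  by rewrite mulr0 add0r.
apply/eqP; apply: contraT => r0; have [n [b [rE _ bu]]] := xonly_factor rx r0.
move: rb; rewrite rE compM // comp_exp // comp_gX // => /germ_mulf_eq0[] E0.
  have : b1 ^+ n != 0.
    elim: n {rE E0} => [|n IH]; first by rewrite expr0 oner_neq0.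
    rewrite exprS; apply/eqP => /germ_mulf_eq0[] /eqP; last by rewrite (negPf IH).
    by apply/negP; apply: contraNneq b11 => ->.
  by rewrite E0 eqxx.
by case: bu; rewrite -(comp00 b10 b20) E0.
Qed.

(* Tougeron's implicit function argument: if f vanishes along the arc to more
   than twice the order of f_y, then substituting a + X^e Y for the second
   coordinate and dividing by X^(2e) leaves an equation solvable for Y. *)
Lemma arc_lifting f b1 b2 e m h u : xonly b1 -> xonly b2 ->
  b1 0%N 0%N = 0 -> b2 0%N 0%N = 0 ->
  comp f b1 b2 = X ^+ (2 * e + m.+1) * h -> comp (d2 f) b1 b2 = X ^+ e * u ->
  unit_germ u -> exists b, [/\ xonly b, b 0%N 0%N = 0 & comp f b1 b = 0].
Proof.
move=> b1x b2x b10 b20 fh fu uu.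
have X0 : X 0%N 0%N = 0 by [].
have bY0 : (b2 + Y) 0%N 0%N = 0 by rewrite germD b20 gY_coef addr0.
(* The expansion in Y of f along the displaced arc starts with f and f_y along the original one;
   [P2] collects the terms from Y^2 on. *)
pose P := comp f b1 (b2 + Y).
have rbY k : restr (comp k b1 (b2 + Y)) = comp k b1 b2.
  rewrite -restr_comp comp_comp // !restr_comp rmorphD /= (xonly_restr b1x) (xonly_restr b2x).
  by rewrite -restr_comp comp_gY // addr0.
have [P1 PE] := split_xonly P; have [P2 P1E] := split_xonly P1.
have P1r : restr P1 = comp (d2 f) b1 b2.
  rewrite -rbY -d2_comp // -/P PE d2D (d2_xonly (@restr_xonly _ P)) add0r d2M d2_gY mul1r.
  by rewrite rmorphD rmorphM /= -[restr Y]restr_comp comp_gY // mul0r addr0.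
have {}PE : P = X ^+ (2 * e + m.+1) * h + Y * (X ^+ e * u + Y * P2).
  by rewrite PE rbY fh P1E P1r fu.
have hx : xonly (X ^+ (2 * e + m.+1) * h) by rewrite -fh; apply: comp_xonly.
have ux : xonly (X ^+ e * u) by rewrite -fu; apply: comp_xonly.
(* Displacing by X^e Y makes the linear term X^(2e) u Y and the higher ones multiples of X^(2e); the
   constant term has the larger exponent 2 e + m + 1. So X^(2e) factors out and leaves [G]. *)
pose V := X ^+ e * Y; have V0 : V 0%N 0%N = 0 by rewrite germ00M gY_coef mulr0.
pose Q := comp P2 X V; pose G := X * (X ^+ m * h) + Y * (u + Y * Q).
have PV : comp P X V = X ^+ (2 * e) * G.
  rewrite PE !(compD X0 V0, compM X0 V0 Y, comp_gY X0 V0).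
  rewrite (comp_xonly_id V0 hx) (comp_xonly_id V0 ux) -/Q /V /G exprD exprS mul2n -addnn exprD.
  by ring.
have G00 : G 0%N 0%N = 0 by rewrite germD gXM_0 gYM_0 addr0.
have G01 : G 0%N 1%N = u 0%N 0%N.
  by rewrite germD gXM_0 add0r gYM_S germD gYM_0 addr0.
have G1 : yord G 1 by split=> [[|//] _ //|]; rewrite G01.
(* The implicit function theorem by division: Y = q G + psi(X) with q a unit, and setting Y = psi(X)
   gives G(X, psi) = 0. *)
have [q [psi [YE psid]]] := weierstrass_division G1 Y.
have psix : xonly psi by move=> i j; apply: psid.
have psi0 : psi 0%N 0%N = 0.
  have := congr1 (fun a : germ => a 0%N 0%N) YE.
  by rewrite germD germ00M G00 mulr0 add0r gY_coef => <-.
have q0 : q 0%N 0%N <> 0.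
  move=> q0; have := congr1 (fun a : germ => a 0%N 1%N) YE.
  rewrite germD psix // addr0 yord_coef0 !big_ord_recl big_ord0 q0 mul0r add0r.
  by rewrite [G _ _]G00 mulr0 addr0 gY_coef /= => /eqP; rewrite oner_eq0.
have Gpsi : comp G X psi = 0.
  have := compB X0 psi0 Y psi; rewrite comp_gY // (comp_xonly_id psi0 psix) subrr.
  rewrite [X in comp (X - _)]YE addrK compM // => /germ_mulf_eq0[E0|//].
  by case: q0; rewrite -(comp00 X0 psi0) E0.
exists (b2 + X ^+ e * psi); split.
- by apply: xonlyD => //; apply: xonlyM => //; apply: xonlyX; apply: xonly_gX.
- by rewrite germD germ00M psi0 mulr0 b20 addr0.
have := congr1 (fun a => comp a X psi) PV.
rewrite compM // Gpsi mulr0 => <-.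
rewrite comp_comp // /V compM // comp_exp // comp_gX // comp_gY //.
rewrite /P comp_comp ?germ00M ?psi0 ?mulr0 //.
rewrite compD ?germ00M ?psi0 ?mulr0 // comp_gY ?germ00M ?psi0 ?mulr0 //.
by rewrite !comp_xonly_id ?germ00M ?psi0 ?mulr0.
Qed.

(** Along the arc X^N becomes b1^N, of order exactly N. If f vanished there to an order k > 2 N,
    then f_y would have an order e <= N, and k > 2 e lets [arc_lifting] correct the arc to one
    inside f = 0. Its image is a component with nonzero Y-derivative. *)
Lemma contact_bound f N a b b1 b2 k : f != 0 ->
  (forall g, irr g -> dvd g f -> g 0%N 1%N = 0) ->
  X ^+ N = a * f + b * d2 f ->
  xonly b1 -> xonly b2 -> b1 0%N 0%N = 0 -> b2 0%N 0%N = 0 -> b1 1%N 0%N != 0 ->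
  (forall j, (j < k)%N -> comp f b1 b2 j 0%N = 0) -> (k <= 2 * N)%N.
Proof.
move=> f0 fs XN b1x b2x b10 b20 b11 low; rewrite leqNgt; apply/negP => Nk.
have X0 : X 0%N 0%N = 0 by [].
have hx := comp_xonly f b10 b20 b1x b2x.
have [h hE] : exists h, comp f b1 b2 = X ^+ k * h.
  by apply: gXn_divides => i [|j] ik; [apply: low | apply: hx].
have [b1' b1E] : exists b1', b1 = X * b1'.
  by apply: gX_divides => -[|j] //; apply: b1x.
have b1'0 : b1' 0%N 0%N = b1 1%N 0%N by rewrite b1E gXM_S.
have E : b1 ^+ N = comp a b1 b2 * (X ^+ k * h) + comp b b1 b2 * comp (d2 f) b1 b2.
  have := congr1 (fun c => comp c b1 b2) XN.
  by rewrite comp_exp // comp_gX // compD // !compM // hE.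
have nX c : b1 ^+ N <> X ^+ N.+1 * c.
  move=> Ec; have : b1' ^+ N = X * c.
    by apply: (@gXn_lreg _ N); rewrite -exprMn -b1E Ec exprSr mulrA.
  move/(congr1 (fun w : germ => w 0%N 0%N)); rewrite gXM_0 => /eqP.
  have -> : (b1' ^+ N) 0%N 0%N = b1 1%N 0%N ^+ N.
    by elim: (N) => [|n IH]; rewrite ?germ1 // !exprS germ00M IH b1'0.
  by rewrite expf_eq0 (negPf b11) andbF.
have kE n : (n <= k)%N -> X ^+ k = X ^+ n * X ^+ (k - n) by move=> nk; rewrite -exprD subnKC.
have [p0|pn0] := eqVneq (comp (d2 f) b1 b2) 0.
  apply: (nX (comp a b1 b2 * (X ^+ (k - N.+1) * h))).
  by rewrite E p0 mulr0 addr0 (kE N.+1); [ring | lia].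
have [e [u [pE _ uu]]] := xonly_factor (comp_xonly (d2 f) b10 b20 b1x b2x) pn0.
have [eN|Ne] := leqP e N; last first.
  apply: (nX (comp a b1 b2 * (X ^+ (k - N.+1) * h) + comp b b1 b2 * (X ^+ (e - N.+1) * u))).
  rewrite E pE (kE N.+1); last by lia.
  by rewrite -(subnKC Ne) exprD addKn; ring.
(* Here m = k - (2 e + 1), so that 2 e + m + 1 = k; this uses 2 e <= 2 N < k. *)
have [|c [cx c0 fc]] := @arc_lifting f b1 b2 e (k - (2 * e).+1) h u b1x b2x b10 b20 _ pE uu.
  by rewrite hE; congr (X ^+ _ * _); lia.
have [g [ig gf g01]] := smooth_component f0 b1x cx b10 c0 b11 fc.
by rewrite (fs g ig gf) eqxx in g01.
Qed.

End Composition.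

(** * Germs of functions *)

Section Transfer.
Variable R : realType.
Local Notation C := (Cplx R).
Local Notation germ := (germ C).
Implicit Types (a b c : germ) (f g h : C * C -> C).

Definition reduced_germ a := forall g : germ, irr g -> ~ dvd (g * g) a.
Definition singular_germ a := forall g : germ, irr g -> dvd g a ->
  g 1%N 0%N = 0 /\ g 0%N 1%N = 0.

Lemma irr_swap a : irr a -> irr (swap a).
Proof.
move=> [a0 na aI]; split=> //.
  by apply: contra_neq a0 => /(congr1 (@swap C)); rewrite swapK rmorph0.
move=> b c E; apply: (aI (swap b) (swap c)).
by rewrite -rmorphM -E /= swapK.
Qed.

Lemma dvd_swap a b : dvd a b -> dvd (swap a) (swap b).
Proof. by case=> q ->; exists (swap q); rewrite rmorphM. Qed.

Lemma reduced_swap a : reduced_germ a -> reduced_germ (swap a).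
Proof.
move=> ra g /irr_swap/ra ng /dvd_swap; rewrite rmorphM swapK.
exact: ng.
Qed.

Lemma singular_swap a : singular_germ a -> singular_germ (swap a).
Proof.
move=> sa g /irr_swap/sa H /dvd_swap; rewrite swapK => /H.
by rewrite !swap_coef => -[].
Qed.

Lemma singular_yord a : singular_germ a -> exists d, yord a d.
Proof.
move=> sa; apply: yord_exists; apply: contrapT => H.
have [|b aE] := @gX_divides C a.
  by move=> j; apply: contrapT => aj; apply: H; exists j.
have [|/eqP + _] := sa _ (irr_gX C); first by exists b; rewrite aE mulrC.
by rewrite gX_coef /= oner_eq0.
Qed.

Lemma singular_contact_bound a : reduced_germ a -> singular_germ a ->
  exists n, forall b1 b2 k, xonly b1 -> xonly b2 -> b1 0%N 0%N = 0 -> b2 0%N 0%N = 0 ->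
    b1 1%N 0%N != 0 -> (forall j, (j < k)%N -> comp a b1 b2 j 0%N = 0) -> (k <= n)%N.
Proof.
move=> ra sa; have [d ad] := singular_yord sa.
have [N [p [q E]]] := jacobian_power ad ra.
exists (2 * N)%N => b1 b2 k b1x b2x b10 b20 b11 low.
apply: (contact_bound (yord_neq0 ad) _ E b1x b2x b10 b20 b11 low) => g ig ga.
exact: (sa g ig ga).2.
Qed.

Lemma unit_ev a : unit_germ a -> is_unit (ev a).
Proof.
move=> /unit_germ_inv[b ba]; exists (ev b); first exact: holo2_ev.
by apply: filterS (evM_near b a) => z; rewrite ba ev1 /= mulrC => <-.
Qed.

Lemma is_unit_germ f a : eq_germ (0 : C * C) f (ev a) -> is_unit f -> unit_germ a.
Proof.
move=> fa [v hv fv]; have [b vb] := holo2_germ hv.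
apply: (@unit_germP _ a b); apply: ev_inj.
apply: near0S4 fa fv vb (evM_near a b) => z /= E1 E2 E3 E4.
by rewrite E4 -E1 -E3 ev1.
Qed.

Lemma is_unit_ev f a : eq_germ (0 : C * C) f (ev a) -> unit_germ a -> is_unit f.
Proof.
move=> fa /unit_ev[v hv av]; exists v => //.
by apply: near0S2 fa av => z /= ->.
Qed.

(** Holomorphic factors are represented by germs, and by injectivity of [ev] a factorisation of
    functions is one of germs. *)
Lemma irreducible_ev a : irr a -> irreducible (ev a).
Proof.
move=> [a0 na aI]; split.
- exact: holo2_ev.
- by move=> /ev_eq0 E; rewrite E eqxx in a0.
- by move=> /(is_unit_germ (near0W (fun z => erefl _))).
move=> f g /holo2_germ[b fb] /holo2_germ[c gc] afg.
have E : a = b * c.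
  apply: ev_inj; apply: near0S4 fb gc afg (evM_near b c) => z E1 E2 E3 E4.
  by rewrite E3 E4 /= E1 E2.
by case: (aI b c E) => [/(is_unit_ev fb)|/(is_unit_ev gc)]; [left | right].
Qed.

Lemma divides_ev f a b : eq_germ (0 : C * C) f (ev a) -> dvd b a -> divides (ev b) f.
Proof.
move=> fa [q aE]; exists (ev q); first exact: holo2_ev.
by apply: near0S2 fa (evM_near q b) => z -> /=; rewrite aE.
Qed.

Lemma no_repeated_factor_germ f a : eq_germ (0 : C * C) f (ev a) ->
  no_repeated_factor f -> reduced_germ a.
Proof.
move=> fa nf g /irreducible_ev/nf H /(divides_ev fa)[q hq E]; apply: H; exists q => //.
by apply: near0S2 E (evM_near g g) => z -> /= ->.
Qed.

Lemma no_smooth_component_germ f a : eq_germ (0 : C * C) f (ev a) ->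
  no_smooth_component f -> singular_germ a.
Proof.
move=> fa nf g ig /(divides_ev fa) gf; have := nf _ (irreducible_ev ig) gf.
have -> : submersion0 (ev g) <-> (g 1%N 0%N, g 0%N 1%N) <> (0, 0).
  rewrite /submersion0 (nbhs_singleton (dx_ev g)) (nbhs_singleton (dy_ev g)).
  by rewrite !ev_at0 d1_coef d2_coef !mulr1n.
by move=> /contrapT[].
Qed.

Lemma germ_rel_add f g a b : eq_germ (0 : C * C) f (ev a) -> eq_germ (0 : C * C) g (ev b) ->
  eq_germ (0 : C * C) (fun z => f z + g z) (ev (a + b)).
Proof.
move=> fa gb; apply: near0S4 fa gb (evD_near a b) (near0W (fun=> I)) => z -> -> -> //.
Qed.

Lemma germ_rel_opp f a : eq_germ (0 : C * C) f (ev a) ->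
  eq_germ (0 : C * C) (fun z => - f z) (ev (- a)).
Proof. by move=> fa; apply: near0S2 fa (evN_near a) => z -> ->. Qed.

Lemma germ_rel_mul f g a b : eq_germ (0 : C * C) f (ev a) -> eq_germ (0 : C * C) g (ev b) ->
  eq_germ (0 : C * C) (fun z => f z * g z) (ev (a * b)).
Proof.
move=> fa gb; apply: near0S4 fa gb (evM_near a b) (near0W (fun=> I)) => z -> -> -> //.
Qed.

Lemma germ_rel_exp f a n : eq_germ (0 : C * C) f (ev a) ->
  eq_germ (0 : C * C) (fun z => f z ^+ n) (ev (a ^+ n)).
Proof. by move=> fa; apply: near0S2 fa (evX_near a n) => z -> ->. Qed.

Lemma germ_rel_nat n : eq_germ (0 : C * C) (fun=> n%:R) (ev n%:R).
Proof. by apply: near0W => z; rewrite natr_gC ev_gC. Qed.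

Lemma infl_ev f a : eq_germ (0 : C * C) f (ev a) ->
  eq_germ (0 : C * C) (inflection_germ f) (ev (infl a)).
Proof.
move=> fa; have fx := dx_germ fa; have fy := dy_germ fa.
have fxx := dx_germ fx; have fxy := dy_germ fx; have fyy := dy_germ fy.
rewrite /inflection_germ /infl /=.
by do ![exact: germ_rel_nat | assumption | apply: germ_rel_add | apply: germ_rel_opp
  | apply: germ_rel_exp | apply: germ_rel_mul].
Qed.

Lemma vert_ev f a : eq_germ (0 : C * C) f (ev a) ->
  eq_germ (0 : C * C) (vertex_germ f) (ev (vert a)).
Proof.
move=> fa; have fx := dx_germ fa; have fy := dy_germ fa.
have fxx := dx_germ fx; have fxy := dy_germ fx; have fyy := dy_germ fy.
have fxxx := dx_germ fxx; have fxxy := dy_germ fxx.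
have fxyy := dy_germ fxy; have fyyy := dy_germ fyy.
have fi := infl_ev fa.
rewrite /vertex_germ /vert /=.
by do ![exact: germ_rel_nat | assumption | apply: germ_rel_add | apply: germ_rel_opp
  | apply: germ_rel_exp | apply: germ_rel_mul].
Qed.

(** By [codim_bound] an independent family has at most N d members, which bounds the supremum. *)
Lemma intersection_number_fin f g a b d N p q :
  eq_germ (0 : C * C) f (ev a) -> eq_germ (0 : C * C) g (ev b) -> yord a d ->
  gX C ^+ N = p * a + q * b -> (intersection_number f g < +oo)%E.
Proof.
move=> fa gb ad XN.
apply: (@le_lt_trans _ _ ((N * d)%:R%:E)%E); last exact: ltry.
apply: ge_ereal_sup => _ [n [h [hh ind]] <-]; rewrite lee_fin ler_nat leqNgt; apply/negP => Nn.
have /choice[H hH] : forall i, exists c, eq_germ (0 : C * C) (h i) (ev c).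
  by move=> i; apply: holo2_germ.
have [c [[i ci] [u [v E]]]] := codim_bound H ad XN Nn.
case/eqP: ci; apply: ind; exists (ev u), (ev v); split; try exact: holo2_ev.
have S : eq_germ (0 : C * C) (fun z => \sum_(i < n) c i * h i z)
    (ev (\sum_(i < n) gC (c i) * H i)).
  elim: n h H c {hh Nn i E} hH => [|n IH] h H c hH.
    by apply: near0W => z; rewrite !big_ord0 ev0.
  apply: near0S4 (hH ord0) (evM_near (gC (c ord0)) (H ord0))
    (IH (fun i => h (lift ord0 i)) (fun i => H (lift ord0 i)) (fun i => c (lift ord0 i))
      (fun i => hH _))
    (evD_near (gC (c ord0) * H ord0) (\sum_(i < n) gC (c (lift ord0 i)) * H (lift ord0 i))).
  move=> z E1 E2 E3 E4.
  by rewrite !big_ord_recl E4 E2 -E3 ev_gC E1.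
rewrite E in S.
have T := germ_rel_add (germ_rel_mul (near0W (fun z => erefl (ev u z))) fa)
  (germ_rel_mul (near0W (fun z => erefl (ev v z))) gb).
by apply: near0S2 S T => z -> <-.
Qed.

Lemma near0_line (P : C * C -> Prop) : (\forall z \near (0 : C * C), P z) ->
  \forall t \near (0 : C), P (t, 0).
Proof.
move=> /near0P[r r0 HP]; apply/nbhs_normP; exists r => // t.
rewrite /ball_ /= sub0r normrN => tr; apply: HP; first exact: ltW.
by rewrite normr0 ltW.
Qed.

(** If both linear coefficients vanished, the difference quotients of both coordinates at 0 would
    tend to 0, against the immersion hypothesis. *)
Lemma immersion_germP (alpha : C -> C * C) : immersion_germ alpha ->
  exists b1 b2 : germ, [/\ xonly b1 /\ xonly b2, b1 0%N 0%N = 0, b2 0%N 0%N = 0,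
    (b1 1%N 0%N != 0) || (b2 1%N 0%N != 0) &
    \forall t \near (0 : C), alpha t = (ev b1 (t, 0), ev b2 (t, 0))].
Proof.
move=> [/holo1_germ[b1 b1x E1] /holo1_germ[b2 b2x E2] a0 da].
have aE : \forall t \near (0 : C), alpha t = (ev b1 (t, 0), ev b2 (t, 0)).
  apply: filterS2 E1 E2 => t /(_ 0) /= <- /(_ 0) /= <-.
  by case: (alpha t).
have b0 : (b1 0%N 0%N, b2 0%N 0%N) = 0 :> C * C.
  by rewrite -a0 (nbhs_singleton aE) !(ev_at0).
have b10 : b1 0%N 0%N = 0 by case: b0.
have b20 : b2 0%N 0%N = 0 by case: b0.
exists b1, b2; split => //; apply: contrapT => /negP.
rewrite negb_or !negbK => /andP[/eqP b11 /eqP b21]; apply: da.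
rewrite derive1E.
have -> : 'D_1 alpha 0 = 'D_1 (fun t => (ev b1 (t, 0), ev b2 (t, 0))) (0 : C).
  exact: near_eq_derive.
rewrite -derive1E.
have Q b : b 1%N 0%N = 0 ->
    h^-1 *: (ev b (h + 0, 0) - ev b (0, 0)) @[h --> (0 : C)^'] --> (0 : C).
  move=> b1_0; have [K [s [K0 s0 H]]] := ev_difference_quotient b.
  apply: (@quotient_cvg _ _ _ K s) => // h hs.
  have := H 0 0 h _ _ hs; rewrite normr0 [0 + h]addrC [ev (d1 b) _](ev_at0) d1_coef b1_0 mul0rn.
  by apply; apply: ltW.
apply: (@norm_cvg_lim C (C * C)%type).
exact: (cvg_pair (Q b1 b11) (Q b2 b21)).
Qed.

Lemma contact_orders_finite f a : eq_germ (0 : C * C) f (ev a) ->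
  reduced_germ a -> singular_germ a -> finite_set (contact_orders f).
Proof.
move=> fa ra sa.
have [n Hn] := singular_contact_bound ra sa.
have [m Hm] := singular_contact_bound (reduced_swap ra) (singular_swap sa).
(* One of the two coordinates of the arc has nonzero derivative; n bounds the order in the first
   case, m in the second, after the exchange of coordinates. *)
apply: (@sub_finite_set _ _ `I_(n + m).+1); last exact: finite_II.
move=> k [alpha /immersion_germP[b1 [b2 [[b1x b2x] b10 b20 b11 aE]]]] [low _].
have cE : \forall t \near (0 : C), (f \o alpha) t = ev (comp a b1 b2) (t, 0).
  have H1 := near0_line (comp_ev b10 b20 a).
  have H2 := near0_line (near_comp b10 b20 fa).
  by apply: filterS3 aE H2 H1 => t /= -> -> ->.
have lowc j : (j < k)%N -> comp a b1 b2 j 0%N = 0.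
  by move=> /low /eqP; rewrite (derive1n_ev j cE) => /eqP.
rewrite /= ltnS; case/orP: b11 => [b11|b21].
  by apply: leq_trans (leq_addr _ _); apply: Hn b11 lowc.
apply: leq_trans (leq_addl _ _); apply: (Hm b2 b1) => // j jk.
by rewrite comp_swap // lowc.
Qed.

End Transfer.

Theorem corollary3p7 (R : realType) (f : Cplx R * Cplx R -> Cplx R)
    (f_holo : holo2 f) (f_at0 : f 0 = 0)
    (f_reduced : no_repeated_factor f)
    (f_singular : no_smooth_component f) :
  [/\ finite_set (contact_orders f),
      (intersection_number f (inflection_germ f) < +oo)%E &
      (intersection_number f (vertex_germ f) < +oo)%E].
Proof.
have [a fa] := holo2_germ f_holo.
have ra := no_repeated_factor_germ fa f_reduced.
have sa := no_smooth_component_germ fa f_singular.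
have [d ad] := singular_yord sa.
split; first exact: contact_orders_finite fa ra sa.
  have [N [p [q E]]] := infl_power ad ra sa.
  exact: intersection_number_fin fa (infl_ev fa) ad E.
have [N [p [q E]]] := vert_power ad ra sa.
exact: intersection_number_fin fa (vert_ev fa) ad E.
Qed.
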